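(* Let $i_1,\dots,i_n\in\mathbb{Z}^2$ be the consecutive vertices, listed in clockwise order, of a (not necessarily convex) simple lattice polygon $\Delta=\Delta_{i_1,\dots,i_n}$, and let the potential $W(H)$ be defined by the coefficients $$\omega_{ijk}=\begin{cases} e^{\,\epsilon^{ab}(i_a-j_a)(k_b-j_b)\,(x^i+x^j+x^k)}, & \text{if } \epsilon^{ab}(i_a-j_a)(k_b-j_b)>0,\\ 0, & \text{if } \epsilon^{ab}(i_a-j_a)(k_b-j_b)\le 0,\end{cases}$$ where $x^i$ ($i\in\mathbb{Z}^2$) are formal variables. Then, for all sufficiently large $N$, the highest degree of $\beta$ occurring (with non-zero coefficient) in the correlator $$\langle\Delta_{i_1,\dots,i_n}\rangle:=\sum_{k=0}^{\infty}\frac{\beta^k}{k!}\left\langle H_{i_1i_2}H_{i_2i_3}\cdots H_{i_ni_1}\,(W(H))^k\right\rangle_0$$ is $2\ell^*(\Delta)+n-2$.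
   Context: Index set and matrices. For $N\in\mathbb{N}$ let $I^2_N=\{m=(m_1,m_2)\in\mathbb{Z}^2: |m_1|,|m_2|\le N\}$. Consider Hermitian matrices $H=(H_{ij})_{i,j\in I^2_N}$ of size $(2N+1)^2\times(2N+1)^2$, i.e. $H_{ij}=\overline{H_{ji}}$, with measure $\mathcal{D}H$ given by the product of $dH_{ii}$ over all $i\in I_N^2$ and of $d\,\mathrm{Re}(H_{ij})\,d\,\mathrm{Im}(H_{ij})$ over all unordered pairs $i\neq j$. Gaussian average. For a polynomial $P$ in the matrix entries, $$\langle P(H)\rangle_0=\frac{\int \mathcal{D}H\,P(H)\,e^{-\frac12 \mathrm{Tr}(H^2)}}{\int \mathcal{D}H\,e^{-\frac12 \mathrm{Tr}(H^2)}},$$ so that $\langle H_{ij}H_{kl}\rangle_0=\delta_{il}\delta_{jk}$ (Wick's rule applies); it is extended linearly to polynomials whose coefficients involve the formal variables $x^i$ (the exponentials of these variables are understood as formal power series). Potential. $$W(H)=\frac13\sum_{i,j,k\in I^2_N}\omega_{ijk}H_{ij}H_{jk}H_{ki}.$$ (There is no summation over $i_1,\dots,i_n$ in the correlator.) Sign convention. Each lattice point has components $i=(i_1,i_2)$, and $\epsilon^{ab}$ is the $2\times2$ antisymmetric symbol with $\epsilon^{21}=1=-\epsilon^{12}$, with summation over $a,b\in\{1,2\}$. Thus $\epsilon^{ab}(i_a-j_a)(k_b-j_b)$ is positive exactly when $i,j,k$ are the vertices of a non-degenerate triangle listed in counterclockwise order, and it then equals twice the Euclidean area of that triangle. Interior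 points. $\ell^*(\Delta)$ is the number of points of $\mathbb{Z}^2$ in the interior of the polygon $\Delta$ (i.e. in $\Delta$ but not on its boundary). *)

(* Defs.v *)
From HB Require Import structures.
From mathcomp Require Import all_boot all_order all_algebra finmap.
From mathcomp Require Import all_classical all_reals all_analysis.
From mathcomp Require Import complex zify.

Set Implicit Arguments.
Unset Strict Implicit.
Unset Printing Implicit Defensive.

Import Order.TTheory GRing.Theory Num.Theory.
Import numFieldNormedType.Exports.

Local Open Scope classical_set_scope.
Local Open Scope ring_scope.

(** * Formal power series in finitely many commuting variables *)

Section MultiIndex.
Variable I : finType.
Implicit Types m a b : {ffun I -> nat}.

Definition below m : seq {ffun I -> nat} :=
  [seq [ffun i => val (a i)] | a : {dffun forall i : I, 'I_(m i).+1}].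

Definition splits m : seq ({ffun I -> nat} * {ffun I -> nat}) :=
  [seq (a, [ffun i => (m i - a i)%N]) | a <- below m].

Lemma mem_below m a : (a \in below m) = [forall i, (a i <= m i)%N].
Proof.
apply/fintype.imageP/forallP => [[b _ ->] i|lea]; first by rewrite ffunE -ltnS ltn_ord.
have H i : (a i < (m i).+1)%N by rewrite ltnS.
exists [ffun i => Ordinal (H i)] => //.
by apply/ffunP => i; rewrite !ffunE.
Qed.

Lemma mem_splits m p : (p \in splits m) = (p.1 + p.2 == m).
Proof.
apply/mapP/eqP => [[a]|<-].
  rewrite mem_below => /forallP lea -> /=.
  by apply/ffunP => i; rewrite !ffunE; exact: subnKC.
exists p.1; first by rewrite mem_below; apply/forallP => i; rewrite ffunE leq_addr.
case: p => a b /=; congr pair; apply/ffunP => i; rewrite !ffunE.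
exact/esym/addKn.
Qed.

Lemma uniq_splits m : uniq (splits m).
Proof.
rewrite map_inj_uniq => [|a b []//]; rewrite map_inj_uniq ?enum_uniq //.
move=> a b /ffunP ab; apply/ffunP => i; apply: val_inj.
by have := ab i; rewrite !ffunE.
Qed.

End MultiIndex.

(* A series is its family of coefficients, indexed by exponent vectors. *)
Definition fpseries (I : finType) (K : Type) : Type := {ffun I -> nat} -> K.

Section PSeries.
Variables (I : finType) (K : comNzRingType).
Local Notation PS := (fpseries I K).
Implicit Types f g h : PS.

HB.instance Definition _ := GRing.Lmodule.copy PS ({ffun I -> nat} -> K^o).

Definition ps_one : PS := fun m => (m == 0)%:R.

Definition ps_mul f g : PS := fun m => \sum_(p <- splits m) f p.1 * g p.2.

Definition ps_var (i : I) : PS := fun m => (m == [ffun j => (j == i) : nat])%:R.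

Fact ps_mulC : commutative ps_mul.
Proof.
move=> f g; apply/funext => m; rewrite /ps_mul.
rewrite [RHS](perm_big (map (fun p => (p.2, p.1)) (splits m))).
  by rewrite [RHS]big_map; apply: eq_bigr => p _; rewrite mulrC.
apply: uniq_perm; rewrite ?uniq_splits //.
  by rewrite map_inj_uniq ?uniq_splits // => -[? ?] [? ?] [-> ->].
move=> [a b]; rewrite mem_splits; apply/eqP/mapP => /= [<-|[[c d]]].
  by exists (b, a) => //; rewrite mem_splits addrC.
by rewrite mem_splits => /eqP <- [-> ->]; rewrite addrC.
Qed.

Fact ps_mulA : associative ps_mul.
Proof.
move=> f g h; apply/funext => m; rewrite /ps_mul.
under eq_bigr do rewrite mulr_sumr.
under [RHS]eq_bigr do rewrite mulr_suml.
pose s1 := [seq (p.1, q.1, q.2) | p <- splits m, q <- splits p.2].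
pose s2 := [seq (q.1, q.2, p.2) | p <- splits m, q <- splits p.1].
transitivity (\sum_(t <- s1) f t.1.1 * g t.1.2 * h t.2).
  rewrite big_allpairs_dep; apply: eq_bigr => p _.
  by apply: eq_bigr => q _; rewrite mulrA.
transitivity (\sum_(t <- s2) f t.1.1 * g t.1.2 * h t.2); last first.
  by rewrite big_allpairs_dep.
apply: perm_big; apply: uniq_perm.
- apply: allpairs_uniq_dep => [|p _|]; rewrite ?uniq_splits //.
  move=> _ _ /allpairsPdep[x [y [_ ym ->]]] /allpairsPdep[x' [y' [_ ym' ->]]].
  rewrite /= => -[e1 e2 e3].
  have yy' : y = y' by apply/eqP; rewrite [y]surjective_pairing [y']surjective_pairing xpair_eqE e2 e3 !eqxx.
  move: ym ym'; rewrite !mem_splits yy' => /eqP xy /eqP xy'.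
  by congr existT; rewrite [x]surjective_pairing [x']surjective_pairing e1 -xy -xy'.
- apply: allpairs_uniq_dep => [|p _|]; rewrite ?uniq_splits //.
  move=> _ _ /allpairsPdep[x [y [_ ym ->]]] /allpairsPdep[x' [y' [_ ym' ->]]].
  rewrite /= => -[e1 e2 e3].
  have yy' : y = y' by apply/eqP; rewrite [y]surjective_pairing [y']surjective_pairing xpair_eqE e1 e2 !eqxx.
  move: ym ym'; rewrite !mem_splits yy' => /eqP xy /eqP xy'.
  by congr existT; rewrite [x]surjective_pairing [x']surjective_pairing e3 -xy -xy'.
- move=> [[a b] c]; apply/allpairsPdep/allpairsPdep => -[x [y []]].
  + rewrite !mem_splits => /eqP xm /eqP yx [-> -> ->].
    exists (x.1 + y.1, y.2), (x.1, y.1); rewrite !mem_splits /= eqxx.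
    by rewrite -addrA yx xm eqxx.
  + rewrite !mem_splits => /eqP xm /eqP yx [-> -> ->].
    exists (y.1, y.2 + x.2), (y.2, x.2); rewrite !mem_splits /= eqxx.
    by rewrite addrA yx xm eqxx.
Qed.

Fact ps_mul1 : left_id ps_one ps_mul.
Proof.
move=> f; apply/funext => m; rewrite /ps_mul.
rewrite (bigD1_seq (0, m)) ?uniq_splits ?mem_splits ?add0r //=.
rewrite /ps_one eqxx mul1r big_seq_cond big1 ?addr0 // => -[a b] /andP[].
rewrite mem_splits xpair_eqE /= => /eqP abm.
have [a0|_ _] := eqVneq a 0; last by rewrite mul0r.
by rewrite -abm a0 add0r eqxx.
Qed.

Fact ps_mulDl : left_distributive ps_mul +%R.
Proof.
move=> f g h; apply/funext => m.
transitivity (\sum_(p <- splits m) (f p.1 * h p.2 + g p.1 * h p.2)).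
  by apply: eq_bigr => p _; exact: mulrDl.
exact: big_split.
Qed.

Fact ps_one_neq0 : ps_one != 0.
Proof.
apply/eqP => /(congr1 (fun f : PS => f 0)); rewrite /ps_one eqxx.
exact/eqP/oner_neq0.
Qed.

HB.instance Definition _ := GRing.Zmodule_isComNzRing.Build PS
  ps_mulA ps_mulC ps_mul1 ps_mulDl ps_one_neq0.

End PSeries.

(* The exponential of a series without constant term: [f ^+ k] has no monomial
   of total degree [< k], so each coefficient is a finite sum. *)
Definition ps_exp (I : finType) (K : fieldType) (f : fpseries I K) : fpseries I K :=
  fun m => \sum_(k < (\sum_i m i).+1) (k`!%:R)^-1 * (f ^+ k) m.

(** * Lattice points *)

Definition Z2 : Type := (int * int)%type.

HB.instance Definition _ := Countable.on Z2.

Definition in_box (N : nat) : pred Z2 :=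
  fun m => (`|m.1| <= N)%N && (`|m.2| <= N)%N.

(* The index set I_N^2. *)
Definition box (N : nat) : Type := {m : Z2 | in_box N m}.

Section Box.
Variable N : nat.

HB.instance Definition _ := SubCountable.on (box N).

Let range : seq int := [seq k%:Z - N%:Z | k <- iota 0 N.*2.+1].
Let enum_box : seq (box N) := pmap insub [seq (a, b) | a <- range, b <- range].

Let mem_range a : (`|a| <= N)%N -> a \in range.
Proof.
move=> aN; apply/mapP; exists (absz (a + N%:Z)); last by lia.
by rewrite mem_iota; lia.
Qed.

Fact box_enumP : Finite.axiom enum_box.
Proof.
move=> m; rewrite count_uniq_mem.
  rewrite mem_pmap_sub; case: m => -[a b] /= /andP[aN bN].
  suff -> : (a, b) \in [seq (x, y) | x <- range, y <- range] by [].
  by apply/allpairsP; exists (a, b); rewrite !mem_range.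
apply: pmap_sub_uniq; apply: allpairs_uniq => [||[? ?] [? ?] //].
  by rewrite map_inj_uniq ?iota_uniq // => j k; lia.
by rewrite map_inj_uniq ?iota_uniq // => j k; lia.
Qed.

HB.instance Definition _ := fintype.isFinite.Build (box N) box_enumP.

End Box.

(* [eps^{ab} (i_a - j_a) (k_b - j_b)] with [eps^{21} = 1 = - eps^{12}]. *)
Definition eps3 (i j k : Z2) : int :=
  (i.2 - j.2) * (k.1 - j.1) - (i.1 - j.1) * (k.2 - j.2).

(** * Lattice polygons *)

Section Polygon.
Variables (R : realType) (n : nat) (v : 'I_n -> Z2).

Definition plane (m : Z2) : R * R := (m.1%:~R, m.2%:~R).

Definition edge_point (k : 'I_n) (t : R) : R * R :=
  (1 - t) *: plane (v k) + t *: plane (v (ordS k)).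

(* The closed polygonal line through the vertices, run through once with
   parameters [(k, t)] with [0 <= t < 1], does not meet itself.  Consecutive
   edges may be collinear. *)
Definition simple_polygon : Prop :=
  forall (k l : 'I_n) (s t : R), 0 <= s < 1 -> 0 <= t < 1 ->
    edge_point k s = edge_point l t -> k = l /\ s = t.

(* The signed area enclosed by the polygonal line is negative. *)
Definition clockwise : Prop :=
  \sum_(k < n) ((v k).1 * (v (ordS k)).2 - (v (ordS k)).1 * (v k).2) < 0.

Definition boundary : set (R * R) :=
  [set x | exists k t, 0 <= t <= 1 /\ x = edge_point k t].

(* The boundary together with the bounded components of its complement. *)
Definition polygon : set (R * R) :=
  boundary `|`
  [set x | ~ boundary x /\ bounded_set (connected_component (~` boundary) x)].

(* The set is finite because the polygon is bounded ([fset_set] of an infinite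
   set would be empty). *)
Definition ell_star : nat :=
  let interior_points := [set m : Z2 | (polygon `\` boundary) (plane m)] in
  #|` fset_set interior_points|%fset.

End Polygon.

(** * Gaussian average over Hermitian matrices *)

Section Gauss.
Variable R : realType.
Local Notation C := R[i].

Definition tuple_cons n (z : n.-tuple (measurableTypeR R) * measurableTypeR R) :
    n.+1.-tuple (measurableTypeR R) := [tuple of z.2 :: z.1].

Fact measurable_tuple_cons n : measurable_fun [set: _] (@tuple_cons n).
Proof. exact: measurable_cons. Qed.

Definition cons_measure n
    (mu : {measure set (n.-tuple (measurableTypeR R)) -> \bar R}) :
    set (n.+1.-tuple (measurableTypeR R)) -> \bar R :=
  pushforward (product_measure1 mu (@lebesgue_measure R)) (@tuple_cons n).

HB.instance Definition _ n mu := Measure.copy (@cons_measure n mu)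
  (measure_function_pushforward__canonical__measure_function_Measure
     (product_measure1 mu (@lebesgue_measure R)) (@measurable_tuple_cons n)).

(* Lebesgue measure on R^n, as an iterated product of Lebesgue measures on R. *)
Fixpoint lebesgue_tuple n :
    {measure set (n.-tuple (measurableTypeR R)) -> \bar R} :=
  match n with
  | 0 => dirac [tuple]
  | n'.+1 => cons_measure (lebesgue_tuple n')
  end.

(* Hermitian matrices in the coordinates [H_ii], [Re H_ij] and [Im H_ij]
   for [i < j], stored at positions (i, i), (i, j) and (j, i). *)
Definition herm_of d (u : (d * d).-tuple (measurableTypeR R)) : 'M[C]_d :=
  let c i j : R := tnth u (mxvec_index i j) in
  \matrix_(i, j)
    if (i == j)%N then (c i i)%:C%C
    else if (i < j)%N then (c i j +i* c j i)%C else (c j i -i* c i j)%C.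

Definition gauss_weight d (H : 'M[C]_d) : R :=
  expR (- (complex.Re (\tr (H *m H)) / 2)).

(* [\int DH f(H)], computed on real and imaginary parts. *)
Definition hermitian_integral d (f : 'M[C]_d -> C) : C :=
  ((\int[lebesgue_tuple (d * d)]_u complex.Re (f (herm_of u)))
   +i* (\int[lebesgue_tuple (d * d)]_u complex.Im (f (herm_of u))))%C.

Definition gauss_avg d (P : 'M[C]_d -> C) : C :=
  hermitian_integral (fun H => P H * (gauss_weight H)%:C%C) /
  hermitian_integral (fun H : 'M[C]_d => (gauss_weight H)%:C%C).

(* Linear extension to polynomials with power series coefficients. *)
Definition gauss_avg_ps d (I : finType) (P : 'M[C]_d -> fpseries I C) :
    fpseries I C :=
  fun m => gauss_avg (fun H => P H m).

End Gauss.

(** * The matrix model *)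

Section Model.
Variables (R : realType) (N : nat).
Local Notation C := R[i].
Local Notation PS := (fpseries (box N) C).

Definition hmatrix : Type := 'M[C]_#|{: box N}|.

Definition entry (H : hmatrix) (i j : box N) : C :=
  H (enum_rank i) (enum_rank j).

(* Only the variables [x^i] with [i] in the box occur for a given [N]. *)
Definition omega (i j k : box N) : PS :=
  let e := eps3 (val i) (val j) (val k) in
  if 0 < e then ps_exp (e%:~R *: (ps_var C i + ps_var C j + ps_var C k)) else 0.

Definition potential (H : hmatrix) : PS :=
  3^-1 *: \sum_i \sum_j \sum_k
    (entry H i j * entry H j k * entry H k i) *: omega i j k.

(* Coefficient of [beta ^ k] in the correlator. *)
Definition correlator n (i : 'I_n -> box N) (k : nat) : PS :=
  (k`!%:R)^-1 *:
  gauss_avg_ps (fun H : hmatrix =>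
    (\prod_(a < n) entry H (i a) (i (ordS a))) *: potential H ^+ k).

End Model.

(* [d] is the highest degree occurring in [\sum_k c k * beta ^ k]. *)
Definition highest_degree (V : zmodType) (c : nat -> V) (d : nat) : Prop :=
  c d != 0 /\ forall k, (d < k)%N -> c k = 0.

(* Main.v *)
From HB Require Import structures.
Require Import Defs.
From mathcomp Require Import all_boot all_order all_algebra finmap.
From mathcomp Require Import all_classical all_reals all_analysis.
From mathcomp Require Import measurable_realfun complex zify ring lra.

Set Implicit Arguments.
Unset Strict Implicit.
Unset Printing Implicit Defensive.

Import Order.TTheory GRing.Theory Num.Theory.
Import numFieldNormedType.Exports.

Local Open Scope classical_set_scope.
Local Open Scope ring_scope.

(* By Wick's rule, which follows from Gaussian integration by parts, a monomial
   in off-diagonal entries of H has a nonzero, and then positive, average exactly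
   when H_ij and H_ji occur equally often for all i, j.  The coefficient of beta^k
   is therefore nonzero if and only if there are k counterclockwise lattice
   triangles whose edges cancel, as a 1-chain, the edges of the polygon.

   Such triangles fill the polygon, so every crossing number of the polygon is
   the sum of those of the triangles.  Since the angles of a triangle add up to a
   half-turn, exactly one of its corners is such that a displacement by
   (delta, 1) or by -(delta, 1), with delta infinitesimal, leads inside.  Hence
   the number of triangles is a sum over corners p of contributions bounded by
   the crossing numbers of the polygon at the two displacements of p: at most 2
   for an interior point, 0 for a boundary point that is not a vertex, and n - 2
   for all vertices together, as a triangulation along diagonals shows.
   Conversely, inserting the interior lattice points one at a time into such a
   triangulation, which has n - 2 triangles, adds two triangles per point, whether
   the point lies inside a triangle or on an edge shared by two. *)

(** * Crossing numbers of polygonal lines *)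

(** A priori the triangles of a Wick contraction form only a 2-chain: they may overlap, and their
    corners are arbitrary lattice points. Comparing areas does not give the bound. A lattice
    triangle has at least 1 as twice its area, and Pick's formula turns this into 2 l* + b - 2,
    where b counts all boundary lattice points and not only the n vertices. The pair of opposite
    displacements removes the excess: at a boundary point that is not a vertex one of them leads
    outside, where nothing can be counted, and the corners at such a point close up around it, so
    that the counts for the two displacements agree and both vanish. For the lower bound no
    cancellation can occur: every nonzero [omega] has constant term 1 in the variables x, so the
    constant term of the coefficient of beta^k is a sum of nonnegative numbers. The Jordan curve
    theorem and the triangulation are proved for either orientation, recorded by a number k in {0,
    1}; only afterwards does the shoelace sum over a triangulation show that k = 1 for a clockwise
    polygon. *)

Section Crossing.
Variable R : realType.
Local Notation pt := (R * R)%type.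
Implicit Types (x y q p : pt) (e : pt * pt) (c t : R).

Definition lin x y t : pt := ((1 - t) * x.1 + t * y.1, (1 - t) * x.2 + t * y.2).

Definition seg e : set pt := [set q | exists t, 0 <= t <= 1 /\ q = lin e.1 e.2 t].
Definition hseg e : set pt := [set q | exists t, 0 <= t < 1 /\ q = lin e.1 e.2 t].
Definition oseg e : set pt := [set q | exists t, 0 < t < 1 /\ q = lin e.1 e.2 t].

(* Twice the signed area of the triangle, positive for clockwise triangles. *)
Definition orient x y q : R :=
  (y.2 - x.2) * (q.1 - x.1) - (y.1 - x.1) * (q.2 - x.2).

(* Signed crossing of the edge with an upward ray from a point infinitesimally
   displaced from [q] in the direction [(delta, 1)], resp. [- (delta, 1)], with
   [delta] a positive infinitesimal. *)
Definition crossp q e : int :=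
  ((e.1.1 <= q.1 < e.2.1) && (0 < orient e.1 e.2 q))%:Z
  - ((e.2.1 <= q.1 < e.1.1) && (0 < orient e.2 e.1 q))%:Z.
Definition crossm q e : int :=
  ((e.1.1 < q.1 <= e.2.1) && (0 <= orient e.1 e.2 q))%:Z
  - ((e.2.1 < q.1 <= e.1.1) && (0 <= orient e.2 e.1 q))%:Z.

Lemma crosspN q x y : crossp q (x, y) = - crossp q (y, x).
Proof. by rewrite /crossp opprB. Qed.

Lemma crossmN q x y : crossm q (x, y) = - crossm q (y, x).
Proof. by rewrite /crossm opprB. Qed.

Lemma linC x y t : lin x y t = lin y x (1 - t).
Proof. by rewrite /lin; congr pair; ring. Qed.

Lemma lin0 x y : lin x y 0 = x.
Proof. by case: x => a b; rewrite /lin; congr pair => /=; ring. Qed.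

Lemma lin1 x y : lin x y 1 = y.
Proof. by case: y => a b; rewrite /lin; congr pair => /=; ring. Qed.

Lemma segC x y : seg (x, y) = seg (y, x).
Proof.
by apply/seteqP; split=> q [t [t01 ->]]; exists (1 - t); (split; [lra|]); rewrite linC.
Qed.

Lemma orient_lin x y a b t :
  orient x y (lin a b t) = (1 - t) * orient x y a + t * orient x y b.
Proof. by rewrite /orient /lin /=; ring. Qed.

Definition height x y c : R := x.2 + (y.2 - x.2) / (y.1 - x.1) * (c - x.1).

Lemma orient_height x y q : x.1 < y.1 ->
  orient x y q = (y.1 - x.1) * (height x y q.1 - q.2).
Proof.
by move=> xy; rewrite /orient /height; field; lra.
Qed.

Lemma below_height x y q : x.1 < y.1 -> (0 < orient x y q) = (q.2 < height x y q.1).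
Proof.
by move=> xy; rewrite orient_height// pmulr_rgt0 ?subr_gt0.
Qed.

Lemma height_seg x y c : x.1 < y.1 -> x.1 <= c <= y.1 -> seg (x, y) (c, height x y c).
Proof.
move=> xy cxy; exists ((c - x.1) / (y.1 - x.1)); split.
  by rewrite divr_ge0 ?ler_pdivrMr /=; lra.
by rewrite /lin /height /=; congr pair; field; lra.
Qed.

(** The gap between the two heights is affine in the abscissa and changes sign, so linear
    interpolation between [a] and [b] gives its zero explicitly. *)
Lemma height_crossing x y q r a b :
  x.1 < y.1 -> q.1 < r.1 -> a <= b ->
  x.1 <= a -> b <= y.1 -> q.1 <= a -> b <= r.1 ->
  (height x y a - height q r a) * (height x y b - height q r b) <= 0 ->
  exists p, seg (x, y) p /\ seg (q, r) p.
Proof.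
move=> xy qr ab xa yb qa rb.
set ga := _ - _; set gb := (_ - _ in X in _ * X).
move=> gab.
suff [c [cab gc]] : exists c, a <= c <= b /\ height x y c = height q r c.
  exists (c, height x y c); split; first by apply: height_seg => //; lra.
  by rewrite gc; apply: height_seg => //; lra.
have [gE|gE] := eqVneq ga gb.
  exists a; split; first by lra.
  suff : ga = 0 by rewrite /ga; lra.
  by apply/eqP; rewrite -sqrf_eq0 expr2 eq_le {2}gE gab -expr2 sqr_ge0.
exists (a + (b - a) * (ga / (ga - gb))); split.
  have gd : ga - gb != 0 by rewrite subr_eq0.
  have /andP[r0 r1] : 0 <= ga / (ga - gb) <= 1.
    have [g0|g0] := ltrP 0 (ga - gb).
      by rewrite divr_ge0 ?ler_pdivrMr ?mul1r; nra.
    have gn : ga - gb < 0 by rewrite lt_neqAle gd.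
    by rewrite ler_ndivrMr // mul1r mulr_le0// ?invr_le0; nra.
  by apply/andP; split; nra.
apply/eqP; rewrite -subr_eq0; apply/eqP.
transitivity (ga + (gb - ga) * (ga / (ga - gb))).
  rewrite /ga /gb /height.
  have h1 : y.1 - x.1 != 0 by lra.
  have h2 : r.1 - q.1 != 0 by lra.
  set u := (y.2 - x.2) / _; set v := (r.2 - q.2) / _.
  set w := (_ / _). ring.
by field; rewrite subr_eq0.
Qed.

Lemma height_r x y : x.1 < y.1 -> height x y y.1 = y.2.
Proof. by move=> xy; rewrite /height; field; lra. Qed.

Lemma height_l x y : height x y x.1 = x.2.
Proof. by rewrite /height subrr mulr0 addr0. Qed.

End Crossing.

Section Crossing2.
Variable R : realType.
Local Notation pt := (R * R)%type.
Implicit Types (x y z q p : pt) (e : pt * pt) (c : R).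

Lemma itv_coF (a b z : R) : b <= a -> (a <= z < b) = false.
Proof. by move=> ba; apply/negP => /andP[az /(le_lt_trans az)]; rewrite ltNge ba. Qed.

Lemma itv_ocF (a b z : R) : b <= a -> (a < z <= b) = false.
Proof. by move=> ba; apply/negP => /andP[/lt_le_trans az /az]; rewrite ltNge ba. Qed.

Lemma seg_vertical x y c : x.1 = y.1 -> (c - x.2) * (c - y.2) <= 0 ->
  seg (x, y) (x.1, c).
Proof.
move=> xy h; have [e|ne] := eqVneq x.2 y.2.
  exists 0; split; first by lra.
  rewrite lin0 /=; case: x xy h e => /= a b _ h e; congr pair.
  apply/eqP; rewrite -subr_eq0 -sqrf_eq0 expr2 eq_le -expr2 sqr_ge0 andbT.
  by rewrite expr2 {2}e.
exists ((c - x.2) / (y.2 - x.2)); split; last first.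
  have d : y.2 - x.2 != 0 by lra.
  by rewrite /lin /= -xy; congr pair; field.
have [l|l] := ltrP x.2 y.2.
  by rewrite divr_ge0 ?ler_pdivrMr /=; nra.
have l' : y.2 < x.2 by rewrite lt_neqAle eq_sym ne.
rewrite -mulrNN -invrN divr_ge0 ?ler_pdivrMr /=; nra.
Qed.

(** As the base point moves from [q] to [r], its upward ray sweeps the strip above [[q, r]]. An edge
    that misses [[q, r]] enters or leaves this strip only through the two bounding rays or by ending
    inside. Hence the change of the crossing number is a coboundary, which cancels around a closed
    line. The half-open range in [phi] matches those in [crossp]. *)
Lemma crossp_free q r x y : q.1 <= r.1 ->
  (forall p, seg (q, r) p -> ~ seg (x, y) p) ->
  let phi z : int := ((q.1 < z.1 <= r.1) && (orient q r z < 0))%:Z in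
  crossp q (x, y) - crossp r (x, y) = phi y - phi x.
Proof.
move=> qr; wlog xy : x y / x.1 <= y.1 => [hw|].
  have [xy|/ltW yx] := leP x.1 y.1; first exact: hw.
  move=> fr /=; rewrite (crosspN q x y) (crosspN r x y).
  by have := hw _ _ yx; rewrite (segC y x) => /(_ fr) /=; lia.
move=> fr phi.
(* Without a common point, the height gap has the same sign at both ends of every common range of
   abscissas. *)
have gapP a b : q.1 < r.1 -> x.1 < y.1 -> a <= b -> x.1 <= a -> b <= y.1 -> q.1 <= a -> b <= r.1 ->
   (height x y a < height q r a) = (height x y b < height q r b) /\
   (height q r a < height x y a) = (height q r b < height x y b).
  move=> qr' xy' ab xa yb qa rb.
  have h : 0 < (height x y a - height q r a) * (height x y b - height q r b).
    rewrite ltNge; apply/negP => h.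
    by have [p [p1 p2]] := height_crossing xy' qr' ab xa yb qa rb h; exact: (fr p).
  by split; apply/idP/idP; nra.
have phiE z : q.1 < z.1 -> phi z = ((z.1 <= r.1) && (height q r z.1 < z.2))%:Z.
  move=> qz; rewrite /phi qz /=; have [zr|//] /= := lerP z.1 r.1.
  have qr' : q.1 < r.1 by lra.
  by rewrite orient_height // pmulr_rlt0 ?subr_gt0 // subr_lt0.
have phi0 z : z.1 <= q.1 \/ r.1 < z.1 -> phi z = 0.
  by rewrite /phi => -[h|h]; rewrite (_ : (q.1 < z.1 <= r.1) = false) //; lra.
have crE z : x.1 < y.1 -> crossp z (x, y) = ((x.1 <= z.1 < y.1) && (z.2 < height x y z.1))%:Z.
  move=> xy'; rewrite /crossp /= below_height //.
  by rewrite (itv_coF _ (ltW xy')) subr0.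
have [xy'|yx] := ltrP x.1 y.1; last first.
  have exy : x.1 = y.1 by lra.
  have cr0 z : crossp z (x, y) = 0.
    by rewrite /crossp /= exy !itv_coF.
  rewrite !cr0; have [xq|qx] := lerP x.1 q.1.
    by rewrite !phi0 //; left; lra.
  have qy : q.1 < y.1 by rewrite -exy.
  rewrite !phiE // -exy. have [xr|//] := lerP x.1 r.1; rewrite /=.
  suff : (height q r x.1 < y.2) = (height q r x.1 < x.2) by move=> ->; rewrite !subrr.
  have qr' : q.1 < r.1 by lra.
  have h : 0 < (height q r x.1 - x.2) * (height q r x.1 - y.2).
    rewrite ltNge; apply/negP => h; apply: (fr (x.1, height q r x.1)).
      by apply: height_seg => //; lra.
    exact: seg_vertical.
  by apply/idP/idP; nra.
rewrite !crE //.
have [qr'|rq] := ltrP q.1 r.1; last first.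
  have eqr : q.1 = r.1 by lra.
  rewrite !phi0; try (case: (ltrP q.1 _) => ?; [right; rewrite -eqr|left]; done).
  rewrite -eqr; case: (boolP (x.1 <= q.1 < y.1)) => //= /andP[xq qy].
  suff : (q.2 < height x y q.1) = (r.2 < height x y q.1) by move=> ->; rewrite !subrr.
  have h : 0 < (height x y q.1 - q.2) * (height x y q.1 - r.2).
    rewrite ltNge; apply/negP => h; apply: (fr (q.1, height x y q.1)).
      exact: seg_vertical.
    by apply: height_seg => //; lra.
  by apply/idP/idP; nra.
have [xq|qx] := lerP x.1 q.1.
  rewrite (phi0 x); last by left.
  have [yq|qy] /= := lerP y.1 q.1.
    rewrite (phi0 y); last by left.
    by rewrite (_ : (_ <= _ < _) = false) //; apply/negP => /andP[]; lra.
  have [yr|ry] := lerP y.1 r.1.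
    rewrite phiE // yr /=.
    rewrite andbF /= !subr0; congr (Posz (nat_of_bool _)).
    have [h1 h2] := gapP q.1 y.1 qr' xy' (ltW qy) xq (lexx _) (lexx _) yr.
    by move: h1 h2; rewrite height_l height_r.
  rewrite phi0 ?subr0; last by right.
  rewrite (le_trans xq qr) /=.
  have [h1 h2] := gapP q.1 r.1 qr' xy' qr xq (ltW ry) (lexx _) (lexx _).
  by move: h1 h2; rewrite height_l height_r // => _ ->; rewrite subrr.
rewrite sub0r.
have [xr|rx] := lerP x.1 r.1; last first.
  rewrite (phi0 x); last by right.
  rewrite (phi0 y); last by right; lra.
  by rewrite /= ?subrr.
rewrite (phiE x) // xr /=.
have [yr|ry] /= := lerP y.1 r.1.
  rewrite phiE ?yr /=; last by lra.
  have [h1 h2] := gapP x.1 y.1 qr' xy' xy (lexx _) (lexx _) (ltW qx) yr.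
  by move: h1 h2; rewrite height_l !height_r // => _ ->; rewrite subrr.
rewrite phi0 ?sub0r; last by right.
have [h1 h2] := gapP x.1 r.1 qr' xy' xr (lexx _) (ltW ry) (ltW qx) (lexx _).
by move: h1 h2; rewrite height_l height_r // => _ ->.
Qed.

End Crossing2.

(** * Winding numbers and components of the complement *)

Section Winding.
Variable R : realType.
Local Notation pt := (R * R)%type.
Implicit Types (x y z q p r : pt) (e f : pt * pt) (c t : R) (s : seq pt) (E : seq (pt * pt)).

Definition edges s : seq (pt * pt) := zip s (rot 1 s).

Definition windp E q : int := \sum_(e <- E) crossp q e.
Definition windm E q : int := \sum_(e <- E) crossm q e.

Definition bd E : set pt := [set q | exists2 e, e \in E & seg e q].

Lemma sum_edges (V : zmodType) (phi : pt -> V) s :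
  \sum_(e <- edges s) (phi e.2 - phi e.1) = 0.
Proof.
have sr : size (rot 1 s) = size s by rewrite size_rot.
rewrite sumrB -(big_map snd xpredT phi) -(big_map fst xpredT phi).
rewrite -/(unzip2 _) -/(unzip1 _) unzip2_zip ?unzip1_zip ?sr //.
by rewrite (perm_big s) /= ?subrr // perm_rot.
Qed.

Lemma windp_free s q r : (forall p, seg (q, r) p -> ~ bd (edges s) p) ->
  windp (edges s) q = windp (edges s) r.
Proof.
wlog qr : q r / q.1 <= r.1 => [hw fr|fr].
  have [qr|/ltW rq] := leP q.1 r.1; first exact: hw.
  by symmetry; apply: hw => // p; rewrite segC; exact: fr.
apply/eqP; rewrite -subr_eq0 /windp -sumrB.
pose phi z : int := ((q.1 < z.1 <= r.1) && (orient q r z < 0))%:Z.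
rewrite (eq_big_seq (fun e => phi e.2 - phi e.1)) ?sum_edges // => -[x y] xyE.
by apply: crossp_free => // p /fr h xyp; apply: h; exists (x, y).
Qed.

Definition cube p c : set pt := [set q | `|q.1 - p.1| < c /\ `|q.2 - p.2| < c].

Lemma conv_lt (a b c t : R) : 0 <= t <= 1 -> a < c -> b < c -> (1 - t) * a + t * b < c.
Proof.
move=> /andP[t0 t1] ac bc; have [->|tn] := eqVneq t 0; first by lra.
have tp : 0 < t by rewrite lt_neqAle eq_sym tn.
have : t * b < t * c by rewrite ltr_pM2l.
have : (1 - t) * a <= (1 - t) * c by rewrite ler_wpM2l ?subr_ge0 // ltW.
lra.
Qed.

Lemma cube_lin p c a b t : 0 <= t <= 1 -> cube p c a -> cube p c b -> cube p c (lin a b t).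
Proof.
move=> t01 []; rewrite !ltr_norml => a1 a2 []; rewrite !ltr_norml => b1 b2.
have cv (u v w : R) : - c < u - w < c -> - c < v - w < c ->
    - c < (1 - t) * u + t * v - w < c.
  move=> /andP[u1 u2] /andP[v1 v2].
  have := conv_lt t01 u2 v2; have := @conv_lt (w - u) (w - v) c t t01.
  by move=> h1 h2; apply/andP; split; last lra; have := h1 _ _; lra.
by split; rewrite ltr_norml /lin /=; apply: cv.
Qed.

Lemma cube_seg p c a b q : cube p c a -> cube p c b -> seg (a, b) q -> cube p c q.
Proof. by move=> pa pb [t [t01 ->]]; exact: cube_lin. Qed.

Lemma cube_refl p c : 0 < c -> cube p c p.
Proof. by move=> c0; split; rewrite subrr normr0. Qed.

Lemma cube_le p c c' : c <= c' -> cube p c `<=` cube p c'.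
Proof. by move=> cc q [h1 h2]; split; [apply: lt_le_trans h1 _|apply: lt_le_trans h2 _]. Qed.

Lemma nbhs_cubeP p (A : set pt) : nbhs p A <-> exists2 c, 0 < c & cube p c `<=` A.
Proof.
split=> [/nbhs_ballP[c /= c0 h]|[c c0 h]].
  by exists c => // q [q1 q2]; apply: h; split; rewrite /ball /= distrC.
apply/nbhs_ballP; exists c => //= q [q1 q2]; apply: h; split; rewrite distrC; [exact: q1|exact: q2].
Qed.

Lemma continuous_lin a b : continuous (lin a b : R -> pt).
Proof.
move=> t; rewrite /lin.
have h u v : ((1 - t') * u + t' * v)@[t' --> t] --> ((1 - t) * u + t * v : R).
  by apply: cvgD; apply: cvgMl; [apply: cvgB; [exact: cvg_cst|exact: cvg_id]|exact: cvg_id].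
exact: (cvg_pair (h a.1 b.1) (h a.2 b.2)).
Qed.

Lemma seg_image e : seg e = lin e.1 e.2 @` `[0, 1].
Proof.
apply/seteqP; split=> q [t]; first by case=> t01 ->; exists t; rewrite //= in_itv.
by rewrite /= in_itv /= => t01 <-; exists t.
Qed.

Lemma seg_compact e : compact (seg e).
Proof.
rewrite seg_image; apply: continuous_compact; last exact: segment_compact.
by apply: continuous_subspaceT => t; exact: continuous_lin.
Qed.

Lemma seg_connected e : connected (seg e).
Proof.
rewrite seg_image; apply: connected_continuous_connected; first exact: segment_connected.
by apply: continuous_subspaceT => t; exact: continuous_lin.
Qed.

Lemma seg_l e : seg e e.1.
Proof. by exists 0; rewrite lin0 lexx ler01. Qed.

Lemma seg_r e : seg e e.2.
Proof. by exists 1; rewrite lin1 lexx ler01. Qed.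

Lemma seg_avoid e p : ~ seg e p -> exists2 c, 0 < c & forall q, cube p c q -> ~ seg e q.
Proof.
move=> ep; have : nbhs p (~` seg e).
  apply: open_nbhs_nbhs; split => //; apply: closed_openC.
  by apply: compact_closed; [exact: norm_hausdorff|exact: seg_compact].
by move=> /nbhs_cubeP[c c0 h]; exists c.
Qed.

(** Compactness of [e] makes the distance at which [f] is avoided uniform. Halving the radius leaves
    room for the centre to move. *)
Lemma seg_separate e f : (forall p, seg e p -> ~ seg f p) ->
  exists2 c, 0 < c & forall p q, seg e p -> cube p c q -> ~ seg f q.
Proof.
move=> ef.
have h : \forall c \near (0:R)^'+, seg e `<=` (fun p => forall q, cube p c q -> ~ seg f q).
  apply: (iffLR (compact_near_coveringP _) (@seg_compact e)) => p /ef /seg_avoid[c c0 hc].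
  have h1 : nbhs p (cube p (c / 2)) by apply/nbhs_cubeP; exists (c / 2) => //; lra.
  have h2 : \forall d \near (0:R)^'+, d < c / 2 by apply: nbhs_right_lt; lra.
  exists (cube p (c / 2), [set d | d < c / 2]) => // -[p' d] /= [[pp1 pp2] dc] q [q1 q2].
  have := ler_distD p'.1 q.1 p.1; have := ler_distD p'.2 q.2 p.2 => k1 k2.
  by apply: hc; split; lra.
near (0:R)^'+ => c; exists c => [//|p q].
by have /(_ p) hc : seg e `<=` (fun p => forall q, cube p c q -> ~ seg f q); [near: c|move=> /hc; exact].
Unshelve. all: end_near. Qed.

Lemma bd_avoid E p : ~ bd E p -> exists2 c, 0 < c & forall q, cube p c q -> ~ bd E q.
Proof.
elim: E => [_|e E IH h]; first by exists 1 => // q _ [].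
have [|c c0 hc] := @seg_avoid e p; first by move=> ?; apply: h; exists e; rewrite ?mem_head.
have [|d d0 hd] := IH; first by move=> [f fE ?]; apply: h; exists f; rewrite ?inE ?fE ?orbT.
exists (Num.min c d); first by rewrite lt_min c0.
move=> q cq [f]; rewrite inE => /orP[/eqP->|fE] fq.
  by apply: (hc q) fq; apply: cube_le cq; rewrite ge_min lexx.
by apply: (hd q); [apply: cube_le cq; rewrite ge_min lexx orbT|exists f].
Qed.

Definition linked E p : set pt := connected_component (~` bd E) p.

Lemma linked_seg E p q : (forall r, seg (p, q) r -> ~ bd E r) -> linked E p q.
Proof.
move=> h; apply: (@connected_component_max _ _ (seg (p, q))) => //.
- exact: (seg_l (p, q)).
- exact: seg_connected.
- exact: (seg_r (p, q)).
Qed.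

Lemma linked_sym E p q : linked E p q -> linked E q p.
Proof. exact: connected_component_sym. Qed.

Lemma linked_trans E p q r : linked E p q -> linked E q r -> linked E p r.
Proof. exact: connected_component_trans. Qed.

Lemma linked_bd E p q : linked E p q -> ~ bd E q.
Proof. exact: connected_component_sub. Qed.

Lemma windp_local s p : ~ bd (edges s) p ->
  exists2 c, 0 < c & forall q, cube p c q -> ~ bd (edges s) q /\ windp (edges s) q = windp (edges s) p.
Proof.
move=> /bd_avoid[c c0 h]; exists c => // q pq; split; first exact: h.
apply: windp_free => r qr; apply: h; apply: cube_seg qr => //; exact: cube_refl.
Qed.

(** The crossing number is locally constant off the polygon, so the points of a connected set where
    it takes a given value form a subset that is both open and closed in it. *)
Lemma windp_linked s p q : linked (edges s) p q ->
  windp (edges s) q = windp (edges s) p.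
Proof.
move=> [C [Cp CU Cc] Cq].
pose A k := [set r | ~ bd (edges s) r /\ k (windp (edges s) r)].
have oA k : open (A k).
  rewrite openE => r [rb kr]; apply/nbhs_cubeP.
  by have [c c0 h] := windp_local rb; exists c => // r' /h[r'b wr']; split; rewrite // wr'.
pose P := A (fun k => k = windp (edges s) p).
suff : C `&` P = C by move=> CE; have [_ []] : (C `&` P) q by rewrite CE.
apply: Cc.
- by exists p; split => //; split => //; exact: CU.
- by exists P => //; exact: oA.
- exists (~` A (fun k => k <> windp (edges s) p)); first exact/open_closedC/oA.
  apply/seteqP; split=> r [Cr]; first by move=> [_ wr]; split => // -[].
  move=> Ar; split => //; split; first exact: CU.
  by apply: contrapT => wr; apply: Ar; split => //; exact: CU.
Qed.

End Winding.

Ltac clear_pairs := repeat match goal with H : @eq (prod _ _) _ _ |- _ => clear H end.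
Ltac plra := clear_pairs; lra.

(** * The Jordan curve theorem for simple polygons *)

Section Simple.
Variable R : realType.
Local Notation pt := (R * R)%type.
Implicit Types (x y z q r a b m : pt) (e f : pt * pt) (c t : R) (s : seq pt) (E : seq (pt * pt)).

(** Edges are taken without their final point, so that consecutive edges are disjoint although they
    share a vertex. *)
Definition simple s : Prop :=
  [/\ (2 < size s)%N, uniq s &
      forall e f q, e \in edges s -> f \in edges s -> hseg e q -> hseg f q -> e = f].

Lemma edges_next s : uniq s -> edges s = [seq (x, next s x) | x <- s].
Proof.
case: s => // x0 s us; apply: (@eq_from_nth _ (x0, x0)) => [|i].
  by rewrite size_zip size_rot minnn size_map.
rewrite size_zip size_rot minnn => ilt.
rewrite nth_zip ?size_rot // (nth_map x0) //; congr pair.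
rewrite next_nth mem_nth // index_uniq // /rot /= take0 cats1 drop0 nth_rcons.
move: ilt; rewrite ltnS leq_eqVlt => /orP[/eqP->|->//].
by rewrite ltnn eqxx nth_default.
Qed.

Lemma mem_edges s e : uniq s -> (e \in edges s) = (e.1 \in s) && (e.2 == next s e.1).
Proof.
move=> us; rewrite edges_next //; apply/mapP/andP => [[x xs ->]|[es /eqP e2]].
  by rewrite xs eqxx.
by exists e.1 => //; rewrite -e2 -surjective_pairing.
Qed.

Lemma edges_rot s k : uniq s -> perm_eq (edges (rot k s)) (edges s).
Proof.
move=> us; rewrite !edges_next ?rot_uniq // (eq_map (_ : _ =1 (fun x => (x, next s x)))).
  by rewrite perm_map // perm_rot.
by move=> x; rewrite next_rot.
Qed.

Lemma simple_rot s k : simple s -> simple (rot k s).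
Proof.
move=> [s2 us h]; split; rewrite ?size_rot ?rot_uniq // => e f q.
by rewrite !(perm_mem (edges_rot k us)); exact: h.
Qed.

Lemma hsegP e q : seg e q -> hseg e q \/ q = e.2.
Proof.
move=> [t [/andP[t0 t1] qE]]; have [t1'|t1'] := ltrP t 1.
  by left; exists t; rewrite t0.
have t1E : t = 1 by plra.
by right; rewrite qE t1E lin1.
Qed.

Lemma hseg_l e : hseg e e.1.
Proof. by exists 0; rewrite lin0 lexx ltr01. Qed.

Lemma hseg_seg e : hseg e `<=` seg e.
Proof. by move=> q [t [/andP[t0 t1] ->]]; exists t; rewrite t0 ltW. Qed.

Lemma oseg_hseg e : oseg e `<=` hseg e.
Proof. by move=> q [t [/andP[t0 t1] ->]]; exists t; rewrite ltW. Qed.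

Lemma next_inj s x y : uniq s -> next s x = next s y -> x = y.
Proof. by move=> us /(congr1 (prev s)); rewrite !prev_next. Qed.

Lemma next_neq s x : simple s -> x \in s -> next s x != x.
Proof.
move=> [s2 us _] /rot_to[i s' sE]; rewrite -(next_rot i us) sE.
have : uniq (x :: s') by rewrite -sE rot_uniq.
have : (2 < size (x :: s'))%N by rewrite -sE size_rot.
case: s' {sE} => [|y [|z s']] //= _; rewrite eqxx inE negb_or eq_sym.
by case/andP => /andP[].
Qed.

Lemma simple_meet s e f q : simple s -> e \in edges s -> f \in edges s ->
  seg e q -> seg f q -> [\/ e = f, f.1 = e.2 | f.2 = e.1].
Proof.
move=> [s2 us h] eE fE.
have nx g : g \in edges s -> exists2 g', g' \in edges s & g'.1 = g.2.
  rewrite mem_edges // => /andP[gs /eqP g2]; exists (g.2, next s g.2) => //.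
  by rewrite mem_edges //= eqxx g2 mem_next gs.
move=> /hsegP[he|qe] /hsegP[hf|qf].
- by apply: Or31; exact: h he hf.
- have [g gE gf] := nx _ fE; apply: Or33.
  have hg : hseg g q by rewrite qf -gf; exact: hseg_l.
  by rewrite -gf (h _ _ _ gE eE hg he).
- have [g gE ge] := nx _ eE; apply: Or32.
  have hg : hseg g q by rewrite qe -ge; exact: hseg_l.
  by rewrite -ge (h _ _ _ gE fE hg hf).
- apply: Or31; move: eE fE; rewrite !mem_edges // => /andP[_ /eqP e2] /andP[_ /eqP f2].
  have e1 : e.1 = f.1 by apply: (@next_inj s) => //; rewrite -e2 -f2 -qe -qf.
  by rewrite [e]surjective_pairing [f]surjective_pairing e2 f2 e1.
Qed.

(** The delicate case is [q = f.2]: then [q] starts the edge that follows [f], this edge must be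
    [e], and a point inside [e] would be its initial vertex. *)
Lemma simple_oseg s e f q : simple s -> e \in edges s -> f \in edges s ->
  oseg e q -> seg f q -> e = f.
Proof.
move=> ss eE fE oe; have [s2 us h] := ss.
have he := oseg_hseg oe.
move=> /hsegP[hf|qf]; first exact: h he hf.
have f2s : f.2 \in s by move: fE; rewrite mem_edges // => /andP[f1 /eqP->]; rewrite mem_next.
have gE : (f.2, next s f.2) \in edges s by rewrite mem_edges // f2s eqxx.
have eg : e = (f.2, next s f.2).
  by apply: h he _ => //; rewrite qf; exact: (hseg_l (f.2, next s f.2)).
have : next s f.2 != f.2 by apply: next_neq.
case: oe => t [/andP[t0 t1]]; rewrite eg qf /lin /= => E /eqP[].
have E1 := congr1 fst E; have E2 := congr1 snd E.
move: E1 E2 => /= E1 E2; set w := next _ _ in E1 E2 *.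
case: w E1 E2 => w1 w2 /= E1 E2; rewrite [f.2]surjective_pairing; congr pair.
  by apply: (mulfI (_ : t != 0)); [plra|plra].
by apply: (mulfI (_ : t != 0)); [plra|plra].
Qed.

Lemma seq_small (T : eqType) (l : seq T) (P : T -> R -> Prop) :
  (forall u, u \in l -> exists2 c0, 0 < c0 & forall c, 0 < c < c0 -> P u c) ->
  exists2 c0, 0 < c0 & forall c, 0 < c < c0 -> forall u, u \in l -> P u c.
Proof.
elim: l => [_|y l IH h]; first by exists 1.
have [|c1 c10 h1] := IH; first by move=> x xl; apply: h; rewrite inE xl orbT.
have [c2 c20 h2] := h y (mem_head _ _).
exists (Num.min c1 c2); first by rewrite lt_min c10.
move=> c; rewrite lt_min => /and3P[c0 cc1 cc2] x; rewrite inE => /orP[/eqP->|xl].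
  by apply: h2; rewrite c0.
by apply: h1; rewrite ?c0.
Qed.

Lemma seq_argmin (T : eqType) (l : seq T) (r : rel T) : l != [::] ->
  total r -> transitive r -> exists2 u, u \in l & forall v, v \in l -> r u v.
Proof.
move=> l0 tr trr; elim: l l0 => // x [_ _|y l IH _].
  by exists x; rewrite ?mem_head // => z; rewrite inE => /eqP->; case/orP: (tr x x).
have [//|u ul hu] := IH.
have [xu|ux] := orP (tr x u).
  exists x; rewrite ?mem_head // => z; rewrite inE => /orP[/eqP->|/hu].
    by case/orP: (tr x x).
  exact: trr.
exists u; first by rewrite inE ul orbT.
by move=> z; rewrite inE => /orP[/eqP->//|/hu].
Qed.

(* Positive when [b] points to the right of [a]. *)
Definition dvec a b : R := a.2 * b.1 - a.1 * b.2.

Lemma collinear_scale (a1 a2 b1 b2 : R) : a2 * b1 - a1 * b2 = 0 -> a1 ^+ 2 + a2 ^+ 2 != 0 ->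
  let k := (a1 * b1 + a2 * b2) / (a1 ^+ 2 + a2 ^+ 2) in b1 = k * a1 /\ b2 = k * a2.
Proof.
move=> h A0 k; have kA : k * (a1 ^+ 2 + a2 ^+ 2) = a1 * b1 + a2 * b2 by rewrite /k divfK.
split; apply: (mulIf A0).
  by rewrite mulrAC kA; have := congr1 (fun u => a2 * u) h; rewrite /=; plra.
by rewrite mulrAC kA; have := congr1 (fun u => a1 * u) h; rewrite /=; plra.
Qed.

(** At a proper turn, the difference of the two edge directions, with the sign given by the turn,
    points to the right of both. When the edges are parallel, the right normal of the second edge
    serves, unless the line folds back on itself, which simplicity excludes. *)
Lemma corner_vector s x y z : simple s -> (x, y) \in edges s -> (y, z) \in edges s ->
  exists m, 0 < dvec (y - x) m /\ 0 < dvec (z - y) m.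
Proof.
move=> ss xyE yzE; have [s2 us h] := ss.
have xs : x \in s by move: xyE; rewrite mem_edges // => /andP[].
have ys : y \in s by move: yzE; rewrite mem_edges // => /andP[].
have xy : y != x by move: xyE; rewrite mem_edges // => /andP[_ /eqP/= ->]; exact: next_neq.
have yz : z != y by move: yzE; rewrite mem_edges // => /andP[_ /eqP/= ->]; exact: next_neq.
have [c0|c0|c0] := ltrgtP (dvec (y - x) (z - y)) 0.
- exists ((y - x) - (z - y)); rewrite /dvec /= in c0 *; split; plra.
- exists ((z - y) - (y - x)); rewrite /dvec /= in c0 *; split; plra.
have sq (u v : pt) : u != v -> 0 < (u.1 - v.1) ^+ 2 + (u.2 - v.2) ^+ 2.
  move=> uv; rewrite lt_neqAle addr_ge0 ?sqr_ge0 // andbT eq_sym.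
  rewrite paddr_eq0 ?sqr_ge0 // !sqrf_eq0 !subr_eq0.
  by apply: contra uv => /andP[/eqP e1 /eqP e2]; rewrite [u]surjective_pairing e1 e2 -surjective_pairing.
have na := sq _ _ xy; have nb := sq _ _ yz.
exists ((z - y).2, - (z - y).1).
have d2 : 0 < dvec (z - y) ((z - y).2, - (z - y).1).
  by rewrite /dvec /=; move: nb; rewrite !expr2; plra.
split=> //; rewrite ltNge; apply/negP => dot.
set A := (y.1 - x.1) ^+ 2 + _ in na; set B := (z.1 - y.1) ^+ 2 + _ in nb.
have [k1 k2] := collinear_scale c0 (lt0r_neq0 na).
move: k1 k2; rewrite -/A; set D := (_ + _ in X in X / A); move=> k1 k2.
have D0 : D <= 0 by move: dot; rewrite /dvec /D /=; plra.
have DA : D / A <= 0 by rewrite ler_pdivrMr // mul0r.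
have kn : D / A != 0.
  apply/eqP => k0; move: nb; rewrite /B -[z.1 - y.1]/((z - y).1) -[z.2 - y.2]/((z - y).2).
  by rewrite k1 k2 k0 !mul0r expr0n addr0 ltxx.
(* [z - y = - k (y - x)] with [k > 0]: the two edges overlap near [y]. *)
pose k := - (D / A).
have k0 : 0 < k by rewrite /k oppr_gt0 lt_neqAle kn.
pose mu := Num.min 1 k / 2.
have mu0 : 0 < mu by rewrite /mu divr_gt0 // lt_min ltr01.
have mu1 : mu < 1 by rewrite /mu ltr_pdivrMr // gt_min; plra.
have muk : mu / k < 1 by rewrite ltr_pdivrMr // mul1r /mu ltr_pdivrMr // gt_min; apply/orP; right; plra.
have q1 : hseg (x, y) (lin x y (1 - mu)) by exists (1 - mu); split => //; plra.
have q2 : hseg (y, z) (lin x y (1 - mu)).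
  exists (mu / k); split; first by rewrite divr_ge0 ?ltW.
  rewrite /= /lin; congr pair.
    have : (1 - mu / k) * y.1 + mu / k * z.1 = y.1 + mu / k * (z - y).1 by rewrite /=; ring.
    move=> ->; rewrite k1 -[D / A]opprK -/k mulrA mulrN divfK ?lt0r_neq0 //=; ring.
  have : (1 - mu / k) * y.2 + mu / k * z.2 = y.2 + mu / k * (z - y).2 by rewrite /=; ring.
  move=> ->; rewrite k2 -[D / A]opprK -/k mulrA mulrN divfK ?lt0r_neq0 //=; ring.
by have [xE _] := h _ _ _ xyE yzE q1 q2; rewrite xE eqxx in xy.
Qed.

End Simple.

(** * Parallel copies of a polygon *)

Section Tube.
Variable R : realType.
Local Notation pt := (R * R)%type.
Implicit Types (x y q p r a m v w u : pt) (f : pt * pt) (c t eps sg : R) (s : seq pt).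

Definition displace a eps m : pt := (a.1 + eps * m.1, a.2 + eps * m.2).

(** The displacement is interpolated along the edge between the directions chosen at its ends, so
    that displaced edges fit together at the vertices; the sign of [sg] selects the side. *)
Lemma tube_self v w m m' sg eps t : 0 < sg * dvec (w - v) m -> 0 < sg * dvec (w - v) m' ->
  0 < eps -> 0 <= t <= 1 -> 0 < sg * orient v w (displace (lin v w t) eps (lin m m' t)).
Proof.
move=> A0 A'0 e0 t01.
have -> : sg * orient v w (displace (lin v w t) eps (lin m m' t)) =
    eps * ((1 - t) * (sg * dvec (w - v) m) + t * (sg * dvec (w - v) m')).
  by rewrite /orient /dvec /displace /lin /=; ring.
by rewrite mulr_gt0 //; move: A0 A'0; set A := (_ * _); set A' := (_ * _); nra.
Qed.

Lemma orient_seg x y q : seg (x, y) q -> orient x y q = 0.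
Proof. by move=> [t [_ ->]]; rewrite /orient /lin /=; ring. Qed.

(** The two equations say that a displaced point of an edge lies on a neighbouring edge, measured
    across either edge. The first forces [c], the turn between the edges, to be positive. For small
    [eps] the second then equates a nonnegative with a nonpositive quantity, which leaves only
    [t = 1] and contradicts [0 < C]. *)
Lemma tube_arith (A A' B C c r t eps : R) : 0 < A -> 0 < A' -> 0 < C -> 0 <= r -> 0 <= t <= 1 ->
  0 < eps -> (0 < c -> eps * (`|B| + 1) < c) ->
  eps * ((1 - t) * A + t * A') = r * c -> (1 - t) * c = eps * ((1 - t) * B - t * C) -> False.
Proof.
move=> A0 A'0 C0 r0 t01 e0 ec H1 H2.
have conv0 : 0 < (1 - t) * A + t * A' by nra.
have c0 : 0 < c.
  rewrite ltNge; apply/negP => c0; have : r * c <= 0 by rewrite mulr_ge0_le0.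
  by rewrite -H1 leNgt mulr_gt0.
have eB : eps * B < c by rewrite (le_lt_trans _ (ec c0)) // ler_pM2l //; have := ler_norm B; lra.
have [t1|t1] := ltrP t 1.
  have : 0 < (1 - t) * (c - eps * B) by rewrite mulr_gt0 ?subr_gt0.
  have : 0 <= eps * (t * C) by apply: mulr_ge0; [lra|apply: mulr_ge0; lra].
  by move=> k1 k2; move: H2; lra.
have tE : t = 1 by lra.
by move: H2; rewrite tE subrr !mul0r mul1r sub0r mulrN => /eqP; rewrite eq_sym oppr_eq0 mulf_eq0; lra.
Qed.

Lemma small_exists (B c : R) : exists2 e0, 0 < e0 & forall eps, 0 < eps < e0 -> 0 < c -> eps * (`|B| + 1) < c.
Proof.
have n0 : 0 < `|B| + 1 by have := normr_ge0 B; lra.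
have [c0|c0] := ltrP 0 c; last by exists 1 => // *; lra.
by exists (c / (`|B| + 1)); [rewrite divr_gt0|move=> eps /andP[_ e1] _; rewrite -ltr_pdivlMr].
Qed.

Lemma tube_next v w u m m' sg : 0 < sg * dvec (w - v) m -> 0 < sg * dvec (w - v) m' ->
  0 < sg * dvec (u - w) m' ->
  exists2 e0, 0 < e0 & forall eps, 0 < eps < e0 -> forall t, 0 <= t <= 1 ->
    ~ seg (w, u) (displace (lin v w t) eps (lin m m' t)).
Proof.
move=> A0 A'0 C0.
have [e0 e00 he] := small_exists (sg * dvec m (u - w)) (sg * dvec (w - v) (u - w)).
exists e0 => // eps epse t t01 [r [r01 [E1 E2]]].
(* The meeting equation is paired by [dvec] first with [w - v], then with [u - w]. *)
apply: (tube_arith A0 A'0 C0 (_ : 0 <= r) t01 _ (he _ epse)); [lra|lra| |].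
  move: E1 E2; rewrite /displace /lin /dvec /= => E1 E2.
  transitivity (sg * ((w.2 - v.2) * ((1 - t) * v.1 + t * w.1 + eps * ((1 - t) * m.1 + t * m'.1) - w.1)
     - (w.1 - v.1) * ((1 - t) * v.2 + t * w.2 + eps * ((1 - t) * m.2 + t * m'.2) - w.2))); first ring.
  by rewrite E1 E2; ring.
move: E1 E2; rewrite /displace /lin /dvec /= => E1 E2.
apply/eqP; rewrite -subr_eq0; apply/eqP.
transitivity (- sg * (((1 - t) * v.2 + t * w.2 + eps * ((1 - t) * m.2 + t * m'.2) - w.2) * (u.1 - w.1)
  - ((1 - t) * v.1 + t * w.1 + eps * ((1 - t) * m.1 + t * m'.1) - w.1) * (u.2 - w.2))); first ring.
by rewrite E1 E2; ring.
Qed.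

(** The mirror image of [tube_next], with both edge parameters reversed. *)
Lemma tube_prev u v w m m' sg : 0 < sg * dvec (w - v) m -> 0 < sg * dvec (w - v) m' ->
  0 < sg * dvec (v - u) m ->
  exists2 e0, 0 < e0 & forall eps, 0 < eps < e0 -> forall t, 0 <= t <= 1 ->
    ~ seg (u, v) (displace (lin v w t) eps (lin m m' t)).
Proof.
move=> A0 A'0 C0.
have [e0 e00 he] := small_exists (- (sg * dvec (v - u) m')) (sg * dvec (v - u) (w - v)).
exists e0 => // eps epse t t01 [r [r01 [E1 E2]]].
apply: (tube_arith A'0 A0 C0 (_ : 0 <= 1 - r) (_ : 0 <= 1 - t <= 1) _ (he _ epse)); [lra|lra|lra| |].
  move: E1 E2; rewrite /displace /lin /dvec /= => E1 E2.
  transitivity (sg * ((w.2 - v.2) * ((1 - t) * v.1 + t * w.1 + eps * ((1 - t) * m.1 + t * m'.1) - v.1)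
     - (w.1 - v.1) * ((1 - t) * v.2 + t * w.2 + eps * ((1 - t) * m.2 + t * m'.2) - v.2))); first ring.
  by rewrite E1 E2; ring.
move: E1 E2; rewrite /displace /lin /dvec /= => E1 E2.
apply/eqP; rewrite -subr_eq0; apply/eqP.
transitivity (sg * ((v.2 - u.2) * ((1 - t) * v.1 + t * w.1 + eps * ((1 - t) * m.1 + t * m'.1) - v.1)
  - (v.1 - u.1) * ((1 - t) * v.2 + t * w.2 + eps * ((1 - t) * m.2 + t * m'.2) - v.2))); first ring.
by rewrite E1 E2; ring.
Qed.

Lemma tube_far v w m m' f : (forall p, seg (v, w) p -> ~ seg f p) ->
  exists2 e0, 0 < e0 & forall eps, 0 < eps < e0 -> forall t, 0 <= t <= 1 ->
    ~ seg f (displace (lin v w t) eps (lin m m' t)).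
Proof.
move=> /seg_separate[c c0 hc].
pose K : R := `|m.1| + `|m.2| + `|m'.1| + `|m'.2| + 1.
have [n1 n2 n3 n4] := And4 (normr_ge0 m.1) (normr_ge0 m.2) (normr_ge0 m'.1) (normr_ge0 m'.2).
have K0 : 0 < K by rewrite /K; lra.
exists (c / K); first by rewrite divr_gt0.
move=> eps /andP[e0]; rewrite ltr_pdivlMr // => eK t t01; apply: (hc (lin v w t)).
  by exists t.
have bnd (i j : R) : `|i| + `|j| <= K -> `|eps * ((1 - t) * i + t * j)| < c.
  move=> ij; rewrite normrM (gtr0_norm e0) (le_lt_trans _ eK) // ler_pM2l //.
  rewrite (le_trans _ ij) // (le_trans (ler_normD _ _)) // !normrM.
  rewrite (@ger0_norm _ t) ?(@ger0_norm _ (1 - t)); [|lra|lra].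
  have := normr_ge0 i; have := normr_ge0 j; nra.
by split; rewrite /= addrC addKr; apply: bnd; rewrite /K; lra.
Qed.

Lemma tube s (M : pt -> pt) sg : simple s -> sg != 0 ->
  (forall x, x \in s -> 0 < sg * dvec (next s x - x) (M x)) ->
  (forall x, x \in s -> 0 < sg * dvec (next s x - x) (M (next s x))) ->
  exists2 e0, 0 < e0 & forall eps, 0 < eps < e0 -> forall x, x \in s ->
   forall t, 0 <= t <= 1 -> ~ bd (edges s) (displace (lin x (next s x) t) eps (lin (M x) (M (next s x)) t)).
Proof.
move=> ss sg0 h1 h2; have [_ us _] := ss.
apply: (@seq_small _ _ s (fun x eps => forall t, 0 <= t <= 1 -> ~ bd (edges s) _)) => x xs.
have [|e0 e00 he0] := @seq_small _ _ (edges s) (fun f eps => forall t, 0 <= t <= 1 ->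
    ~ seg f (displace (lin x (next s x) t) eps (lin (M x) (M (next s x)) t))); last first.
  by exists e0 => // eps he t t01 [f fE]; exact: he0.
move=> f fE.
have xE : (x, next s x) \in edges s by rewrite mem_edges // xs eqxx.
have nxs : next s x \in s by rewrite mem_next.
have [mt|nmt] := pselect (exists p, seg (x, next s x) p /\ seg f p); last first.
  by apply: tube_far => p p1 p2; apply: nmt; exists p.
have [p [p1 p2]] := mt; move: (fE); rewrite mem_edges // => /andP[f1s /eqP f2E].
have [<-|/= f1|/= f2] := simple_meet ss xE fE p1 p2.
- exists 1 => // eps /andP[e0 _] t t01 /orient_seg o0.
  have := tube_self (h1 _ xs) (h2 _ xs) e0 t01; rewrite o0 mulr0 ltxx //.
- have -> : f = (next s x, next s (next s x)) by rewrite [f]surjective_pairing f2E f1.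
  exact: tube_next (h1 _ xs) (h2 _ xs) (h1 _ nxs).
- have -> : f = (f.1, x) by rewrite [f]surjective_pairing -f2.
  by apply: tube_prev (h1 _ xs) (h2 _ xs) _; have := h2 _ f1s; rewrite -f2E f2.
Qed.

End Tube.

Section Sides.
Variable R : realType.
Local Notation pt := (R * R)%type.
Implicit Types (x y z q p r a b m u : pt) (e f : pt * pt) (c t sg : R) (s : seq pt) (E : seq (pt * pt)).

Lemma corner_vectors s : simple s -> exists M : pt -> pt, forall x, x \in s ->
  0 < dvec (next s x - x) (M x) /\ 0 < dvec (next s x - x) (M (next s x)).
Proof.
move=> ss; have [s2 us _] := ss.
have [M hM] : {M : pt -> pt & forall x, x \in s -> 0 < dvec (x - prev s x) (M x) /\ 0 < dvec (next s x - x) (M x)}.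
  apply: (@boolp.choice _ _ (fun x m => x \in s -> 0 < dvec (x - prev s x) m /\ 0 < dvec (next s x - x) m)).
  move=> x; have [xs|xs] := boolP (x \in s); last by exists 0.
  have [||m hm] := @corner_vector _ s (prev s x) x (next s x) ss; last by exists m.
    by rewrite mem_edges //= mem_prev xs next_prev /=.
  by rewrite mem_edges //= xs eqxx.
exists M => x xs; split; first by have [] := hM _ xs.
by have [] := hM (next s x); rewrite ?mem_next // prev_next.
Qed.

Lemma linked_all s E (g : pt -> pt) x y : uniq s -> x \in s -> y \in s ->
  (forall z, z \in s -> linked E (g z) (g (next s z))) -> linked E (g x) (g y).
Proof.
move=> us xs ys h; have := cycle_next us.
suff H : forall x0 s', x0 \in s -> all (mem s) s' -> path (frel (next s)) x0 s' ->
    forall z, z \in s' -> linked E (g x0) (g z).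
  have [i s' sE] := rot_to xs.
  rewrite -(rot_cycle i) sE /= => /(H _ _ xs); apply; last first.
    by rewrite mem_rcons -sE mem_rot.
  by apply/allP => z; rewrite mem_rcons -sE mem_rot.
move=> x0 s'; elim: s' x0 => //= z s' IH x0 x0s /andP[zs as'] /andP[/eqP nz ps'] u.
have l0 : linked E (g x0) (g z) by rewrite -nz; exact: h.
rewrite inE => /orP[/eqP->//|us'].
by apply: linked_trans l0 _; exact: IH.
Qed.

Lemma other_edges s e p : simple s -> e \in edges s -> oseg e p ->
  exists2 c, 0 < c & forall q, cube p c q -> forall f, f \in edges s -> f != e -> ~ seg f q.
Proof.
move=> ss eE ep.
have [|c0 c00 h] := @seq_small _ _ (edges s) (fun f c => f != e -> forall q, cube p c q -> ~ seg f q); last first.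
  by exists (c0 / 2) => [|q pq f fE fe]; [lra|apply: (h (c0 / 2)) => //; lra].
move=> f fE; have [->|fe] := eqVneq f e; first by exists 1.
have [|c c0 hc] := @seg_avoid _ f p.
  by move=> fp; move: fe; rewrite (simple_oseg ss eE fE ep fp) eqxx.
exists c => // d /andP[_ dc] _ q pq; apply: hc; apply: cube_le pq; exact: ltW.
Qed.

(** The displaced copy of the polygon is a closed line in the complement that runs along every edge
    on the side given by [sg]. Points near the inside of an edge on that side can be joined to it,
    so all of them lie in one component. *)
Lemma side_linked s sg : simple s -> sg != 0 -> exists b, forall e, e \in edges s ->
  forall t, 0 < t < 1 -> exists2 c, 0 < c & forall q, cube (lin e.1 e.2 t) c q ->
    0 < sg * orient e.1 e.2 q -> linked (edges s) b q.
Proof.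
move=> ss sg0; have [s2 us _] := ss; have [M0 hM0] := corner_vectors ss.
pose M x : pt := (sg * (M0 x).1, sg * (M0 x).2).
have hM x : x \in s -> 0 < sg * dvec (next s x - x) (M x) /\ 0 < sg * dvec (next s x - x) (M (next s x)).
  have ME (a u : pt) : sg * dvec a (sg * u.1, sg * u.2) = sg ^+ 2 * dvec a u by rewrite /dvec /=; ring.
  have sg2 : 0 < sg ^+ 2 by rewrite exprn_even_gt0 // sg0.
  by move=> /hM0[h1 h2]; rewrite !ME; split; apply: mulr_gt0.
have [e0 e00 tb] := tube ss sg0 (fun x xs => (hM x xs).1) (fun x xs => (hM x xs).2).
pose eps1 := e0 / 2.
have eps1P : 0 < eps1 < e0 by rewrite /eps1; lra.
pose g x := displace x eps1 (M x).
have seg_g x t : x \in s -> 0 <= t <= 1 ->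
    linked (edges s) (g x) (displace (lin x (next s x) t) eps1 (lin (M x) (M (next s x)) t)).
  move=> xs t01; apply: linked_seg => r [k [k01 ->]].
  rewrite (_ : lin _ _ _ = displace (lin x (next s x) (k * t)) eps1 (lin (M x) (M (next s x)) (k * t))).
    by apply: tb => //; nra.
  by rewrite /g /displace /lin /=; congr pair; ring.
have lg x : x \in s -> linked (edges s) (g x) (g (next s x)).
  by move=> xs; have := seg_g x 1 xs; rewrite !lin1; apply; lra.
have [x0 x0s] : exists x, x \in s by case: (s) s2 => // x ? _; exists x; rewrite mem_head.
exists (g x0) => e eE t t01.
have [c c0 hc] := @other_edges s e (lin e.1 e.2 t) ss eE (ex_intro _ t (conj t01 erefl)).
exists c => // q yq oq.
move: (eE); rewrite mem_edges // => /andP[xs /eqP nx]; set x := e.1 in xs nx *.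
apply: linked_trans (linked_all us x0s xs lg) _.
have t01' : 0 <= t <= 1 by lra.
apply: linked_trans (seg_g _ _ xs t01') _; apply: linked_sym.
set m := lin (M x) _ t; rewrite nx in yq oq hc; set y := lin x _ t in yq hc *.
pose K := `|m.1| + `|m.2| + 1.
have [n1 n2] := conj (normr_ge0 m.1) (normr_ge0 m.2).
have K0 : 0 < K by rewrite /K; lra.
(* So close to the edge that the displaced point lies in the cube, where no other edge occurs; from
   there the distance grows to [eps1] inside the tube. *)
pose eps2 := Num.min eps1 (c / K / 2).
have cK0 : 0 < c / K by rewrite divr_gt0.
have eps20 : 0 < eps2 by rewrite /eps2 lt_min; lra.
have eps21 : eps2 <= eps1 by rewrite /eps2 ge_min lexx.
have eps2K : eps2 * K < c by rewrite -ltr_pdivlMr // /eps2 gt_min; apply/orP; right; lra.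
apply: (@linked_trans _ _ _ (displace y eps2 m)); last first.
  apply: linked_seg => r [k [k01 ->]].
  rewrite (_ : lin _ _ _ = displace y (eps2 + k * (eps1 - eps2)) m).
    by apply: tb => //; nra.
  by rewrite /displace /lin /=; congr pair; ring.
have yq2 : cube y c (displace y eps2 m).
  have bnd (i : R) : `|i| <= K -> `|eps2 * i| < c.
    move=> iK; rewrite normrM gtr0_norm // (le_lt_trans _ eps2K) //.
    by rewrite ler_pM2l.
  by split; rewrite /= addrC addKr; apply: bnd; rewrite /K; lra.
have oq2 : 0 < sg * orient x (next s x) (displace y eps2 m).
  by have [h1 h2] := hM _ xs; exact: tube_self.
apply: linked_seg => r qr [f fE fr].
have yr : cube y c r by apply: cube_seg qr.
have [fe|fe] := eqVneq f e; last exact: hc yr f fE fe fr.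
move: fr; rewrite fe [e]surjective_pairing -/x nx => /orient_seg r0.
move: qr => [k [k01 rE]]; move: r0; rewrite rE orient_lin /= => r0.
have : sg * ((1 - k) * orient x (next s x) q + k * orient x (next s x) (displace y eps2 m)) = 0.
  by rewrite r0 mulr0.
rewrite mulrDr mulrCA (mulrCA sg k) => {r0}r0.
by move: oq oq2 r0; set A := sg * _; set B := sg * _ => A0 B0; clear_pairs; nra.
Qed.

End Sides.

(** * The two sides of a polygon, interior and exterior *)

Section Jordan.
Variable R : realType.
Local Notation pt := (R * R)%type.
Implicit Types (x y z q p r m v u : pt) (e : pt * pt) (c t : R) (s : seq pt).

Definition bound s (B : R) := forall x, x \in s -> `|x.1| <= B /\ `|x.2| <= B.

Lemma bound_exists s : exists B, bound s B.
Proof.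
elim: s => [|x s [B hB]]; first by exists 0.
exists (Num.max B (Num.max `|x.1| `|x.2|)) => y; rewrite inE => /orP[/eqP->|/hB[h1 h2]].
  by split; rewrite !le_max lexx ?orbT.
by split; rewrite le_max ?h1 ?h2.
Qed.

Lemma mem_edges_both s e : e \in edges s -> e.1 \in s /\ e.2 \in s.
Proof.
have sr : size (rot 1 s) = size s by rewrite size_rot.
move=> eE; have := map_f fst eE; have := map_f snd eE.
by rewrite -/(unzip2 _) -/(unzip1 _) unzip2_zip ?unzip1_zip ?sr // mem_rot.
Qed.

Lemma bd_bound s B p : bound s B -> bd (edges s) p -> `|p.1| <= B /\ `|p.2| <= B.
Proof.
move=> hB [e /mem_edges_both[/hB[a1 a2] /hB[b1 b2]] [t [t01 ->]]].
by move: a1 a2 b1 b2; rewrite /lin /= !ler_norml => *; split; apply/andP; split; nra.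
Qed.

Lemma windp_out_left s B p : bound s B -> B < `|p.1| -> windp (edges s) p = 0.
Proof.
move=> hB pB; rewrite /windp big_seq big1 // => e /mem_edges_both[/hB[a1 _] /hB[b1 _]].
move: a1 b1; rewrite !ler_norml => /andP[a1 a2] /andP[b1 b2].
have F (u v : R) : - B <= u -> v <= B -> (u <= p.1 < v) = false.
  move=> uB vB; apply/negP => /andP[k1 k2]; move: pB; rewrite ltr_normr => /orP[h|h]; lra.
by rewrite /crossp !F.
Qed.

Lemma windp_out s B p : bound s B -> B < `|p.1| \/ B < `|p.2| -> windp (edges s) p = 0.
Proof.
move=> hB [|pB]; first exact: windp_out_left.
have B0 : 0 <= `|B| := normr_ge0 _.
(* A point above or below the bounding square can be moved horizontally until no edge spans its
   abscissa. *)
rewrite (@windp_free _ s p (`|B| + 1, p.2)).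
  by apply: windp_out_left hB _; rewrite /= ger0_norm; have := ler_norm B; lra.
move=> r [t [t01 rE]] /(bd_bound hB)[_].
by rewrite rE /lin /= (_ : _ + _ = p.2) ?leNgt ?pB //; ring.
Qed.

(** The form in which membership in the unbounded component is used: the component contains a whole
    upward vertical ray. *)
Definition far s p := exists c (z0 : R), forall z : R, z0 <= z -> linked (edges s) p (c, z).

Lemma far_linked s p q : far s q -> linked (edges s) p q -> far s p.
Proof.
by move=> [c [z0 h]] pq; exists c, z0 => z /h; exact: linked_trans.
Qed.

Lemma far_windp s p : far s p -> windp (edges s) p = 0.
Proof.
move=> [c [z0 h]]; have [B hB] := bound_exists s.
rewrite -(windp_linked (h (Num.max z0 (`|B| + 1)) _)) ?le_max ?lexx //.
apply: windp_out hB _; right => /=.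
rewrite (lt_le_trans _ (ler_norm _)) // lt_max; apply/orP; right.
by have := ler_norm B; lra.
Qed.

Definition generic s c := forall x, x \in s -> x.1 != c.

Lemma generic_near s c : exists2 c0, 0 < c0 & forall d, 0 < d < c0 -> generic s (c + d).
Proof.
have [|c0 c00 h] := @seq_small R _ s (fun (x : pt) d => x.1 != c + d); last by exists c0.
move=> x xs; have [h|h] := ltrP c x.1.
  by exists (x.1 - c) => [|d /andP[d0 d1]]; [lra|lra].
by exists 1 => // d /andP[d0 d1]; lra.
Qed.

Lemma linked_generic s p : ~ bd (edges s) p ->
  exists2 q, linked (edges s) p q & generic s q.1.
Proof.
move=> /bd_avoid[c c0 hc]; have [c1 c10 hg] := generic_near s p.1.
pose d := Num.min c c1 / 2.
have m0 : 0 < Num.min c c1 by rewrite lt_min c0.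
have dc : d < c by rewrite /d ltr_pdivrMr // gt_min; apply/orP; left; lra.
have dc1 : d < c1 by rewrite /d ltr_pdivrMr // gt_min; apply/orP; right; lra.
have d0 : 0 < d by rewrite /d; lra.
exists (p.1 + d, p.2); last by apply: hg; rewrite d0.
apply: linked_seg => r pr; apply: hc; apply: cube_seg pr; first exact: cube_refl.
by split => /=; rewrite ?subrr ?normr0 // addrC addKr gtr0_norm.
Qed.

Definition spans c e := (e.1.1 < c < e.2.1) || (e.2.1 < c < e.1.1).

Lemma seg_spans s e c (z : R) : generic s c -> e \in edges s -> seg e (c, z) ->
  spans c e /\ z = height e.1 e.2 c.
Proof.
move=> gc /mem_edges_both[/gc x1 /gc y1] [t [t01 [cE zE]]].
have xy : e.1.1 != e.2.1.
  by apply: contraNneq x1 => xy; rewrite cE -xy; apply/eqP; ring.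
split; last by rewrite zE /height cE; field; rewrite subr_eq0 eq_sym.
rewrite /spans; have [xy'|yx'] := ltrP e.1.1 e.2.1.
  apply/orP; left; move: x1 y1; rewrite !neq_lt => x1 y1; apply/andP; split; nra.
apply/orP; right; have yx : e.2.1 < e.1.1 by lra.
by move: x1 y1; rewrite !neq_lt => x1 y1; apply/andP; split; nra.
Qed.

Lemma spans_oseg c e : spans c e -> exists2 t, 0 < t < 1 & (c, height e.1 e.2 c) = lin e.1 e.2 t.
Proof.
move=> sp; have xy : e.1.1 != e.2.1 by apply/eqP => xy; move: sp; rewrite /spans xy; case/orP => /andP[]; lra.
exists ((c - e.1.1) / (e.2.1 - e.1.1)); last by rewrite /lin /height; congr pair; field; rewrite subr_eq0 eq_sym.
case/orP: sp => sp.
  by rewrite divr_gt0 ?ltr_pdivrMr ?mul1r; lra.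
by rewrite -mulrNN -invrN divr_gt0 ?ltr_pdivrMr ?mul1r; lra.
Qed.

Lemma linked_up s p (z : R) : generic s p.1 -> ~ bd (edges s) p -> p.2 <= z ->
  (forall e, e \in edges s -> spans p.1 e -> p.2 < height e.1 e.2 p.1 -> z < height e.1 e.2 p.1) ->
  linked (edges s) p (p.1, z).
Proof.
move=> gp bp pz h; apply: linked_seg => r [t [t01 rE]] [e eE er].
have rE' : r = (p.1, (1 - t) * p.2 + t * z) by rewrite rE /lin /=; congr pair; ring.
move: er; rewrite rE' => er; have [sp zE] := seg_spans gp eE er.
have [pe|pe] := eqVneq p.2 (height e.1 e.2 p.1).
  apply: bp; exists e => //; move: er; rewrite zE -pe.
  by rewrite -surjective_pairing.
have pe' : p.2 < height e.1 e.2 p.1 by rewrite lt_neqAle pe -zE; clear_pairs; nra.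
by have := h e eE sp pe'; rewrite -zE; clear_pairs; nra.
Qed.

(** At a lowest vertex the line arrives from above and leaves upwards. If both edges were vertical,
    no direction could point to the right of both, against [corner_vector]. *)
Lemma nonvertical_edge s : simple s -> exists2 e, e \in edges s & e.1.1 != e.2.1.
Proof.
move=> ss; have [s2 us _] := ss; apply: contrapT => hv.
have vert e : e \in edges s -> e.1.1 = e.2.1.
  by move=> eE; apply/eqP; apply: contrapT => /negP ne; apply: hv; exists e.
have s0 : s != [::] by case: (s) s2.
have [||x xs xmin] := @seq_argmin _ s (fun x y => x.2 <= y.2) s0.
- by move=> x y; exact: le_total.
- by move=> y x z; exact: le_trans.
have pE : (prev s x, x) \in edges s by rewrite mem_edges //= mem_prev xs next_prev /=.
have nE : (x, next s x) \in edges s by rewrite mem_edges //= xs eqxx.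
have [m [m1 m2]] := corner_vector ss pE nE.
have p1 := vert _ pE; have n1 := vert _ nE.
have p2 := xmin (prev s x); rewrite mem_prev in p2; have {}p2 := p2 xs.
have n2 := xmin (next s x); rewrite mem_next in n2; have {}n2 := n2 xs.
move: m1 m2 p1 n1 p2 n2; rewrite /dvec /= => + + p1 n1 p2 n2.
rewrite -n1 p1 !subrr !mul0r !subr0; have [h|h] := ltrP 0 m.1.
  by rewrite pmulr_lgt0 // => h1; lra.
by move=> _; rewrite ltNge mulr_ge0_le0 // subr_ge0.
Qed.

Section Packaging.
Variables (s : seq pt) (bR bL : pt).
Hypothesis ss : simple s.
Hypothesis hR : forall e, e \in edges s -> forall t, 0 < t < 1 ->
  exists2 c, 0 < c & forall q, cube (lin e.1 e.2 t) c q -> 0 < orient e.1 e.2 q -> linked (edges s) bR q.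
Hypothesis hL : forall e, e \in edges s -> forall t, 0 < t < 1 ->
  exists2 c, 0 < c & forall q, cube (lin e.1 e.2 t) c q -> orient e.1 e.2 q < 0 -> linked (edges s) bL q.

Lemma near_edge_linked e t : e \in edges s -> 0 < t < 1 ->
  exists2 c, 0 < c & forall q, cube (lin e.1 e.2 t) c q ->
    (0 < orient e.1 e.2 q -> linked (edges s) bR q) /\ (orient e.1 e.2 q < 0 -> linked (edges s) bL q).
Proof.
move=> eE t01; have [c c0 h] := hR eE t01; have [d d0 k] := hL eE t01.
exists (Num.min c d); first by rewrite lt_min c0.
move=> q yq; split; [apply: h|apply: k]; apply: cube_le yq; by rewrite ge_min lexx ?orbT.
Qed.

Lemma orient_vertical x y (h d : R) c : x.1 != y.1 ->
  orient x y (c, height x y c + d) = (x.1 - y.1) * d.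
Proof. by move=> xy; rewrite /orient /height /=; field; rewrite subr_eq0 eq_sym. Qed.

(** Below an edge that runs to the right lies its right side, and above it its left side; an edge
    that runs to the left has them exchanged. No other edge comes near, so [e] alone changes the
    crossing number. *)
Lemma above_below e c : e \in edges s -> spans c e ->
  exists2 d0, 0 < d0 & forall d, 0 < d < d0 ->
  let lo := (c, height e.1 e.2 c - d) in let hi := (c, height e.1 e.2 c + d) in
  (linked (edges s) bR lo /\ linked (edges s) bL hi /\ windp (edges s) lo = windp (edges s) hi + 1) \/
  (linked (edges s) bL lo /\ linked (edges s) bR hi /\ windp (edges s) hi = windp (edges s) lo + 1).
Proof.
move=> eE sp; have [t t01 yE] := spans_oseg sp.
have [c1 c10 h1] := near_edge_linked eE t01.
have [c2 c20 h2] := @other_edges _ s e (lin e.1 e.2 t) ss eE (ex_intro _ t (conj t01 erefl)).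
rewrite -yE in h1 h2; set h := height _ _ _ in yE h1 h2 *.
have xy : e.1.1 != e.2.1 by apply/eqP => xy; move: sp; rewrite /spans xy; case/orP => /andP[]; lra.
exists (Num.min c1 c2); first by rewrite lt_min c10.
move=> d /andP[d0]; rewrite lt_min => /andP[dc1 dc2] lo hi.
have cu k : d < k -> 0 < k -> cube (c, h) k lo /\ cube (c, h) k hi.
  move=> dk k0; rewrite /lo /hi; split; split => /=; rewrite ?subrr ?normr0 // addrC addKr ?normrN gtr0_norm //.
have [l1 l2] := cu _ dc1 c10; have [k1 k2] := cu _ dc2 c20.
have [lR lL] := h1 _ l1; have [hR' hL'] := h1 _ l2.
have olo : orient e.1 e.2 lo = (e.2.1 - e.1.1) * d.
  by rewrite /lo orient_vertical //; ring.
have ohi : orient e.1 e.2 hi = (e.1.1 - e.2.1) * d by rewrite /hi orient_vertical.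
have dpoly : windp (edges s) lo - windp (edges s) hi = crossp lo e - crossp hi e.
  rewrite /windp -sumrB (bigD1_seq e) //=; last first.
    by have [_ us _] := ss; rewrite edges_next // map_inj_uniq // => u v [].
  rewrite big_seq_cond big1 ?addr0 // => f /andP[fE fe]; rewrite [f]surjective_pairing.
  (* [lo] and [hi] have the same abscissa, so the range in the potential of [crossp_free] is
     empty. *)
  rewrite crossp_free //=.
    by rewrite !itv_ocF.
  by move=> r /(cube_seg k1 k2) /h2 /(_ f fE fe); rewrite -surjective_pairing.
have [xy'|yx] := ltrP e.1.1 e.2.1.
  left; split; [apply: lR; rewrite olo; nra|split; [apply: hL'; rewrite ohi; nra|]].
  rewrite -[LHS](subrK (windp (edges s) hi)) dpoly addrC; congr (_ + _).
  rewrite /crossp olo ohi /=.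
  have -> : e.1.1 <= c < e.2.1 by case/orP: sp => /andP[]; lra.
  have -> : (e.2.1 <= c < e.1.1) = false by apply/negP => /andP[]; lra.
  rewrite /= !(pmulr_lgt0 _ d0) !subr_gt0 xy' [e.2.1 < e.1.1]ltNge (ltW xy') /=.
  by rewrite subr0.
have yx' : e.2.1 < e.1.1 by lra.
right; split; [apply: lL; rewrite olo; nra|split; [apply: hR'; rewrite ohi; nra|]].
rewrite -[LHS](subrK (windp (edges s) lo)) -opprB dpoly addrC; congr (_ + _).
have oN q : orient e.2 e.1 q = - orient e.1 e.2 q by rewrite /orient; ring.
rewrite /crossp !oN olo ohi /=.
have -> : e.2.1 <= c < e.1.1 by case/orP: sp => /andP[]; lra.
have -> : (e.1.1 <= c < e.2.1) = false by apply/negP => /andP[]; lra.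
rewrite -!mulNr !opprB /= !(pmulr_lgt0 _ d0) !subr_gt0 yx' [e.1.1 < e.2.1]ltNge (ltW yx') /=.
by [].
Qed.

Lemma windp_sides : windp (edges s) bR = windp (edges s) bL + 1.
Proof.
have [e eE xy] := nonvertical_edge ss.
have sp : spans ((e.1.1 + e.2.1) / 2) e.
  by rewrite /spans; have [xy'|yx] := ltrP e.1.1 e.2.1; apply/orP; [left|right]; lra.
have [d0 d00 hd] := above_below eE sp.
have [|[h1 [h2 h3]]|[h1 [h2 h3]]] := hd (d0 / 2); first by lra.
  by rewrite -(windp_linked h1) -(windp_linked h2).
by rewrite -(windp_linked h1) -(windp_linked h2).
Qed.

(** Climb vertically from [p]: either no edge is met, or the lowest edge above [p] is approached
    from below, which is one of its two sides. *)
Lemma up_cases p : generic s p.1 -> ~ bd (edges s) p ->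
  [\/ far s p, linked (edges s) bR p | linked (edges s) bL p].
Proof.
move=> gp bp; pose A := [seq e <- edges s | spans p.1 e && (p.2 < height e.1 e.2 p.1)].
have [A0|A0] := eqVneq A [::].
  apply: Or31; exists p.1, p.2 => h pz; apply: linked_up => // e eE sp he.
  have : e \in A by rewrite mem_filter sp he.
  by rewrite A0.
have [||e] := seq_argmin A0 (r := fun e f => height e.1 e.2 p.1 <= height f.1 f.2 p.1).
- by move=> e f; exact: le_total.
- by move=> e f g; exact: le_trans.
rewrite mem_filter => /andP[/andP[sp ph] eE] emin.
have [d0 d00 hd] := above_below eE sp.
pose d := Num.min d0 (height e.1 e.2 p.1 - p.2) / 2.
have m0 : 0 < Num.min d0 (height e.1 e.2 p.1 - p.2) by rewrite lt_min d00 subr_gt0.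
have dd0 : 0 < d < d0.
  apply/andP; split; first by rewrite /d; lra.
  by rewrite /d ltr_pdivrMr // gt_min; apply/orP; left; lra.
have dh : d < height e.1 e.2 p.1 - p.2.
  by rewrite /d ltr_pdivrMr // gt_min; apply/orP; right; lra.
have lp : linked (edges s) p (p.1, height e.1 e.2 p.1 - d).
  apply: linked_up => // [|f fE spf hf]; first by lra.
  have := emin f; rewrite mem_filter spf hf fE => /(_ isT) h; lra.
have [[h1 _]|[h1 _]] := hd d dd0.
  by apply: Or32; apply: linked_trans h1 (linked_sym lp).
by apply: Or33; apply: linked_trans h1 (linked_sym lp).
Qed.

(** A point just above the topmost edge over a generic abscissa has a free vertical ray, so the side
    it lies on is exterior. *)
Lemma far_side : far s bR \/ far s bL.
Proof.
have [e0 e0E xy] := nonvertical_edge ss.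
pose m := (e0.1.1 + e0.2.1) / 2.
have [c0 c00 gc] := generic_near s m.
pose D := `|e0.2.1 - e0.1.1| / 2.
have D0 : 0 < D by rewrite divr_gt0 // normr_gt0 subr_eq0 eq_sym.
pose k := Num.min c0 D / 2.
have m0 : 0 < Num.min c0 D by rewrite lt_min c00.
have kc : 0 < k < c0.
  apply/andP; split; first by rewrite /k; lra.
  by rewrite /k ltr_pdivrMr // gt_min; apply/orP; left; lra.
have kD : k < D by rewrite /k ltr_pdivrMr // gt_min; apply/orP; right; lra.
(* The middle of a nonvertical edge, shifted slightly to avoid all vertices, so that at least one
   edge spans this abscissa. *)
pose c := m + k; have gen : generic s c by exact: gc.
have sp0 : spans c e0.
  rewrite /spans /c /m; move: kD; rewrite /D; have [xy'|yx] := ltrP e0.1.1 e0.2.1.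
    by move=> kD; apply/orP; left; lra.
  by move=> kD; apply/orP; right; lra.
pose A := [seq e <- edges s | spans c e].
have e0A : e0 \in A by rewrite mem_filter sp0.
have A0 : A != [::] by apply/eqP => A0; rewrite A0 in e0A.
have [||e] := seq_argmin A0 (r := fun e f => height f.1 f.2 c <= height e.1 e.2 c).
- by move=> e f; exact: le_total.
- by move=> e f g h1 h2; exact: le_trans h2 h1.
rewrite mem_filter => /andP[sp eE] emax.
have [d0 d00 hd] := above_below eE sp.
have d01 : 0 < d0 / 2 < d0 by lra.
have farhi b : linked (edges s) b (c, height e.1 e.2 c + d0 / 2) -> far s b.
  move=> lb; apply: (far_linked _ lb); exists c, (height e.1 e.2 c + d0 / 2) => z hz.
  apply: (@linked_up s (c, height e.1 e.2 c + d0 / 2)) => //; first exact: linked_bd lb.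
  by move=> f fE spf /= hf; have := emax f; rewrite mem_filter spf fE => /(_ isT) h; lra.
have [[_ [h1 _]]|[_ [h1 _]]] := hd _ d01; first by right; exact: farhi.
by left; exact: farhi.
Qed.

End Packaging.

(** [k] is the crossing number to the right of the edges and [k - 1] the one to the left. One side
    is exterior and has crossing number 0, so [k] is 1 when the interior lies on the right and 0
    when it lies on the left; the interior has value [2 * k - 1]. *)
Theorem jordan s : simple s -> exists k : int, [/\ k = 0 \/ k = 1,
  forall p, ~ bd (edges s) p -> windp (edges s) p = 0 \/ windp (edges s) p = 2 * k - 1,
  forall p, ~ bd (edges s) p -> windp (edges s) p = 0 -> far s p &
  forall e t, e \in edges s -> 0 < t < 1 -> exists2 c, 0 < c & forall q, cube (lin e.1 e.2 t) c q ->
    (0 < orient e.1 e.2 q -> ~ bd (edges s) q /\ windp (edges s) q = k) /\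
    (orient e.1 e.2 q < 0 -> ~ bd (edges s) q /\ windp (edges s) q = k - 1)].
Proof.
move=> ss; have [bR hR0] := side_linked ss (oner_neq0 R).
have n10 : -1 != 0 :> R by rewrite oppr_eq0 oner_neq0.
have [bL hL0] := side_linked ss n10.
have hR e : e \in edges s -> forall t, 0 < t < 1 ->
    exists2 c, 0 < c & forall q, cube (lin e.1 e.2 t) c q -> 0 < orient e.1 e.2 q -> linked (edges s) bR q.
  by move=> eE t t01; have [c c0 h] := hR0 e eE t t01; exists c => // q yq oq; apply: h; rewrite ?mul1r.
have hL e : e \in edges s -> forall t, 0 < t < 1 ->
    exists2 c, 0 < c & forall q, cube (lin e.1 e.2 t) c q -> orient e.1 e.2 q < 0 -> linked (edges s) bL q.
  by move=> eE t t01; have [c c0 h] := hL0 e eE t t01; exists c => // q yq oq; apply: h; rewrite ?mulN1r ?oppr_gt0.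
have wRL := windp_sides ss hR hL.
have fs := far_side ss hR hL.
set k := windp (edges s) bR in wRL.
have wL : windp (edges s) bL = k - 1 by rewrite wRL addrK.
have k01 : k = 0 \/ k = 1.
  case: fs => /far_windp h; first by left.
  by right; rewrite wRL h.
have cases p : ~ bd (edges s) p -> [\/ far s p, linked (edges s) bR p | linked (edges s) bL p].
  move=> bp; have [q pq gq] := linked_generic bp.
  have [h|h|h] := up_cases ss hR hL gq (linked_bd pq).
  - by apply: Or31; exact: far_linked h pq.
  - by apply: Or32; exact: linked_trans h (linked_sym pq).
  - by apply: Or33; exact: linked_trans h (linked_sym pq).
exists k; split => //.
- move=> p /cases[/far_windp->|/windp_linked->|/windp_linked->]; first by left.
    by rewrite -/k; case: k01 => ->; [left|right].
  by rewrite wL; case: k01 => ->; [right|left].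
- move=> p /cases[//|h|h]; rewrite (windp_linked h) => w0.
    case: fs => [fb|/far_windp]; first exact: far_linked fb (linked_sym h).
    by rewrite wL {1}/k w0.
  case: fs => [/far_windp|fb]; last exact: far_linked fb (linked_sym h).
  by rewrite -/k => k0; move: w0; rewrite wL k0.
- move=> e t eE t01; have [c c0 h] := near_edge_linked hR hL eE t01.
  exists c => // q /h[h1 h2]; split => [/h1 lq|/h2 lq].
    by split; [exact: linked_bd lq|rewrite (windp_linked lq)].
  by split; [exact: linked_bd lq|rewrite (windp_linked lq)].
Qed.

End Jordan.

(** * Triangles and diagonals *)

Section Triangles.
Variable R : realType.
Local Notation pt := (R * R)%type.
Local Notation tri := (pt * pt * pt)%type.
Implicit Types (x y z q p a b v u : pt) (e : pt * pt) (c t : R) (s : seq pt) (E : seq (pt * pt)) (T : tri).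

Definition tedges T : seq (pt * pt) := [:: (T.1.1, T.1.2); (T.1.2, T.2); (T.2, T.1.1)].
Definition torient T : R := orient T.1.1 T.1.2 T.2.
Definition corners T : seq pt := [:: T.1.1; T.1.2; T.2].

Lemma tedges_edges x y z : tedges (x, y, z) = edges [:: x; y; z].
Proof. by []. Qed.

Lemma orient_sum x y z q : orient x y q + orient y z q + orient z x q = orient x y z.
Proof. by rewrite /orient; ring. Qed.

Lemma orient_rot x y z : orient y z x = orient x y z.
Proof. by rewrite /orient; ring. Qed.

Lemma orientN x y q : orient y x q = - orient x y q.
Proof. by rewrite /orient; ring. Qed.

Definition in_tri T q := [/\ 0 <= orient T.1.1 T.1.2 q, 0 <= orient T.1.2 T.2 q & 0 <= orient T.2 T.1.1 q].

Lemma crosspE q x y : crossp q (x, y) =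
  ([&& x.1 <= q.1, ~~ (y.1 <= q.1) & 0 < orient x y q])%:Z
  - ([&& y.1 <= q.1, ~~ (x.1 <= q.1) & orient x y q < 0])%:Z.
Proof. by rewrite /crossp /= -!ltNge (orientN x y) oppr_gt0 !andbA. Qed.

Lemma windp_tri_rot x y z q : windp (tedges (y, z, x)) q = windp (tedges (x, y, z)) q.
Proof. by rewrite /windp !big_cons !big_nil !addr0 /= addrA [RHS]addrC. Qed.

(** The vertical line through [q] separates at most one corner from the other two. After a rotation
    this corner is [x], the edge [(y, z)] does not count, and the signs of the barycentric
    coordinates decide. *)
Lemma windp_tri T q : 0 < torient T ->
  windp (tedges T) q = 0 \/ (windp (tedges T) q = 1 /\ in_tri T q).
Proof.
suff H x y z : 0 < orient x y z -> (x.1 <= q.1) != (y.1 <= q.1) -> (y.1 <= q.1) = (z.1 <= q.1) ->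
    windp (tedges (x, y, z)) q = 0 \/ (windp (tedges (x, y, z)) q = 1 /\ in_tri (x, y, z) q).
  case: T => -[x y] z; rewrite /torient /= => D0.
  have [xy|xy] := eqVneq (x.1 <= q.1) (y.1 <= q.1); last first.
    have [yz|yz] := eqVneq (y.1 <= q.1) (z.1 <= q.1); first exact: H.
    rewrite -windp_tri_rot; have [|||->|[-> [h1 h2 h3]]] := H y z x.
    - by rewrite orient_rot.
    - by [].
    - by move: xy yz; case: (_ <= _); case: (_ <= _); case: (_ <= _).
    - by left.
    - by right.
  have [yz|yz] := eqVneq (y.1 <= q.1) (z.1 <= q.1).
    left; rewrite /windp !big_cons !big_nil !crosspE /= xy -yz.
    by case: (y.1 <= q.1); rewrite /= ?andbF.
  rewrite (windp_tri_rot z x y).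
  have [|||->|[-> [h1 h2 h3]]] := H z x y.
  - by rewrite -orient_rot.
  - by rewrite xy eq_sym.
  - by [].
  - by left.
  - by right.
move=> D0 xy yz; rewrite /windp !big_cons !big_nil !addr0 !crosspE -yz.
(* Up to the factor [orient x y z], the values [orient z x q] and [orient x y q] are the barycentric
   weights of [y] and [z]. *)
have key : orient x y z * (q.1 - x.1) = orient z x q * (y.1 - x.1) + orient x y q * (z.1 - x.1).
  by rewrite /orient; ring.
have sum := orient_sum x y z q.
rewrite /in_tri /=.
move: key sum D0; set D := orient x y z; set A := orient x y q; set B := orient y z q; set C := orient z x q.
move: xy yz; have [hx|hx] := lerP x.1 q.1; have [hy|hy] := lerP y.1 q.1; have [hz|hz] := lerP z.1 q.1 => //= _ _ key sum D0.
  have [hA|hA] := ltrP 0 A; have [hC|hC] := ltrP C 0; rewrite /=.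
  - by left.
  - by right; split => //; split; nra.
  - by exfalso; nra.
  - by left.
have [hA|hA] := ltrP A 0; have [hC|hC] := ltrP 0 C; rewrite /=.
- by left.
- by exfalso; nra.
- by right; split => //; split; nra.
- by left.
Qed.

Definition negp p : pt := (- p.1, - p.2).

(** The reflection exchanges the two displacements but also turns the upward ray into a downward
    one. The counts along the two rays differ by the coboundary of the indicator of the half-plane
    to the left of [q]. *)
Lemma windm_reflect s q :
  windm (edges s) q = windp (edges (map negp s)) (negp q).
Proof.
have -> : edges (map negp s) = [seq (negp e.1, negp e.2) | e <- edges s].
  rewrite /edges -map_rot; move: s (rot 1 s); elim=> [|x s1 IH] [|y s2] //=.
  by rewrite IH.
rewrite /windp big_map; apply/eqP; rewrite -subr_eq0 /windm -sumrB.
pose phi x : int := - (nat_of_bool (x.1 < q.1)%R)%:Z.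
rewrite (eq_bigr (fun e => phi e.2 - phi e.1)) ?sum_edges // => -[x y] _.
have oN (a b d : pt) : orient (negp a) (negp b) (negp d) = orient a b d by rewrite /orient /negp /=; ring.
rewrite /crossm /crossp /phi /= !lerN2 !ltrN2 !oN (orientN x y) oppr_gt0 oppr_ge0.
by have [h1|h1] := ltrP x.1 q.1; have [h2|h2] := ltrP y.1 q.1 => //=; have [h|h|h] := ltrgtP (orient x y q) 0.
Qed.

Lemma windm_tri T q : 0 < torient T ->
  windm (tedges T) q = 0 \/ (windm (tedges T) q = 1 /\ in_tri T q).
Proof.
case: T => -[x y] z D0; rewrite tedges_edges windm_reflect /=.
have oN (a b d : pt) : orient (negp a) (negp b) (negp d) = orient a b d by rewrite /orient /negp /=; ring.
have := @windp_tri (negp x, negp y, negp z) (negp q); rewrite /torient /in_tri /= !oN => /(_ D0).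
by case=> [->|[-> h]]; [left|right].
Qed.

Lemma windp_corner x y z : 0 < orient x y z ->
  windp (tedges (x, y, z)) x = (nat_of_bool (y.1 <= x.1 < z.1)%R)%:Z /\
  windm (tedges (x, y, z)) x = (nat_of_bool (z.1 < x.1 <= y.1)%R)%:Z.
Proof.
move=> D0; have o1 : orient x y x = 0 by rewrite /orient; ring.
have o2 : orient z x x = 0 by rewrite /orient; ring.
have o3 : orient y z x = orient x y z by exact: orient_rot.
rewrite /windp /windm !big_cons !big_nil /crossp /crossm /= !(orientN x y) !(orientN z x) !(orientN y z).
have n1 : (0 < - orient x y z) = false by rewrite oppr_gt0 ltNge ltW.
have n2 : (0 <= - orient x y z) = false by rewrite oppr_ge0 leNgt D0.
rewrite o1 o2 o3 !oppr0 !ltxx !lexx D0 (ltW D0) n1 n2 /= ?andbF ?andbT.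
by case: (ltrgtP y.1 x.1) => h1; case: (ltrgtP z.1 x.1) => h2.
Qed.

Definition wind2 E q : int := windp E q + windm E q.

(** The corner that counts is the one whose abscissa lies between the other two; the half-open
    inequalities of [windp_corner] select exactly one in case of ties. *)
Lemma corner_sum T : 0 < torient T -> \sum_(p <- corners T) wind2 (tedges T) p = 1.
Proof.
case: T => -[x y] z; rewrite /torient /= => D0.
have D1 : 0 < orient y z x by rewrite orient_rot.
have D2 : 0 < orient z x y by rewrite orient_rot.
have [a1 a2] := windp_corner D0; have [b1 b2] := windp_corner D1; have [c1 c2] := windp_corner D2.
have rm a b d q : windm (tedges (b, d, a)) q = windm (tedges (a, b, d)) q.
  by rewrite /windm !big_cons !big_nil !addr0 /= addrA [RHS]addrC.
rewrite /corners !big_cons big_nil /wind2 /= a1 a2.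
rewrite windp_tri_rot in b1; rewrite rm in b2; rewrite b1 b2.
rewrite 2!windp_tri_rot in c1; rewrite 2!rm in c2; rewrite c1 c2.
have : ~~ ((x.1 == y.1) && (y.1 == z.1)).
  apply/negP => /andP[/eqP e1 /eqP e2].
  by move: D0; rewrite /orient e1 e2 !subrr mulr0 mul0r subrr ltxx.
clear; move: x.1 y.1 z.1 => a b d.
by case: (ltrgtP a b) => h1; case: (ltrgtP b d) => h2; case: (ltrgtP a d) => h3 //= _; exfalso; lra.
Qed.

Definition above p x : int := (nat_of_bool ((x.1 == p.1) && (p.2 < x.2)))%:Z.

(** Passing from one displacement of [p] to the other affects an edge that misses [p] only through
    an end on the vertical line above [p], and these changes form a coboundary. *)
Lemma crossm_crossp x y p : ~ seg (x, y) p ->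
  crossm p (x, y) - crossp p (x, y) = above p y - above p x.
Proof.
wlog xy : x y / x.1 <= y.1 => [hw|].
  have [xy|/ltW yx] := leP x.1 y.1; first exact: hw.
  by rewrite segC crosspN crossmN => /(hw _ _ yx) /=; lia.
have [xy'|yx] := ltrP x.1 y.1 => np; last first.
  have xE : x.1 = y.1 by lra.
  rewrite /crossp /crossm /= xE !itv_coF // !itv_ocF //=.
  rewrite /above xE; have [pE|//] := eqVneq y.1 p.1.
  rewrite /= (_ : (p.2 < y.2) = (p.2 < x.2)) ?subrr //.
  have h : 0 < (p.2 - x.2) * (p.2 - y.2).
    rewrite ltNge; apply/negP => h; apply: np.
    by have := seg_vertical xE h; rewrite xE pE -surjective_pairing.
  by apply/idP/idP; nra.
have O0 : x.1 <= p.1 <= y.1 -> orient x y p != 0.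
  move=> px; apply/eqP => O0; apply: np.
  have := height_seg xy' px; rewrite (_ : height x y p.1 = p.2) -?surjective_pairing //.
  by move: O0; rewrite orient_height // => /eqP; rewrite mulf_eq0 subr_eq0; lra.
rewrite /crossp /crossm /= [in X in X - _](itv_ocF _ xy) [in X in _ - X](itv_coF _ xy) /= !subr0.
rewrite /above.
have [px|px|px] := ltrgtP p.1 x.1.
- by rewrite /= (gt_eqF (lt_trans px xy')).
- rewrite /=; have o0 h := O0 (introT andP (conj (ltW px) h)).
  have [py|py|py] := ltrgtP p.1 y.1 => //=.
    by rewrite le_eqVlt eq_sym (negbTE (o0 (ltW py))) /= subrr.
  have py' : p.1 <= y.1 by rewrite py.
  rewrite !subr0; congr (Posz (nat_of_bool _)).
  rewrite le_eqVlt eq_sym (negbTE (o0 py')) /= (_ : orient x y p = (y.1 - x.1) * (y.2 - p.2)).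
    by rewrite pmulr_rgt0 ?subr_gt0.
  by rewrite /orient py; ring.
- rewrite /= px xy' /= (gt_eqF xy') /= !sub0r; congr (- Posz (nat_of_bool _)).
  rewrite (_ : orient x y p = (y.1 - x.1) * (x.2 - p.2)); last by rewrite /orient px; ring.
  by rewrite pmulr_rgt0 subr_gt0.
Qed.

(** The two displacements of a point inside an edge lie on opposite sides of it, also when the edge
    is vertical because [delta] is positive. *)
Lemma crossm_crossp_oseg x y p : x != y -> oseg (x, y) p ->
  let d := crossm p (x, y) - crossp p (x, y) - (above p y - above p x) in d = 1 \/ d = -1.
Proof.
wlog xy : x y / x.1 <= y.1 => [hw|].
  have [xy|/ltW yx] := leP x.1 y.1; first exact: hw.
  rewrite eq_sym => xy [t [t01 pE]] /=; rewrite (crosspN p x y) (crossmN p x y).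
  have [|h|h] := hw _ _ yx xy; last 2 first.
  - by right; move: h; lia.
  - by left; move: h; lia.
  by exists (1 - t); split; [lra|rewrite pE linC].
move=> xny [t [t01 pE]] /=; have pE1 := congr1 fst pE; have pE2 := congr1 snd pE.
rewrite /= in pE1 pE2.
have [xy'|yx] := ltrP x.1 y.1.
  have o0 : orient x y p = 0 by rewrite pE /orient /lin /=; ring.
  have px : x.1 < p.1 by clear pE; nra.
  have py : p.1 < y.1 by clear pE; nra.
  left; rewrite /crossp /crossm /above /= (itv_ocF _ xy) (itv_coF _ xy) o0 ltxx lexx px (ltW py).
  by rewrite (lt_eqF px) (gt_eqF py) /= andbF.
have xE : x.1 = y.1 by lra.
rewrite /crossp /crossm /above /= pE1 -xE !itv_coF // !itv_ocF //= (_ : (1 - t) * x.1 + t * x.1 = x.1); last by ring.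
rewrite eqxx /= pE2.
have : x.2 != y.2 by apply: contraNneq xny => e; rewrite [x]surjective_pairing xE e -surjective_pairing.
rewrite neq_lt => /orP[h|h].
  have -> : ((1 - t) * x.2 + t * y.2 < y.2) by nra.
  rewrite (_ : ((1 - t) * x.2 + t * y.2 < x.2) = false); last by apply/negP; nra.
  by right.
have -> : ((1 - t) * x.2 + t * y.2 < x.2) by nra.
rewrite (_ : ((1 - t) * x.2 + t * y.2 < y.2) = false); last by apply/negP; nra.
by left.
Qed.

Lemma windm_windp s p : windm (edges s) p - windp (edges s) p =
  \sum_(e <- edges s) (crossm p e - crossp p e - (above p e.2 - above p e.1)).
Proof. rewrite [RHS]sumrB sum_edges subr0 /windp /windm.
by rewrite -sumrB. Qed.

Lemma windm_off s p : ~ bd (edges s) p -> windm (edges s) p = windp (edges s) p.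
Proof.
move=> bp; apply/eqP; rewrite -subr_eq0 windm_windp big_seq big1 // => -[x y] eE.
by rewrite crossm_crossp ?subrr // => ep; apply: bp; exists (x, y).
Qed.

Lemma windm_windp_edge s e p : simple s -> e \in edges s -> oseg e p ->
  windm (edges s) p - windp (edges s) p = 1 \/ windm (edges s) p - windp (edges s) p = -1.
Proof.
move=> ss eE ep; rewrite windm_windp; have [_ us _] := ss.
rewrite (bigD1_seq e) //=; last by rewrite edges_next // map_inj_uniq // => u v [].
rewrite big_seq_cond big1 ?addr0 // => [|[x y] /andP[fE fe]].
  case: e eE ep => x y eE ep; apply: crossm_crossp_oseg => //.
  move: eE; rewrite mem_edges // => /andP[xs /eqP/= ->]; rewrite eq_sym; exact: next_neq.
rewrite crossm_crossp ?subrr // => fp.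
by rewrite (simple_oseg ss eE fE ep fp) eqxx in fe.
Qed.

Lemma seg_fst x y q : x.1 <= y.1 -> seg (x, y) q -> x.1 <= q.1 <= y.1.
Proof. by move=> xy [t [t01 ->]]; rewrite /lin /=; apply/andP; split; nra. Qed.

(** The offset [(c ^+ 2, c)] is [c] times [(delta, 1)] with [delta = c], so that [delta] tends to 0
    along with the distance, as an infinitesimal should. *)
Lemma crossp_limit x y p : exists2 c0, 0 < c0 & forall c, 0 < c < c0 ->
  crossp (p.1 + c ^+ 2, p.2 + c) (x, y) = crossp p (x, y) /\ ~ seg (x, y) (p.1 + c ^+ 2, p.2 + c).
Proof.
wlog xy : x y / x.1 <= y.1 => [hw|].
  have [xy|/ltW yx] := leP x.1 y.1; first exact: hw.
  have [c0 c00 h] := hw _ _ yx; exists c0 => // c /h[h1 h2]; split; last by rewrite segC.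
  by rewrite (crosspN _ x y) h1 -crosspN.
have sq c : 0 < c < 1 -> 0 < c ^+ 2 < c by move=> c01; rewrite expr2; apply/andP; split; nra.
have out c : y.1 < p.1 + c ^+ 2 \/ p.1 + c ^+ 2 < x.1 -> ~ seg (x, y) (p.1 + c ^+ 2, p.2 + c).
  by move=> h /(seg_fst xy) /= /andP[h1 h2]; case: h; lra.
have crE q : crossp q (x, y) = (nat_of_bool ((x.1 <= q.1 < y.1) && (0 < orient x y q)))%:Z.
  by rewrite /crossp /= (itv_coF _ xy) subr0.
have [px|xp] := ltrP p.1 x.1.
  exists (Num.min 1 (x.1 - p.1)); first by rewrite lt_min ltr01 subr_gt0.
  move=> c; rewrite lt_min => /and3P[c0 c1 cx].
  have /sq/andP[s1 s2] : 0 < c < 1 by rewrite c0.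
  split; last by apply: out; right; lra.
  rewrite !crE /= (lt_geF px) (_ : (x.1 <= p.1 + c ^+ 2) = false) //.
  by apply/negbTE; rewrite -ltNge; lra.
have [py|yp] := ltrP p.1 y.1; last first.
  exists 1 => // c /sq/andP[s1 s2]; split; last by apply: out; left; lra.
  rewrite !crE /= [p.1 < y.1]ltNge yp (_ : (p.1 + c ^+ 2 < y.1) = false) ?andbF //.
  by apply/negbTE; rewrite -leNgt; lra.
pose K := `|y.2 - x.2|.
have K0 : 0 <= K := normr_ge0 _.
have xy' : x.1 < y.1 by lra.
have oE c : orient x y (p.1 + c ^+ 2, p.2 + c) =
    orient x y p + (c * (c * (y.2 - x.2)) - c * (y.1 - x.1)).
  by rewrite /orient /=; ring.
have Kn : - K <= y.2 - x.2 <= K by rewrite -ler_norml.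
pose O := orient x y p; pose M := K + (y.1 - x.1) + 1.
have M0 : 0 < M by rewrite /M; lra.
pose c1 := if 0 < O then O / M else 1.
have c10 : 0 < c1 by rewrite /c1; case: ifP => // O0; rewrite divr_gt0.
(* These bounds keep the point to the left of [y], let the term [- c * (y.1 - x.1)] dominate the
   quadratic one, and preserve the sign of a positive [O]. *)
exists (Num.min (Num.min 1 (y.1 - p.1)) (Num.min ((y.1 - x.1) / (K + 1)) c1)).
  by rewrite !lt_min ltr01 subr_gt0 py divr_gt0 ?subr_gt0 //; lra.
move=> c; rewrite !lt_min ltr_pdivlMr; last by lra.
move=> /andP[c0 /andP[/andP[c1' cy] /andP[cK cc1]]].
have /sq/andP[s1 s2] : 0 < c < 1 by rewrite c0.
have oN : (0 < orient x y (p.1 + c ^+ 2, p.2 + c)) = (0 < O) /\ orient x y (p.1 + c ^+ 2, p.2 + c) != 0.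
  rewrite oE -/O; have cK' : - (c * K) <= c * (y.2 - x.2) <= c * K by apply/andP; split; nra.
  have [hO|hO] := ltrP 0 O.
    have : c * M < O by rewrite -ltr_pdivlMr //; move: cc1; rewrite /c1 hO.
    rewrite /M => cM.
    have pos : 0 < O + (c * (c * (y.2 - x.2)) - c * (y.1 - x.1)) by nra.
    by rewrite pos; split => //; rewrite gt_eqF.
  have neg : O + (c * (c * (y.2 - x.2)) - c * (y.1 - x.1)) < 0.
    have : c * (y.2 - x.2) < y.1 - x.1 by nra.
    by rewrite -subr_lt0 => h; nra.
  by rewrite (lt_gtF neg); split => //; rewrite lt_eqF.
split; last by move=> /orient_seg /eqP; apply/negP; case: oN.
rewrite !crE oN.1 /= xp py (_ : (x.1 <= p.1 + c ^+ 2)); last by lra.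
by rewrite (_ : (p.1 + c ^+ 2 < y.1)) //; lra.
Qed.

(** Transfers what is known of crossing numbers off the polygon to points on it, where [windp] looks
    in a fixed direction. *)
Lemma windp_limit s p : exists2 q, ~ bd (edges s) q & windp (edges s) q = windp (edges s) p.
Proof.
pose g c : pt := (p.1 + c ^+ 2, p.2 + c).
have [|c0 c00 h] := @seq_small R _ (edges s) (fun e c => crossp (g c) e = crossp p e /\ ~ seg e (g c)).
  by move=> [x y] _; exact: crossp_limit.
have c1 : 0 < c0 / 2 < c0 by lra.
exists (g (c0 / 2)); first by move=> [e eE]; have [_] := h _ c1 e eE.
by rewrite /windp; apply: eq_big_seq => e /(h _ c1)[].
Qed.

End Triangles.

(** * Existence of an interior diagonal *)

Section Diagonal.
Variable R : realType.
Local Notation pt := (R * R)%type.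
Implicit Types (q p a b : pt) (e : pt * pt) (c t : R) (s : seq pt).

Definition sided s (k : int) := forall e t, e \in edges s -> 0 < t < 1 ->
  exists2 c, 0 < c & forall q, cube (lin e.1 e.2 t) c q ->
    (0 < orient e.1 e.2 q -> ~ bd (edges s) q /\ windp (edges s) q = k) /\
    (orient e.1 e.2 q < 0 -> ~ bd (edges s) q /\ windp (edges s) q = k - 1).

Definition affine (al : pt -> R) := forall a b t, al (lin a b t) = (1 - t) * al a + t * al b.

(** Between [q] and [p] the coordinate [al] vanishes once. The last inequality makes [be]
    nonnegative there, and since [al + be] does not increase towards [p], [be] is at most 1: the
    segment crosses the forbidden side. *)
Lemma exit_side (al be : pt -> R) p p' q t : affine al -> affine be ->
  (forall r, 0 < r < 1 -> ~ (al (lin p p' r) = 0 /\ 0 <= be (lin p p' r) <= 1)) ->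
  0 <= t <= 1 -> q = lin p p' t -> 0 < al q -> 0 < be q -> al q + be q <= 1 ->
  al p + be p <= al q + be q -> al p < 0 -> 0 <= al q * be p - al p * be q -> False.
Proof.
move=> hal hbe h t01 qE aq bq abq abp ap ex.
have d0 : 0 < al q - al p by lra.
pose r := al q / (al q - al p).
have r01 : 0 < r < 1 by rewrite /r divr_gt0 // ltr_pdivrMr //; lra.
have t0 : 0 < t.
  case/andP: t01 => t0 _; rewrite lt_neqAle t0 andbT; apply/eqP => tE.
  by move: aq; rewrite qE -tE lin0; lra.
have xE : lin p p' (t * (1 - r)) = lin q p r by rewrite qE /lin /=; congr pair; ring.
have ax : al (lin q p r) = 0 by rewrite hal /r; field; lra.
have bx : be (lin q p r) = (al q * be p - al p * be q) / (al q - al p).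
  by rewrite hbe /r; field; lra.
apply: (h (t * (1 - r))); first by clear_pairs; apply/andP; split; nra.
rewrite xE ax; split => //; rewrite bx; apply/andP; split; first by rewrite divr_ge0 // ltW.
by rewrite ler_pdivrMr // mul1r; clear_pairs; nra.
Qed.

(** The level [al + be] is 1 at [p] and at most 1 at [q] without decreasing from [p] to [q], so the
    whole segment lies on the line of level 1. *)
Lemma leave_corner (al be : pt -> R) p p' q t : affine al -> affine be ->
  0 <= t <= 1 -> q = lin p p' t -> 0 < al q -> 0 < be q -> al q + be q <= 1 ->
  al p = 1 -> be p = 0 -> al p + be p <= al q + be q ->
  [/\ 0 < be p', al p' + be p' = 1, al q + be q = 1 &
      al p' < 0 -> exists2 r, 0 < r < 1 & al (lin p p' r) = 0 /\ be (lin p p' r) = 1].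
Proof.
move=> hal hbe t01 qE aq bq abq ap bp abp.
have aE : al q = (1 - t) * 1 + t * al p' by rewrite qE hal ap.
have bE : be q = t * be p' by rewrite qE hbe bp; ring.
have t0 : 0 < t.
  by case/andP: t01 => t0 _; rewrite lt_neqAle t0 andbT; apply/eqP => tE; move: bq; rewrite bE -tE mul0r ltxx.
have bp' : 0 < be p' by move: bq; rewrite bE pmulr_rgt0.
have s1 : al q + be q = 1 by lra.
have s2 : al p' + be p' = 1.
  apply: (mulfI (lt0r_neq0 t0)); rewrite mulr1; move: s1; rewrite aE bE; lra.
split => // ap'; have d0 : 0 < 1 - al p' by lra.
exists (1 / (1 - al p')); first by rewrite divr_gt0 // ltr_pdivrMr //; lra.
have ax : al (lin p p' (1 / (1 - al p'))) = 0 by rewrite hal ap; field; lra.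
split => //; rewrite hbe bp (_ : be p' = 1 - al p'); last lra.
by rewrite mulr0 add0r mul1r mulVf //; lra.
Qed.

Section Corner.
Variables (s : seq pt) (v : pt).
Hypotheses (ss : simple s) (s3 : (3 < size s)%N) (vs : v \in s).
Let u := prev s v.
Let w := next s v.
Let D := dvec (u - v) (w - v).
Hypothesis D0 : D != 0.

(** Affine coordinates in which [v], [u], [w] become [(0, 0)], [(1, 0)], [(0, 1)]; [comb] is the
    inverse map. *)
Let al q : R := dvec (q - v) (w - v) / D.
Let be q : R := dvec (u - v) (q - v) / D.
Let comb (i j : R) : pt := (v.1 + i * (u.1 - v.1) + j * (w.1 - v.1), v.2 + i * (u.2 - v.2) + j * (w.2 - v.2)).

Let us : uniq s. Proof. by case: ss. Qed.
Let uvE : (u, v) \in edges s. Proof. by rewrite mem_edges //= mem_prev vs next_prev /=. Qed.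
Let vwE : (v, w) \in edges s. Proof. by rewrite mem_edges //= vs eqxx. Qed.
Let usm : u \in s. Proof. by rewrite mem_prev. Qed.
Let wsm : w \in s. Proof. by rewrite mem_next. Qed.
Let wv : w != v. Proof. exact: next_neq. Qed.
Let uv : u != v.
Proof. by apply/eqP => h; have := next_neq ss usm; rewrite next_prev // h eqxx. Qed.

Lemma al_affine : affine al. Proof. by move=> a b t; rewrite /al /dvec /lin /=; field. Qed.
Lemma be_affine : affine be. Proof. by move=> a b t; rewrite /be /dvec /lin /=; field. Qed.
Lemma comb_al q : q = comb (al q) (be q).
Proof.
rewrite [LHS]surjective_pairing /comb /al /be; congr pair.
  by move: D0; rewrite /D /dvec /= => d0; field.
by move: D0; rewrite /D /dvec /= => d0; field.
Qed.
Lemma al_comb i j : al (comb i j) = i.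
Proof. by move: D0; rewrite /al /D /comb /dvec /= => d0; field. Qed.
Lemma be_comb i j : be (comb i j) = j.
Proof. by move: D0; rewrite /be /D /comb /dvec /= => d0; field. Qed.
Lemma alu : al u = 1. Proof. by rewrite /al divff. Qed.
Lemma beu : be u = 0. Proof. by rewrite /be /dvec; move: D0; rewrite /D /dvec /= => d0; field. Qed.
Lemma bew : be w = 1. Proof. by rewrite /be divff. Qed.
Lemma alw : al w = 0. Proof. by rewrite /al /dvec; move: D0; rewrite /D /dvec /= => d0; field. Qed.
Lemma alv : al v = 0. Proof. by rewrite /al /dvec /= !subrr !mul0r subrr mul0r. Qed.
Lemma bev : be v = 0. Proof. by rewrite /be /dvec /= !subrr !mulr0 subrr mul0r. Qed.

Lemma seg_vw q : al q = 0 -> 0 <= be q <= 1 -> seg (v, w) q.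
Proof.
move=> aq bq; exists (be q); split => //; rewrite [LHS]comb_al aq /comb /lin /=; congr pair; ring.
Qed.
Lemma seg_uv q : be q = 0 -> 0 <= al q <= 1 -> seg (u, v) q.
Proof.
move=> bq aq; rewrite segC; exists (al q); split => //; rewrite [LHS]comb_al bq /comb /lin /=; congr pair; ring.
Qed.
Lemma al_vw q : seg (v, w) q -> al q = 0.
Proof. by move=> [t [_ ->]]; rewrite al_affine /= alv alw; ring. Qed.
Lemma be_uv q : seg (u, v) q -> be q = 0.
Proof. by move=> [t [_ ->]]; rewrite be_affine /= bev beu; ring. Qed.

Lemma next_w_neq : next s w != u.
Proof.
apply/eqP => nw; have nu : next s u = v by rewrite next_prev.
have [i l sE] := rot_to usm.
move: nu; rewrite -(next_rot i) // sE; have us' : uniq (u :: l) by rewrite -sE rot_uniq.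
have : next (rot i s) v = w by rewrite next_rot.
have : next (rot i s) w = u by rewrite next_rot.
have : (3 < size (u :: l))%N by rewrite -sE size_rot.
rewrite sE; case: l us' {sE} => [|a [|b [|c l]]] //= /and5P[]; rewrite !inE !negb_or.
move=> /and4P[ua ub uc _] /and3P[ab ac _] /andP[bc _] _ _ _.
rewrite eqxx => + + av; rewrite -av (eq_sym a u) (negbTE ua) eqxx => + wb.
by rewrite -wb (eq_sym b u) (negbTE ub) (eq_sym b a) (negbTE ab) eqxx => h; rewrite h eqxx in uc.
Qed.

(** Follow the edge from [q] to an end [p] where the level [al + be] is not larger. It cannot pass
    through the sides [(u, v)] and [(v, w)], and it does not end in [v]. If [p] is [u] or [w], the
    edge lies on level 1 and its other end serves as [z]. *)
Lemma corner_obstacle e q : e \in edges s -> seg e q -> 0 < al q -> 0 < be q -> al q + be q <= 1 ->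
  exists z, [/\ z \in s, z \notin [:: u; v; w], 0 <= al z, 0 <= be z & al z + be z <= al q + be q].
Proof.
move=> eE [t0 [t01 qE0]] aq bq abq.
have [p [p' [t [eP t01' qE abp]]]] : exists p p' t, [/\ e = (p, p') \/ e = (p', p), 0 <= t <= 1, q = lin p p' t & al p + be p <= al q + be q].
  have [h|h] := lerP (al e.1 + be e.1) (al q + be q).
    by exists e.1, e.2, t0; split => //; left; rewrite -surjective_pairing.
  exists e.2, e.1, (1 - t0); split.
  - by right; rewrite -surjective_pairing.
  - by clear_pairs; lra.
  - by rewrite qE0 linC.
  - move: h; rewrite {1 2 3 4}qE0 al_affine be_affine.
    move: (al e.1) (be e.1) (al e.2) (be e.2) t01 => a1 b1 a2 b2 t01.
    move=> h; have [l|l] := lerP (a2 + b2) (a1 + b1).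
      have : 0 <= (1 - t0) * (a1 + b1 - (a2 + b2)) by apply: mulr_ge0; clear_pairs; lra.
      by clear_pairs; lra.
    have : 0 <= t0 * (a2 + b2 - (a1 + b1)) by apply: mulr_ge0; clear_pairs; lra.
    by clear_pairs; lra.
have [ps p's] : p \in s /\ p' \in s.
  by case: eP eE => -> /mem_edges_both[].
have qe : seg e q by exists t0.
have free r : 0 < r < 1 -> oseg e (lin p p' r).
  by move=> r01; case: eP => ->; [exists r|exists (1 - r); split; [lra|rewrite linC]].
have nvw : e <> (v, w) by move=> eE'; move: qe aq; rewrite eE' => /al_vw ->; rewrite ltxx.
have nuv : e <> (u, v) by move=> eE'; move: qe bq; rewrite eE' => /be_uv ->; rewrite ltxx.
have F1 r : 0 < r < 1 -> ~ (al (lin p p' r) = 0 /\ 0 <= be (lin p p' r) <= 1).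
  move=> r01 [a0 b01]; apply: nvw.
  exact: simple_oseg ss eE vwE (free _ r01) (seg_vw a0 b01).
have F2 r : 0 < r < 1 -> ~ (be (lin p p' r) = 0 /\ 0 <= al (lin p p' r) <= 1).
  move=> r01 [b0 a01]; apply: nuv.
  exact: simple_oseg ss eE uvE (free _ r01) (seg_uv b0 a01).
have e12 : e.2 = next s e.1 by move: eE; rewrite mem_edges // => /andP[_ /eqP].
have nv x : e = (x, v) \/ e = (v, x) -> False.
  case=> h; rewrite h /= in e12.
    by apply: nuv; rewrite h /u e12 prev_next.
  by apply: nvw; rewrite h /w e12.
have nvp : p != v /\ p' != v.
  split; apply/eqP => h; rewrite h in eP; case: eP => h'.
  - by apply: (nv p'); right.
  - by apply: (nv p'); left.
  - by apply: (nv p); left.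
  - by apply: (nv p); right.
have nuw x y : (x = u /\ y = w) \/ (x = w /\ y = u) -> e <> (x, y).
  case=> -[-> ->] h; rewrite h /= in e12.
    by move: wv; rewrite e12 /u next_prev // eqxx.
  by have := next_w_neq; rewrite -e12 eqxx.
have [pin|] := boolP ((0 <= al p) && (0 <= be p)).
  case/andP: pin => ap bp.
  have [pu|pu] := eqVneq p u.
    have apu : al p = 1 by rewrite pu alu.
    have bpu : be p = 0 by rewrite pu beu.
    have [b' s' sq h] := leave_corner al_affine be_affine t01' qE aq bq abq apu bpu abp.
    have [ap'|ap'] := ltrP (al p') 0.
      have [r r01 [a0 b1]] := h ap'; exfalso; apply: (F1 r r01).
      by rewrite a0 b1 lexx ler01.
    exists p'; split => //; [|exact: ltW|by rewrite s' sq].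
    rewrite !inE !negb_or nvp.2 /=; apply/andP; split.
      by apply/eqP => h'; move: b'; rewrite h' beu ltxx.
    by apply/eqP => h'; case: eP; apply: nuw; [left|right].
  have [pw|pw] := eqVneq p w.
    have apw : al p = 0 by rewrite pw alw.
    have bpw : be p = 1 by rewrite pw bew.
    have abq' : be q + al q <= 1 by rewrite addrC.
    have abp' : be p + al p <= be q + al q by rewrite addrC [leRHS]addrC.
    have [a' s' sq h] := leave_corner be_affine al_affine t01' qE bq aq abq' bpw apw abp'.
    have [bp'|bp'] := ltrP (be p') 0.
      have [r r01 [a0 b1]] := h bp'; exfalso; apply: (F2 r r01).
      by rewrite a0 b1 lexx ler01.
    exists p'; split => //; [|exact: ltW|by rewrite addrC s' addrC sq].
    rewrite !inE !negb_or nvp.2 /=; apply/andP; split.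
      by apply/eqP => h'; case: eP; apply: nuw; [right|left].
    by apply/eqP => h'; move: a'; rewrite h' alw ltxx.
  by exists p; split => //; rewrite !inE !negb_or pu pw nvp.1.
rewrite negb_and -!ltNge => pout; exfalso.
(* The sign of this determinant tells whether the segment would leave through the side [al = 0] or
   through the side [be = 0]. *)
have [c1|c1] := boolP ((al p < 0) && (0 <= al q * be p - al p * be q)).
  case/andP: c1 => ap ex.
  exact: (exit_side al_affine be_affine F1 t01' qE aq bq abq abp ap ex).
have bp : be p < 0.
  rewrite ltNge; apply/negP => bp; move: pout c1; rewrite [be p < 0]ltNge bp orbF => ap.
  by rewrite ap /= subr_ge0 (le_trans _ (mulr_ge0 (ltW aq) bp)) // ltW // nmulr_rlt0.
have ex : 0 <= be q * al p - be p * al q.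
  move: c1; rewrite negb_and -leNgt -ltNge => /orP[ap|h].
    by rewrite subr_ge0 (le_trans _ (mulr_ge0 (ltW bq) ap)) // ltW // nmulr_rlt0.
  by rewrite (mulrC (be q)) (mulrC (be p)) -opprB oppr_ge0 ltW.
apply: (exit_side be_affine al_affine F2 t01' qE bq aq _ _ bp ex).
  by rewrite addrC.
by rewrite addrC [leRHS]addrC.
Qed.

Hypotheses (vmin : forall x, x \in s -> v.1 <= x.1) (m1 : 0 < (u.1 - v.1) + (w.1 - v.1)).
Variable k : int.
Hypothesis hk : sided s k.

Lemma edges_at_vertex f : f \in edges s -> seg f v -> f = (u, v) \/ f = (v, w).
Proof.
move=> fE /hsegP[hf|fv].
  by right; case: ss => _ _ h; exact: h fE vwE hf (hseg_l (v, w)).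
left; have := fE; rewrite mem_edges // => /andP[_ /eqP f2].
by rewrite [f]surjective_pairing -fv /u fv f2 prev_next.
Qed.

(** The crossing numbers on the two sides of the edge [(v, w)] differ by 1. The one outside the
    corner is 0, because [v] is a leftmost vertex, so the one inside the corner is not. *)
Lemma vertex_windp (mu : R) : 0 < mu ->
  exists i j, [/\ 0 < i, 0 < j, i + j < mu & windp (edges s) (comb i j) <> 0].
Proof.
move=> mu0.
have [c' c'0 hc'] : exists2 c', 0 < c' & forall q f, cube v c' q -> f \in edges s ->
    f <> (u, v) -> f <> (v, w) -> ~ seg f q.
  have [|c0 c00 h] := @seq_small _ _ (edges s) (fun f c => f <> (u, v) -> f <> (v, w) -> forall q, cube v c q -> ~ seg f q); last first.
    by exists (c0 / 2) => [|q f vq fE f1 f2]; [lra|apply: (h (c0 / 2)) => //; lra].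
  move=> f fE; have [fv|fv] := pselect (seg f v).
    by exists 1 => // c _ f1 f2; case: (edges_at_vertex fE fv).
  have [c c0 hc] := seg_avoid fv; exists c => // d /andP[_ dc] _ _ q pq.
  by apply: hc; apply: cube_le pq; exact: ltW.
pose K : R := `|u.1 - v.1| + `|u.2 - v.2| + `|w.1 - v.1| + `|w.2 - v.2| + 1.
have [n1 n2 n3 n4] := And4 (normr_ge0 (u.1 - v.1)) (normr_ge0 (u.2 - v.2)) (normr_ge0 (w.1 - v.1)) (normr_ge0 (w.2 - v.2)).
have K0 : 0 < K by rewrite /K; clear_pairs; lra.
have bnd (i j d a b c : R) : `|i| <= d -> `|j| <= d -> d * K < c -> `|a| + `|b| <= K -> `|i * a + j * b| < c.
  move=> hi hj dc ab; have d0 : 0 <= d := le_trans (normr_ge0 i) hi.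
  rewrite (le_lt_trans _ dc) // (le_trans (ler_normD _ _)) // !normrM.
  rewrite (le_trans _ (ler_wpM2l d0 ab)) // mulrDr lerD // ler_wpM2r //.
have combE i j i' j' : (comb i j).1 - (comb i' j').1 = (i - i') * (u.1 - v.1) + (j - j') * (w.1 - v.1) /\
    (comb i j).2 - (comb i' j').2 = (i - i') * (u.2 - v.2) + (j - j') * (w.2 - v.2).
  by rewrite /comb /=; split; ring.
have cubeC i j i' j' (d c : R) : `|i - i'| <= d -> `|j - j'| <= d -> d * K < c -> cube (comb i' j') c (comb i j).
  move=> hi hj dc; have [e1 e2] := combE i j i' j'.
  by split; rewrite ?e1 ?e2; apply: bnd dc _ => //; rewrite /K; clear_pairs; lra.
have v00 : comb 0 0 = v by rewrite /comb !mul0r !addr0 -surjective_pairing.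
pose M : R := Num.min (Num.min mu 1) (c' / K); pose t := M / 2.
have M0 : 0 < M by rewrite /M !lt_min mu0 ltr01 divr_gt0.
have [Mmu M1 Mc] : [/\ M <= mu, M <= 1 & M <= c' / K] by rewrite /M; split; rewrite !ge_min lexx ?orbT.
have t01 : 0 < t < 1 by rewrite /t; lra.
have tmu : t + t <= mu by rewrite /t; lra.
have tc : t * K < c' by rewrite -ltr_pdivlMr // /t; lra.
have [c c0 hc] := hk vwE t01; rewrite /= in hc.
have yE : lin v w t = comb 0 t by rewrite /lin /comb; congr pair; ring.
rewrite yE in hc.
pose eps := Num.min t (c / K) / 2.
have cK : 0 < c / K by rewrite divr_gt0.
have m0 : 0 < Num.min t (c / K) by rewrite lt_min cK andbT; lra.
have [mt mc] : Num.min t (c / K) <= t /\ Num.min t (c / K) <= c / K by split; rewrite ge_min lexx ?orbT.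
have e0 : 0 < eps by rewrite /eps; lra.
have et : eps < t by rewrite /eps; lra.
have ec : eps * K < c by rewrite -ltr_pdivlMr // /eps; lra.
have q0c : cube (comb 0 t) c (comb eps t).
  by apply: cubeC ec; rewrite ?subr0 ?subrr ?normr0 ?gtr0_norm // ltW.
have q1c : cube (comb 0 t) c (comb (- eps) t).
  by apply: cubeC ec; rewrite ?subr0 ?subrr ?normr0 ?normrN ?gtr0_norm // ltW.
have oE i j : orient v w (comb i j) = - i * D by rewrite /orient /comb /D /dvec /=; ring.
have w1 : windp (edges s) (comb (- eps) t) = 0.
  (* On the line [al = - eps] the point slides past the vertex, clear of both edges at [v], to a
     place left of the whole polygon. *)
  rewrite (@windp_free _ s _ (comb (- eps) (- eps))).
    rewrite /windp big_seq big1 // => e /mem_edges_both[/vmin h1 /vmin h2].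
    have lt1 : (comb (- eps) (- eps)).1 < v.1.
      rewrite /comb /= -addrA -mulrDr gtrDl.
      by rewrite mulNr oppr_lt0 mulr_gt0.
    by rewrite /crossp !(lt_geF (lt_le_trans lt1 _)).
  move=> r [l [l01 rE]] [f fE fr].
  have {}rE : r = comb (- eps) ((1 - l) * t + l * - eps).
    by rewrite rE /lin /comb /=; congr pair; ring.
  have ar : al r = - eps by rewrite rE al_comb.
  have [fu|fu] := pselect (f = (u, v)).
    move: fr; rewrite fu => -[l' [l'01 rE']]; move: ar; rewrite rE' al_affine /= alu alv; lra.
  have [fw|fw] := pselect (f = (v, w)).
    by move: fr; rewrite fw => /al_vw; rewrite ar; lra.
  apply: (hc' r f) => //; rewrite rE -v00; apply: cubeC tc.
    by rewrite subr0 normrN gtr0_norm // ltW.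
  by rewrite subr0 ler_norml; apply/andP; split; clear_pairs; nra.
exists eps, t; split => //; [by case/andP: t01|lra|].
move: (D0); rewrite neq_lt => /orP[Dn|Dp].
  have [h1 _] := hc _ q0c; have [_ h2] := hc _ q1c.
  have [_ wq] : ~ bd (edges s) (comb eps t) /\ windp (edges s) (comb eps t) = k.
    by apply: h1; rewrite oE nmulr_lgt0 // oppr_lt0.
  have [_ wq'] : ~ bd (edges s) (comb (- eps) t) /\ windp (edges s) (comb (- eps) t) = k - 1.
    by apply: h2; rewrite oE opprK nmulr_llt0.
  by rewrite wq; move: wq'; rewrite w1; clear; lia.
have [_ h1] := hc _ q0c; have [h2 _] := hc _ q1c.
have [_ wq] : ~ bd (edges s) (comb eps t) /\ windp (edges s) (comb eps t) = k - 1.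
  by apply: h1; rewrite oE mulNr oppr_lt0 mulr_gt0.
have [_ wq'] : ~ bd (edges s) (comb (- eps) t) /\ windp (edges s) (comb (- eps) t) = k.
  by apply: h2; rewrite oE opprK mulr_gt0.
by rewrite wq; move: wq'; rewrite w1; clear; lia.
Qed.

(** If the corner triangle contains no further vertex, its third side is a diagonal. Otherwise [v]
    is joined to a vertex in it of least level [al + be], below which no edge can pass. A path
    inside the free region to a point near [v] shows that the diagonal is interior. *)
Lemma diagonal_at : exists x y, [/\ x \in s, y \in s, y != x, next s x != y & next s y != x] /\
  forall q, oseg (x, y) q -> ~ bd (edges s) q /\ windp (edges s) q <> 0.
Proof.
pose Z := [seq z <- s | [&& z \notin [:: u; v; w], 0 <= al z, 0 <= be z & al z + be z <= 1]].
have conv (P Q : R) (l : R) : 0 <= l <= 1 -> 0 < P -> 0 < Q -> 0 < (1 - l) * P + l * Q.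
  by move=> l01 P0 Q0; nra.
have [Z0|Z0] := eqVneq Z [::].
  have free q : 0 < al q -> 0 < be q -> al q + be q <= 1 -> ~ bd (edges s) q.
    move=> aq bq abq [e eE eq]; have [z [zs zn az bz abz]] := corner_obstacle eE eq aq bq abq.
    have : z \in Z by rewrite mem_filter zn az bz zs (le_trans abz).
    by rewrite Z0.
  exists u, w; split.
    split => //; [|by rewrite /u next_prev // eq_sym|exact: next_w_neq].
    by apply/eqP => h; have := alu; rewrite -h alw; move/eqP; rewrite eq_sym oner_eq0.
  move=> q [r [r01 qE]].
  have aq : al q = 1 - r by rewrite qE al_affine /= alu alw; ring.
  have bq : be q = r by rewrite qE be_affine /= beu bew; ring.
  split; first by apply: free; rewrite ?aq ?bq; lra.
  have [i [j [i0 j0 ij w0]]] := vertex_windp ltr01.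
  rewrite (@windp_free _ s q (comb i j)) // => p [l [l01 pE]]; apply: free.
  - by rewrite pE al_affine /= al_comb aq; apply: conv => //; lra.
  - by rewrite pE be_affine /= be_comb bq; apply: conv => //; lra.
  - rewrite pE al_affine be_affine /= al_comb be_comb aq bq; clear_pairs; nra.
have [||z zZ zmin] := seq_argmin Z0 (r := fun x y => al x + be x <= al y + be y).
- by move=> x y; exact: le_total.
- by move=> y x z; exact: le_trans.
move: zZ; rewrite mem_filter => /andP[/and4P[zn az bz abz] zs].
move: zn; rewrite !inE !negb_or => /and3P[zu zv zw].
have hz : hseg (z, next s z) z := hseg_l (z, next s z).
have zE : (z, next s z) \in edges s by rewrite mem_edges //= zs eqxx.
have az0 : 0 < al z.
  rewrite lt_neqAle az andbT; apply/eqP => a0.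
  have : seg (v, w) z by apply: seg_vw; [by []|apply/andP; split; rewrite // (le_trans _ abz) // -a0 add0r].
  move=> /hsegP[hv|/= h]; last by rewrite h eqxx in zw.
  case: ss => _ _ h; have [h1 _] := h _ _ _ zE vwE hz hv.
  by rewrite h1 eqxx in zv.
have bz0 : 0 < be z.
  rewrite lt_neqAle bz andbT; apply/eqP => b0.
  have : seg (u, v) z by apply: seg_uv; [by []|apply/andP; split; rewrite // (le_trans _ abz) // -b0 addr0].
  move=> /hsegP[hv|/= h]; last by rewrite h eqxx in zv.
  case: ss => _ _ h; have [h1 _] := h _ _ _ zE uvE hz hv.
  by rewrite h1 eqxx in zu.
have free q : 0 < al q -> 0 < be q -> al q + be q < al z + be z -> ~ bd (edges s) q.
  move=> aq bq abq [e eE eq].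
  have abq1 : al q + be q <= 1 by rewrite ltW // (lt_le_trans abq).
  have [z' [z's zn' az' bz' abz']] := corner_obstacle eE eq aq bq abq1.
  have : z' \in Z by rewrite mem_filter zn' az' bz' z's (le_trans abz').
  by move=> /zmin; rewrite leNgt (le_lt_trans abz').
exists v, z; split.
  split => //; first by rewrite eq_sym.
  by apply/eqP => h; move: zu; rewrite /u -h prev_next // eqxx.
move=> q [r [r01 qE]].
have aq : al q = r * al z by rewrite qE al_affine /= alv; ring.
have bq : be q = r * be z by rewrite qE be_affine /= bev; ring.
have q1 : 0 < al q by rewrite aq mulr_gt0 //; case/andP: r01.
have q2 : 0 < be q by rewrite bq mulr_gt0 //; case/andP: r01.
have q3 : al q + be q < al z + be z.
  rewrite aq bq -mulrDr gtr_pMl ?addr_gt0 //; by case/andP: r01.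
split; first exact: free.
have [i [j [i0 j0 ij w0]]] := vertex_windp (addr_gt0 az0 bz0).
rewrite (@windp_free _ s q (comb i j)) // => p [l [l01 pE]]; apply: free.
- by rewrite pE al_affine /= al_comb; exact: conv.
- by rewrite pE be_affine /= be_comb; exact: conv.
- rewrite pE al_affine be_affine /= al_comb be_comb.
  have := conv_lt l01 q3 ij; lra.
Qed.

End Corner.

Lemma exists_diagonal s k : simple s -> (3 < size s)%N -> sided s k ->
  exists i x s1 y s2, [/\ rot i s = x :: s1 ++ y :: s2, s1 != [::], s2 != [::] &
    forall q, oseg (x, y) q -> ~ bd (edges s) q /\ windp (edges s) q <> 0].
Proof.
move=> ss s3 hk; have [s2 us _] := ss.
have s0 : s != [::] by case: (s) s2.
(* The abscissa alone would not do: the corner at a leftmost vertex may be straight, with both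
   neighbours on the same vertical line. *)
pose lexle (a b : pt) := (a.1 < b.1) || ((a.1 == b.1) && (a.2 <= b.2)).
have [||v vs vmin] := seq_argmin s0 (r := lexle).
- move=> x y; rewrite /lexle; have [h|h|h] //= := ltrgtP x.1 y.1; exact: le_total.
- move=> y x z; rewrite /lexle => /orP[h1|/andP[/eqP h1 h1']] /orP[h2|/andP[/eqP h2 h2']].
  + by rewrite (lt_trans h1 h2).
  + by rewrite -h2 h1.
  + by rewrite h1 h2.
  + by rewrite h1 h2 eqxx (le_trans h1' h2') orbT.
set u := prev s v; set w := next s v.
have usm : u \in s by rewrite mem_prev.
have wsm : w \in s by rewrite mem_next.
have uvE : (u, v) \in edges s by rewrite mem_edges //= mem_prev vs next_prev /=.
have vwE : (v, w) \in edges s by rewrite mem_edges //= vs eqxx.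
have wv : w != v := next_neq ss vs.
have uv : u != v.
  by apply/eqP => h; have := next_neq ss usm; rewrite next_prev // h eqxx.
have [m [hm1 hm2]] := corner_vector ss uvE vwE.
have strict x : x \in s -> x != v -> v.1 < x.1 \/ (v.1 = x.1 /\ v.2 < x.2).
  move=> xs xv; have := vmin x xs; rewrite /lexle => /orP[|/andP[/eqP h1 h2]]; first by left.
  right; split => //; rewrite lt_neqAle h2 andbT; apply: contraNneq xv => h.
  by rewrite [x]surjective_pairing -h1 -h -surjective_pairing.
have hu := strict u usm uv; have hw := strict w wsm wv.
(* Both neighbours are lexicographically larger than [v], so parallel edges at [v] would fold back,
   against the corner vector [m]. *)
have D0 : dvec (u - v) (w - v) != 0.
  apply/eqP; move: hm1 hm2 hu hw; rewrite /dvec /=.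
  move: u.1 u.2 w.1 w.2 v.1 v.2 m.1 m.2 => u1 u2 w1 w2 v1 v2 a b + + hu hw.
  set p := u1 - v1; set p' := u2 - v2; set q := w1 - v1; set q' := w2 - v2.
  have -> : (v2 - u2) * a - (v1 - u1) * b = - (p' * a - p * b) by rewrite /p /p'; ring.
  have {}hu : 0 < p \/ (p = 0 /\ 0 < p') by case: hu => [h|[h h']]; [left; rewrite /p|right; rewrite /p /p'; split]; lra.
  have {}hw : 0 < q \/ (q = 0 /\ 0 < q') by case: hw => [h|[h h']]; [left; rewrite /q|right; rewrite /q /q'; split]; lra.
  move=> h1 h2 h; clear -h1 h2 h hu hw.
  case: hu => [hp|[hp hp']]; case: hw => [hq|[hq hq']].
  - have : q * (p' * a - p * b) = p * (q' * a - q * b).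
      by have := congr1 (fun r : R => a * r) h; rewrite /=; lra.
    have n1 : q * (p' * a - p * b) < 0 by rewrite pmulr_rlt0 // -oppr_gt0.
    by move=> e; move: n1; rewrite e pmulr_rlt0 // ltNge (ltW h2).
  - by nra.
  - by rewrite hp in h; nra.
  - by rewrite hp hq in h1 h2; nra.
have vmin1 x : x \in s -> v.1 <= x.1.
  by move=> /vmin; rewrite /lexle => /orP[/ltW//|/andP[/eqP-> _]].
have m1 : 0 < (u.1 - v.1) + (w.1 - v.1).
  have h1 := vmin1 _ usm; have h2 := vmin1 _ wsm.
  case: hu => [h|[h _]]; first lra.
  case: hw => [h'|[h' _]]; first lra.
  by move: D0; rewrite /dvec /= -h -h' !subrr mulr0 mul0r subrr eqxx.
have [x [y [[xs ys yx nx ny] hq]]] := diagonal_at ss s3 vs D0 vmin1 m1 hk.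
have [i l sE] := rot_to xs.
have yl : y \in l by move: ys; rewrite -(mem_rot i) sE inE (negbTE yx).
case/splitPr: yl sE => s1 s2' sE.
have us' : uniq (x :: s1 ++ y :: s2') by rewrite -sE rot_uniq.
exists i, x, s1, y, s2'; split => //.
  apply: contraNneq nx => s10; rewrite -(next_rot i) // sE s10 /=.
  by rewrite eqxx.
apply: contraNneq ny => s20; rewrite -(next_rot i) // sE s20 next_nth inE mem_cat mem_seq1 eqxx !orbT.
rewrite /= eq_sym in yx; rewrite /= (negbTE yx) index_cat; move: us'; rewrite s20 /= cat_uniq /= orbF => /and3P[_ _ /andP[/negbTE -> _]].
by rewrite /= eqxx addn0 nth_default // size_cat /= addn1.
Qed.

End Diagonal.

(** * Triangulations and fillings *)

Section Triangulation.
Variable R : realType.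
Local Notation pt := (R * R)%type.
Local Notation tri := (pt * pt * pt)%type.
Implicit Types (x y z q p a b m v u : pt) (e f : pt * pt) (c t : R) (s : seq pt) (E : seq (pt * pt)) (T : tri) (tau : seq tri).

Definition antisym (X : Type) (V : zmodType) (f : X * X -> V) := forall a b : X, f (b, a) = - f (a, b).

(* The boundary of the 2-chain [tau] is the 1-chain [E]. *)
Definition fills tau E := forall (V : numDomainType) (f : pt * pt -> V), antisym f ->
  \sum_(T <- tau) \sum_(e <- tedges T) f e = \sum_(e <- E) f e.

Fixpoint chain x (l : seq pt) : seq (pt * pt) := if l is y :: l' then (x, y) :: chain y l' else [::].

Lemma edges_chain x l : edges (x :: l) = chain x (rcons l x).
Proof.
rewrite /edges rot1_cons.
suff H y a : zip (y :: l) (rcons l a) = chain y (rcons l a) by exact: H.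
by elim: l y => //= b l IH y; rewrite IH.
Qed.

Lemma chain_cat x l1 y l2 : chain x (l1 ++ y :: l2) = chain x (rcons l1 y) ++ chain y l2.
Proof. by elim: l1 x => //= b l1 IH x; rewrite IH. Qed.

Lemma edges_split x s1 y s2 : edges (x :: s1 ++ y :: s2) = chain x (rcons s1 y) ++ chain y (rcons s2 x).
Proof. by rewrite edges_chain rcons_cat rcons_cons chain_cat. Qed.

Lemma edges_closed x s1 y : edges (x :: rcons s1 y) = rcons (chain x (rcons s1 y)) (y, x).
Proof. by rewrite edges_chain -cats1 cat_rcons chain_cat /= cats1. Qed.

Lemma simple_part s x s1 y s2 : simple s -> s = x :: s1 ++ y :: s2 -> s1 != [::] ->
  (forall q, oseg (x, y) q -> ~ bd (edges s) q) -> simple (x :: rcons s1 y).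
Proof.
move=> [s2' us h] sE s10 free.
have us1 : uniq (x :: rcons s1 y).
  apply: subseq_uniq us; rewrite sE /= eqxx -cats1; apply: cat_subseq => //.
  by rewrite sub1seq mem_head.
split => //; first by case: (s1) s10 => //= a l _; rewrite size_rcons.
have AE e : e \in chain x (rcons s1 y) -> e \in edges s by rewrite sE edges_split mem_cat => ->.
have ye f : f \in chain x (rcons s1 y) -> hseg f y -> False.
  move=> fA fy; have fE := AE _ fA.
  have [e eB e1] : exists2 e, e \in chain y (rcons s2 x) & e.1 = y.
    by case: (s2) => [|b l]; [exists (y, x)|exists (y, b)] => //=; rewrite mem_head.
  have eE : e \in edges s by rewrite sE edges_split mem_cat eB orbT.
  have ef : e = f by apply: (h _ _ y) => //; rewrite -e1; exact: hseg_l.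
  have : uniq (edges s) by rewrite edges_next // map_inj_uniq // => u v [].
  rewrite sE edges_split cat_uniq => /and3P[_ /hasPn/(_ e eB) /negP + _]; apply.
  by rewrite ef.
have dg f q : f \in chain x (rcons s1 y) -> hseg f q -> hseg (y, x) q -> False.
  move=> fA fq [t [t01 qE]]; have [t0|t0] := eqVneq t 0.
    by apply: (ye f fA); move: qE; rewrite t0 lin0 => qE; rewrite -[y]qE.
  apply: (free q); last by exists f; [exact: AE|exact: hseg_seg].
  exists (1 - t); split; last by rewrite qE linC.
  by case/andP: t01 => t0' t1; move: t0; rewrite neq_lt => /orP[]; clear_pairs; lra.
move=> e f q; rewrite edges_closed !mem_rcons !inE => /orP[/eqP->|eA] /orP[/eqP->|fA] eq fq //.
- by exfalso; exact: dg fA fq eq.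
- by exfalso; exact: dg eA eq fq.
- by apply: (h _ _ q) => //; exact: AE.
Qed.

Lemma side_point x y t c : x != y -> 0 < c ->
  (exists2 q, cube (lin x y t) c q & 0 < orient x y q) /\ (exists2 q, cube (lin x y t) c q & orient x y q < 0).
Proof.
move=> xy c0; pose d : pt := y - x; pose K : R := `|d.1| + `|d.2| + 1.
have [n1 n2] := conj (normr_ge0 d.1) (normr_ge0 d.2).
have K0 : 0 < K by rewrite /K; lra.
pose q (eta : R) : pt := ((lin x y t).1 + eta * d.2, (lin x y t).2 - eta * d.1).
have oE eta : orient x y (q eta) = eta * (d.1 ^+ 2 + d.2 ^+ 2) by rewrite /orient /q /d /lin /=; ring.
have d0 : 0 < d.1 ^+ 2 + d.2 ^+ 2.
  rewrite lt_neqAle addr_ge0 ?sqr_ge0 // andbT eq_sym paddr_eq0 ?sqr_ge0 // !sqrf_eq0.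
  apply: contra xy => /andP[/eqP h1 /eqP h2]; move: h1 h2; rewrite /d /= => /eqP + /eqP.
  by rewrite !subr_eq0 => /eqP h1 /eqP h2; rewrite [x]surjective_pairing -h1 -h2 -surjective_pairing.
have bnd (eta i : R) : `|eta| = c / K / 2 -> `|i| <= K -> `|eta * i| < c.
  move=> eE iK; rewrite normrM eE (le_lt_trans (ler_wpM2l _ iK)) //; last first.
    by rewrite mulrAC divfK ?lt0r_neq0 //; lra.
  by rewrite divr_ge0 ?divr_ge0 // ltW.
have cq eta : `|eta| = c / K / 2 -> cube (lin x y t) c (q eta).
  move=> eE; split; rewrite /q /= addrC addKr ?normrN; apply: bnd => //; rewrite /K; lra.
have e0 : 0 < c / K / 2 by rewrite divr_gt0 // divr_gt0.
split; [exists (q (c / K / 2))|exists (q (- (c / K / 2)))].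
- by apply: cq; rewrite gtr0_norm.
- by rewrite oE mulr_gt0.
- by apply: cq; rewrite normrN gtr0_norm.
- by rewrite oE mulNr oppr_lt0 mulr_gt0.
Qed.

Lemma windp_cat E E' q : windp (E ++ E') q = windp E q + windp E' q.
Proof. by rewrite /windp big_cat. Qed.

Lemma windm_cat E E' q : windm (E ++ E') q = windm E q + windm E' q.
Proof. by rewrite /windm big_cat. Qed.

Lemma windp_split x s1 y s2 q : windp (edges (x :: s1 ++ y :: s2)) q =
  windp (edges (x :: rcons s1 y)) q + windp (edges (y :: rcons s2 x)) q.
Proof.
rewrite edges_split !edges_closed -!cats1 !windp_cat.
by rewrite /windp !big_seq1 (crosspN q y x); ring.
Qed.

Lemma wind2_split x s1 y s2 q : wind2 (edges (x :: s1 ++ y :: s2)) q =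
  wind2 (edges (x :: rcons s1 y)) q + wind2 (edges (y :: rcons s2 x)) q.
Proof.
rewrite /wind2 windp_split; rewrite edges_split !edges_closed -!cats1 !windm_cat.
by rewrite /windm !big_seq1 (crossmN q y x); ring.
Qed.

Lemma bd_split x s1 y s2 q : bd (edges (x :: s1 ++ y :: s2)) q ->
  bd (edges (x :: rcons s1 y)) q \/ bd (edges (y :: rcons s2 x)) q.
Proof.
move=> [e]; rewrite edges_split mem_cat => /orP[] h eq; [left|right];
  by exists e; rewrite ?edges_closed ?mem_rcons ?inE ?h ?orbT.
Qed.

(** Suppose the first part had value 1 at [p]. It would keep this value along the edge of the second
    part that starts at [p]. Just to the right of the middle of this edge the second part also has
    value 1, and the whole polygon would have value 2. *)
Lemma outside_part x s1 y s2 : let s := x :: s1 ++ y :: s2 in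
  simple s -> s2 != [::] -> simple (y :: rcons s2 x) ->
  (forall q, oseg (x, y) q -> ~ bd (edges s) q) ->
  (forall q, ~ bd (edges s) q -> windp (edges s) q <= 1) ->
  (forall q, ~ bd (edges (x :: rcons s1 y)) q ->
     windp (edges (x :: rcons s1 y)) q = 0 \/ windp (edges (x :: rcons s1 y)) q = 1) ->
  sided (y :: rcons s2 x) 1 ->
  forall p, p \in s2 -> wind2 (edges (x :: rcons s1 y)) p = 0.
Proof.
move=> s ss s20 ss2 free le1 val1 sd p ps2; have [_ us h] := ss.
pose e := (p, next (y :: rcons s2 x) p).
have pt2 : p \in y :: rcons s2 x by rewrite inE mem_rcons inE ps2 !orbT.
have [_ us2 _] := ss2.
have eE2 : e \in edges (y :: rcons s2 x) by rewrite mem_edges //= pt2 eqxx.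
have uss : uniq (x :: s1 ++ y :: s2) by [].
have [pnx pny pns1] : [/\ p != x, p != y & p \notin s1].
  move: uss; rewrite /= cat_uniq mem_cat /= negb_or inE negb_or => /and5P[/and3P[_ _ xs2] _ /norP[_ /hasPn h2] ys2 _].
  split; [apply: contraNneq xs2 => <- //|apply: contraNneq ys2 => <- //|exact: h2].
have eB : e \in chain y (rcons s2 x).
  move: eE2; rewrite edges_closed mem_rcons inE => /orP[/eqP[pE _]|//].
  by rewrite pE eqxx in pnx.
have eE : e \in edges s by rewrite /s edges_split mem_cat eB orbT.
have nxE z : z \in s -> (z, next s z) \in edges s by move=> zs; rewrite mem_edges //= zs eqxx.
have start z q : z \in s -> q = z -> hseg e q -> z = p.
  move=> zs -> hz; have [//] := h _ _ _ (nxE _ zs) eE (hseg_l (z, next s z)) hz.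
have xs : x \in s by rewrite mem_head.
have ys : y \in s by rewrite /s inE mem_cat mem_head !orbT.
have free1 q : hseg e q -> ~ bd (edges (x :: rcons s1 y)) q.
  move=> he [f]; rewrite edges_closed mem_rcons inE => /orP[/eqP->|fA].
    move=> [t [t01 qE]]; have [t0|t0] := eqVneq t 0.
      by rewrite t0 lin0 in qE; rewrite -(start y q ys qE he) eqxx in pny.
    have [t1|t1] := eqVneq t 1.
      by rewrite t1 lin1 in qE; rewrite -(start x q xs qE he) eqxx in pnx.
    apply: (free q); last by exists e => //; exact: hseg_seg.
    exists (1 - t); split; last by rewrite qE linC.
    move: t0 t1; rewrite !neq_lt => /orP[] t0 /orP[] t1; case/andP: t01 => *; clear_pairs; lra.
  have fE : f \in edges s by rewrite /s edges_split mem_cat fA.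
  move=> /hsegP[hf|qf].
    have ef := h _ _ _ eE fE he hf.
    have : uniq (edges s) by rewrite edges_next // map_inj_uniq // => u v [].
    rewrite /s edges_split cat_uniq => /and3P[_ /hasPn/(_ e eB) /negP + _]; apply.
    by rewrite ef.
  have f2 : f.2 \in s /\ f.2 \in rcons s1 y.
    have [_ f2s] := mem_edges_both fE; split=> //.
    elim: (rcons s1 y) (x) fA => //= b l IH a; rewrite inE => /orP[/eqP->|/IH fl]; rewrite inE ?eqxx //.
    by rewrite fl orbT.
  have fp := start _ _ f2.1 qf he.
  by move: f2.2; rewrite fp mem_rcons inE (negbTE pny) (negbTE pns1).
have he0 : hseg e p by exact: (hseg_l e).
have p_off := free1 _ he0.
suff w0 : windp (edges (x :: rcons s1 y)) p = 0 by rewrite /wind2 windm_off // w0.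
case: (val1 _ p_off) => // w1; exfalso.
have t12 : 0 < (1 / 2 : R) < 1 by lra.
pose y1 := lin e.1 e.2 (1 / 2).
have w1' : windp (edges (x :: rcons s1 y)) y1 = 1.
  rewrite -w1; symmetry; apply: windp_free => q [t [t01 ->]]; apply: free1.
  exists (t / 2); split; first by clear_pairs; lra.
  by rewrite /y1 /lin /=; congr pair; field.
have y1_off : ~ bd (edges (x :: rcons s1 y)) y1.
  by apply: free1; exists (1 / 2); split => //; clear_pairs; lra.
have [c c0 hc] := windp_local y1_off.
have [d d0 hd] := sd _ _ eE2 t12.
have cd0 : 0 < Num.min c d by rewrite lt_min c0.
have pn : e.1 != e.2 by rewrite eq_sym; exact: next_neq.
have [[q yq oq] _] := @side_point e.1 e.2 (1/2) _ pn cd0.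
have [q1 wq1] : ~ bd (edges (x :: rcons s1 y)) q /\ windp (edges (x :: rcons s1 y)) q = windp (edges (x :: rcons s1 y)) y1.
  by apply: hc; apply: cube_le yq; rewrite ge_min lexx.
have [q2 wq2] : ~ bd (edges (y :: rcons s2 x)) q /\ windp (edges (y :: rcons s2 x)) q = 1.
  have [|hd1 _] := hd q; last exact: hd1.
  by apply: cube_le yq; rewrite ge_min lexx orbT.
have nb : ~ bd (edges s) q by move=> /bd_split[].
by have := le1 q nb; rewrite windp_split wq1 wq2 w1'.
Qed.

(** The last clause is the bound for the contribution of the vertices. It is carried through the
    same induction because both sides add up when the polygon is cut along a diagonal. *)
Definition decomposed s (k : int) := exists tau, [/\ (size tau + 2)%N = size s,
  forall T, T \in tau -> 0 < (2 * k - 1)%:~R * torient T,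
  forall T, T \in tau -> {subset corners T <= s},
  fills tau (edges s) &
  k = 1 -> \sum_(p <- s) wind2 (edges s) p <= (size s)%:Z - 2].

Definition valued s (k : int) := forall p, ~ bd (edges s) p ->
  windp (edges s) p = 0 \/ windp (edges s) p = 2 * k - 1.

Lemma windp_rot i s q : uniq s -> windp (edges (rot i s)) q = windp (edges s) q.
Proof. by move=> us; rewrite /windp (perm_big _ (edges_rot i us)). Qed.

Lemma windm_rot i s q : uniq s -> windm (edges (rot i s)) q = windm (edges s) q.
Proof. by move=> us; rewrite /windm (perm_big _ (edges_rot i us)). Qed.

Lemma bd_rot i s : uniq s -> bd (edges (rot i s)) = bd (edges s).
Proof.
move=> us; apply/seteqP; split=> q [e eE eq]; exists e => //;
  by rewrite ?(perm_mem (edges_rot i us)) // -(perm_mem (edges_rot i us)).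
Qed.

Lemma sided_rot i s k : uniq s -> sided s k -> sided (rot i s) k.
Proof.
move=> us sd e t; rewrite (perm_mem (edges_rot i us)) => eE /(sd _ _ eE)[c c0 h].
by exists c => // q /h; rewrite bd_rot // !windp_rot.
Qed.

Lemma valued_rot i s k : uniq s -> valued s k -> valued (rot i s) k.
Proof. by move=> us h q; rewrite bd_rot // windp_rot //; exact: h. Qed.

Lemma decomposed_rot i s k : uniq s -> decomposed (rot i s) k -> decomposed s k.
Proof.
move=> us [tau [h1 h2 h3 h4 h5]]; exists tau; split => //.
- by rewrite h1 size_rot.
- by move=> T /h3 h p /h; rewrite mem_rot.
- by move=> V f af; rewrite (h4 V f af) (perm_big _ (edges_rot i us)).
- move=> /h5; rewrite size_rot (perm_big s) ?perm_rot //=.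
  by under eq_bigr do rewrite /wind2 windp_rot // windm_rot //.
Qed.

Lemma decomposed_triangle x y z k : simple [:: x; y; z] -> (k = 0 \/ k = 1) ->
  sided [:: x; y; z] k -> decomposed [:: x; y; z] k.
Proof.
set s := [:: x; y; z] => ss k01 sd; have [_ us _] := ss.
have e1 : (x, y) \in edges s by rewrite inE eqxx.
have e2 : (y, z) \in edges s by rewrite !inE eqxx orbT.
have e3 : (z, x) \in edges s by rewrite !inE eqxx !orbT.
have xy : x != y by move: us; rewrite /= !inE negb_or => /and3P[/andP[]].
have [m [m1 m2]] := corner_vector ss e1 e2.
have [m' [m1' m2']] := corner_vector ss e2 e3.
have D0 : orient x y z != 0.
  apply/eqP => D0; move: D0 m1 m2 m1' m2'; rewrite /orient /dvec /=.
  move: x.1 x.2 y.1 y.2 z.1 z.2 m.1 m.2 m'.1 m'.2 => x1 x2 y1 y2 z1 z2 a b a' b'.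
  move=> D0 h1 h2 h3 h4.
  set p := y1 - x1 in D0 h1 *; set p' := y2 - x2 in D0 h1 *.
  set q := z1 - y1 in D0 h2 h3 *; set q' := z2 - y2 in D0 h2 h3 *.
  have r1 : x1 - z1 = - (p + q) by rewrite /p /q; ring.
  have r2 : x2 - z2 = - (p' + q') by rewrite /p' /q'; ring.
  rewrite r1 r2 in h4.
  have pq : p' * q - p * q' = 0.
    have -> : q = (z1 - x1) - p by rewrite /p /q; ring.
    have -> : q' = (z2 - x2) - p' by rewrite /p' /q'; ring.
    by move: D0; lra.
  (* For parallel directions the mixed products of [dvec] agree. The left side is a product of two
     positive factors; on the right one factor is negative, because the third edge is minus the sum
     of the first two. *)
  have : (q' * a - q * b) * (- (p' + q') * a' - - (p + q) * b') =
         (q' * a' - q * b') * (- (p' + q') * a - - (p + q) * b).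
    apply/eqP; rewrite -subr_eq0; apply/eqP.
    transitivity ((p' * q - p * q') * (b * a' - a * b')); first ring.
    by rewrite pq mul0r.
  have n1 : - (p' + q') * a - - (p + q) * b < 0 by lra.
  by move=> e; have := mulr_gt0 h2 h4; rewrite e pmulr_rgt0 // ltNge (ltW n1).
have sgn : 0 < (2 * k - 1)%:~R * orient x y z.
  have [c c0 hc] := sd (x, y) (1 / 2) e1 ltac:(lra); rewrite /= in hc.
  have [[q1 yq1 oq1] [q2 yq2 oq2]] := @side_point x y (1 / 2) c xy c0.
  have [hR _] := hc _ yq1; have [_ hL] := hc _ yq2.
  have [_ {}hR] := hR oq1; have [_ {}hL] := hL oq2.
  move: D0; rewrite neq_lt => /orP[Dn|Dp].
    have Tp : 0 < torient (x, z, y).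
      by rewrite /torient /= (_ : orient x z y = - orient x y z) ?oppr_gt0 // /orient; ring.
    have wn q : windp (edges s) q = - windp (tedges (x, z, y)) q.
      by rewrite /windp !big_cons !big_nil /= (crosspN q x z) (crosspN q z y) (crosspN q y x); ring.
    case: k01 => k01; rewrite k01.
      by rewrite mulr0 sub0r mulN1r oppr_gt0.
    by move: hR; rewrite wn k01; case: (windp_tri q1 Tp) => [->|[-> _]].
  case: k01 => k01; rewrite k01; last by rewrite (_ : 2 * 1 - 1 = 1 :> int) // mul1r.
  have Tp : 0 < torient (x, y, z) by [].
  by move: hL; rewrite -tedges_edges k01; case: (windp_tri q2 Tp) => [->|[-> _]].
exists [:: (x, y, z)]; split => //.
- by move=> T; rewrite inE => /eqP->.
- by move=> T; rewrite inE => /eqP-> p.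
- by move=> V f _; rewrite big_seq1.
- move=> k1; rewrite -tedges_edges -[s]/(corners (x, y, z)) corner_sum //.
  by move: sgn; rewrite k1 (_ : 2 * 1 - 1 = 1 :> int) // mul1r.
Qed.

Theorem triangulation s k : simple s -> (k = 0 \/ k = 1) -> sided s k -> valued s k -> decomposed s k.
Proof.
have [n] := ubnP (size s); elim: n s k => // n IH s k; rewrite ltnS => sn ss k01 sd vl.
have [s2' us _] := ss.
have [s3|s3] := leqP (size s) 3.
  case: s sn ss sd vl {us} s2' s3 => [|x [|y [|z [|? ?]]]] // _ ss sd _ _ _.
  exact: decomposed_triangle.
have [i [x [s1 [y [s2 [sE s10 s20 free0]]]]]] := exists_diagonal ss s3 sd.
apply: (@decomposed_rot i) => //.
move: (simple_rot i ss) (@sided_rot i _ _ us sd) (@valued_rot i _ _ us vl).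
have szE : size (x :: s1 ++ y :: s2) = size s by rewrite -sE size_rot.
have free q : oseg (x, y) q -> ~ bd (edges (rot i s)) q /\ windp (edges (rot i s)) q <> 0.
  by move=> /free0; rewrite bd_rot // windp_rot.
move: free; rewrite sE => {ss sd vl us s2' s3 free0 sE}.
set s' := x :: s1 ++ y :: s2 => free ss sd vl; have [_ us _] := ss.
have fb q : oseg (x, y) q -> ~ bd (edges s') q by move=> /free[].
have ss1 : simple (x :: rcons s1 y) := simple_part ss erefl s10 fb.
have rE : rot (size s1).+1 s' = y :: s2 ++ x :: s1.
  exact: (rot_size_cat (x :: s1) (y :: s2)).
have ss' : simple (y :: s2 ++ x :: s1) by rewrite -rE; exact: simple_rot.
have fb' q : oseg (y, x) q -> ~ bd (edges (y :: s2 ++ x :: s1)) q.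
  move=> [t [t01 qE]]; rewrite -rE bd_rot //; apply: fb; exists (1 - t); split; last by rewrite qE linC.
  by clear_pairs; lra.
have ss2 : simple (y :: rcons s2 x) := simple_part ss' erefl s20 fb'.
have [k1 [k101 vl1 _ sd1]] := jordan ss1.
have [k2 [k201 vl2 _ sd2]] := jordan ss2.
have e1 : (y, x) \in edges (x :: rcons s1 y) by rewrite edges_closed mem_rcons mem_head.
have e2 : (x, y) \in edges (y :: rcons s2 x) by rewrite edges_closed mem_rcons mem_head.
have xy : x != y by move: us; rewrite /s' /= mem_cat inE !negb_or => /andP[/and3P[]].
have t12 : 0 < (1 / 2 : R) < 1 by lra.
(* To the right of the diagonal [(x, y)], the values [k1 - 1] and [k2] of the parts add up to
   [2 * k - 1], which is 1 or -1 and determines both. *)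
have [kk1 kk2] : k1 = k /\ k2 = k.
  have [y0b y0w] := free (lin x y (1 / 2)) (ex_intro _ (1 / 2) (conj t12 erefl)).
  have w0 : windp (edges s') (lin x y (1 / 2)) = 2 * k - 1 by case: (vl _ y0b).
  have [c c0 hc] := windp_local y0b.
  have [c1 c10 hc1] := sd1 _ _ e1 t12.
  have [c2 c20 hc2] := sd2 _ _ e2 t12.
  rewrite /= linC (_ : 1 - 1 / 2 = 1 / 2) in hc1; last by lra.
  have m0 : 0 < Num.min c (Num.min c1 c2) by rewrite !lt_min c0 c10.
  have [[q yq oq] _] := @side_point x y (1 / 2) _ xy m0.
  have [_ wq] : ~ bd (edges s') q /\ windp (edges s') q = windp (edges s') (lin x y (1 / 2)).
    by apply: hc; apply: cube_le yq; rewrite ge_min lexx.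
  have [_ w1] : ~ bd (edges (x :: rcons s1 y)) q /\ windp (edges (x :: rcons s1 y)) q = k1 - 1.
    have [|_ h] := hc1 q; last by apply: h; rewrite /= orientN oppr_lt0.
    by apply: cube_le yq; rewrite !ge_min lexx !orbT.
  have [_ w2] : ~ bd (edges (y :: rcons s2 x)) q /\ windp (edges (y :: rcons s2 x)) q = k2.
    have [|h _] := hc2 q; last exact: h.
    by apply: cube_le yq; rewrite !ge_min lexx !orbT.
  move: wq; rewrite /s' windp_split w1 w2 -/s' w0.
  by case: k01 => ->; case: k101 => ->; case: k201 => ->.
rewrite kk1 in k101 vl1 sd1; rewrite kk2 in k201 vl2 sd2.
have sz1 : (0 < size s1)%N by case: (s1) s10.
have sz2 : (0 < size s2)%N by case: (s2) s20.
have szE' : (size s = size s1 + size s2 + 2)%N by rewrite -szE /= size_cat /= addnS addn2.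
have [tau1 [a1 b1 d1 f1 g1]] : decomposed (x :: rcons s1 y) k.
  by apply: IH => //; rewrite /= size_rcons; move: sz2 szE' sn; clear; lia.
have [tau2 [a2 b2 d2 f2 g2]] : decomposed (y :: rcons s2 x) k.
  by apply: IH => //; rewrite /= size_rcons; move: sz1 szE' sn; clear; lia.
exists (tau1 ++ tau2); split.
- by rewrite szE szE' size_cat; move: a1 a2; rewrite /= !size_rcons; clear; lia.
- by move=> T; rewrite mem_cat => /orP[/b1|/b2].
- move=> T; rewrite mem_cat => /orP[/d1|/d2] h p /h;
    rewrite !inE mem_rcons !inE mem_cat inE; case: (p == x); case: (p == y); rewrite ?orbT //= => ->; by rewrite ?orbT.
- move=> V f af; rewrite big_cat /= (f1 V f af) (f2 V f af) edges_split !edges_closed -!cats1 !big_cat /= !big_seq1.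
  by rewrite (af y x); set P := \sum_(i <- chain x _) _; set Q := \sum_(i <- chain y _) _; rewrite addrACA subrr addr0.
(* A vertex that belongs to one part only contributes nothing to the other. The ends of the diagonal
   belong to both, so the sizes of the parts add up to [size s + 2] and the two bounds to
   [size s - 2]. *)
move=> k1e; move: (g1 k1e) (g2 k1e) => {}g1 {}g2; rewrite {}k1e in vl1 vl2 sd1 sd2 vl.
have le1 q : ~ bd (edges s') q -> windp (edges s') q <= 1 by move=> /vl[->|->].
have z1 := outside_part ss s20 ss2 fb le1 vl1 sd2.
have z2 p : p \in s1 -> wind2 (edges (y :: rcons s2 x)) p = 0.
  apply: outside_part => //.
  by move=> q; rewrite -rE bd_rot // windp_rot //; exact: le1.
under eq_bigr do rewrite wind2_split.
rewrite big_split /=.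
have sum1 (W : pt -> int) : \sum_(p <- s') W p = \sum_(p <- x :: rcons s1 y) W p + \sum_(p <- s2) W p.
  by rewrite /s' !big_cons -cats1 !big_cat /= !big_cons big_nil; ring.
have sum2 (W : pt -> int) : \sum_(p <- s') W p = \sum_(p <- y :: rcons s2 x) W p + \sum_(p <- s1) W p.
  by rewrite /s' !big_cons -cats1 !big_cat /= !big_cons big_nil; ring.
have {}z1 : \sum_(p <- s2) wind2 (edges (x :: rcons s1 y)) p = 0 by rewrite big_seq big1.
have {}z2 : \sum_(p <- s1) wind2 (edges (y :: rcons s2 x)) p = 0 by rewrite big_seq big1.
rewrite sum1 z1 sum2 z2 !addr0.
apply: le_trans (lerD g1 g2) _.
rewrite /s' /= size_cat /= !size_rcons; move: (size s1) (size s2); clear; lia.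
Qed.

End Triangulation.

(** * Upper bound for the size of a filling *)

Section Fillings.
Variable R : realType.
Local Notation pt := (R * R)%type.
Local Notation tri := (pt * pt * pt)%type.
Implicit Types (x y z q p a b w : pt) (e f : pt * pt) (t : R) (s : seq pt) (E : seq (pt * pt)) (T : tri) (tau : seq tri).

Definition positive tau := forall T, T \in tau -> 0 < torient T.

Lemma windp_antisym q : antisym (crossp q : pt * pt -> int).
Proof. by move=> a b; rewrite crosspN. Qed.

Lemma windm_antisym q : antisym (crossm q : pt * pt -> int).
Proof. by move=> a b; rewrite crossmN. Qed.

Lemma fills_windp tau E q : fills tau E -> windp E q = \sum_(T <- tau) windp (tedges T) q.
Proof. by move=> h; rewrite /windp -(h _ _ (windp_antisym q)). Qed.

Lemma fills_windm tau E q : fills tau E -> windm E q = \sum_(T <- tau) windm (tedges T) q.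
Proof. by move=> h; rewrite /windm -(h _ _ (windm_antisym q)). Qed.

Lemma windp_tri_ge0 T q : 0 < torient T -> 0 <= windp (tedges T) q.
Proof. by move=> T0; case: (windp_tri q T0) => [->|[-> _]]. Qed.

Lemma windm_tri_ge0 T q : 0 < torient T -> 0 <= windm (tedges T) q.
Proof. by move=> T0; case: (windm_tri q T0) => [->|[-> _]]. Qed.

Lemma corners_uniq T : 0 < torient T -> uniq (corners T).
Proof.
case: T => -[x y] z; rewrite /torient /corners /= !inE negb_or andbT => D0.
by apply/andP; split; [apply/andP; split|]; apply: contraTneq D0 => ->; rewrite /orient; apply/negP; lra.
Qed.

(* Half-plane to the right of the direction [(delta, 1)] at [p]. *)
Definition right_of p z : int := (nat_of_bool ((p.1 < z.1) || ((z.1 == p.1) && (z.2 < p.2))))%:Z.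

(** The corner runs clockwise from the direction of [y] to that of [z]. It contains [(delta, 1)]
    when it passes from the left to the right of this direction, and the opposite vector when it
    passes back. *)
Lemma corner_diff x y z : 0 < orient x y z ->
  windp (tedges (x, y, z)) x - windm (tedges (x, y, z)) x = right_of x z - right_of x y.
Proof.
move=> D0; have [-> ->] := windp_corner D0; rewrite /right_of.
move: D0; rewrite /orient; move: x.1 x.2 y.1 y.2 z.1 z.2 => x1 x2 y1 y2 z1 z2.
case: (ltrgtP y1 x1) => [h1|h1|->]; case: (ltrgtP z1 x1) => [h2|h2|->] //=; rewrite ?subrr ?mulr0 ?mul0r ?subr0 ?sub0r => D0 //.
- by rewrite ltNge (_ : x2 <= z2) // -subr_ge0; rewrite -mulNr opprB pmulr_rgt0 ?subr_gt0 // in D0; lra.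
- by rewrite (_ : z2 < x2) // -subr_lt0; rewrite -mulrN pmulr_rgt0 ?subr_gt0 // in D0; lra.
- by rewrite (_ : y2 < x2) // -subr_lt0; rewrite nmulr_lgt0 ?subr_lt0 // in D0; lra.
- by rewrite ltNge (_ : x2 <= y2) // -subr_ge0; rewrite pmulr_lgt0 ?subr_gt0 // in D0; lra.
- by rewrite ltxx in D0.
Qed.

Definition cornerp tau p : int := \sum_(T <- tau) (p \in corners T)%:Z * windp (tedges T) p.
Definition cornerm tau p : int := \sum_(T <- tau) (p \in corners T)%:Z * windm (tedges T) p.

Lemma tedges_rot x y z : perm_eq (tedges (y, z, x)) (tedges (x, y, z)).
Proof. by rewrite /tedges /= -(perm_rot 2) /=. Qed.

(** By [corner_diff] the difference is a sum over the edges at [p] of an antisymmetric function. It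
    can be evaluated on the polygon, which has no edge at [p]. *)
Lemma corner_difference tau s p : positive tau -> fills tau (edges s) -> p \notin s ->
  cornerp tau p = cornerm tau p.
Proof.
move=> pos fl ps; apply/eqP; rewrite -subr_eq0 /cornerp /cornerm -sumrB.
pose f (e : pt * pt) : int := (e.2 == p)%:Z * right_of p e.1 - (e.1 == p)%:Z * right_of p e.2.
have af : antisym f by move=> a b; rewrite /f /= opprB.
transitivity (\sum_(T <- tau) \sum_(e <- tedges T) f e == 0).
  congr (_ == 0); apply: eq_big_seq => T /pos T0; rewrite -mulrBr.
  have := corners_uniq T0; case: T T0 => -[x y] z; rewrite /torient /corners /= !inE negb_or andbT => D0.
  move=> /andP[/andP[xy xz] yz]; rewrite !big_cons big_nil /f /= addr0.
  have D1 : 0 < orient y z x by rewrite orient_rot.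
  have D2 : 0 < orient z x y by rewrite orient_rot.
  have c0 := corner_diff D0; have c1 := corner_diff D1; have c2 := corner_diff D2.
  have rm q : windm (tedges (y, z, x)) q = windm (tedges (x, y, z)) q by rewrite /windm (perm_big _ (tedges_rot x y z)).
  have rm' q : windm (tedges (z, x, y)) q = windm (tedges (x, y, z)) q by rewrite -rm /windm (perm_big _ (tedges_rot y z x)).
  have rp q : windp (tedges (z, x, y)) q = windp (tedges (x, y, z)) q by rewrite windp_tri_rot windp_tri_rot.
  rewrite windp_tri_rot rm in c1; rewrite rp rm' in c2.
  have [px|px] := eqVneq p x; [|have [py|py] := eqVneq p y; [|have [pz|pz] := eqVneq p z]].
  - by rewrite /= px (eq_sym y) (eq_sym z) (negbTE xy) (negbTE xz) c0 /=; ring.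
  - by rewrite /= py (eq_sym z) (negbTE yz) c1 /=; ring.
  - by rewrite /= pz c2 /=; ring.
  - by rewrite /=; ring.
rewrite (fl _ f af) big_seq big1 // => e /mem_edges_both[e1 e2].
have h a : a \in s -> (a == p) = false by move=> as_; apply: contraNF ps => /eqP <-.
by rewrite /f !h // !mul0r subrr.
Qed.

Lemma cornerp_bounds tau E p : positive tau -> fills tau E -> 0 <= cornerp tau p <= windp E p.
Proof.
move=> pos fl; rewrite (fills_windp p fl) /cornerp; apply/andP; split.
  by rewrite big_seq sumr_ge0 // => T /pos T0; rewrite mulr_ge0 // windp_tri_ge0.
rewrite big_seq [leRHS]big_seq ler_sum // => T /pos T0; case: (_ \in _); rewrite ?mul1r // mul0r.
exact: windp_tri_ge0.
Qed.

Lemma cornerm_bounds tau E p : positive tau -> fills tau E -> 0 <= cornerm tau p <= windm E p.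
Proof.
move=> pos fl; rewrite (fills_windm p fl) /cornerm; apply/andP; split.
  by rewrite big_seq sumr_ge0 // => T /pos T0; rewrite mulr_ge0 // windm_tri_ge0.
rewrite big_seq [leRHS]big_seq ler_sum // => T /pos T0; case: (_ \in _); rewrite ?mul1r // mul0r.
exact: windm_tri_ge0.
Qed.

Lemma negpK : involutive (@negp R).
Proof. by case=> a b; rewrite /negp /= !opprK. Qed.

Lemma bd_negp s q : bd (edges s) q -> bd (edges (map (@negp R) s)) (negp q).
Proof.
have -> : edges (map (@negp R) s) = [seq (negp e.1, negp e.2) | e <- edges s].
  rewrite /edges -map_rot; move: s (rot 1 s); elim=> [|x s1 IH] [|y s2] //=.
  by rewrite IH.
move=> [e eE [t [t01 ->]]]; exists (negp e.1, negp e.2).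
  by apply/mapP; exists e.
by exists t; split => //; rewrite /negp /lin /=; congr pair; ring.
Qed.

Lemma windm_limit s p : exists2 q, ~ bd (edges s) q & windp (edges s) q = windm (edges s) p.
Proof.
have [q qb wq] := windp_limit (map (@negp R) s) (negp p).
have nb : ~ bd (edges s) (negp q) by move=> /bd_negp; rewrite negpK.
exists (negp q) => //; rewrite -windm_off // !windm_reflect negpK.
by rewrite wq.
Qed.

Lemma filling_size_le tau s (I : seq pt) : simple s -> valued s 1 ->
  \sum_(p <- s) wind2 (edges s) p <= (size s)%:Z - 2 ->
  positive tau -> fills tau (edges s) -> uniq I ->
  (forall T p, T \in tau -> p \in corners T -> ~ bd (edges s) p -> windp (edges s) p = 1 -> p \in I) ->
  (size tau + 2 <= size s + 2 * size I)%N.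
Proof.
move=> ss vl S pos fl uI hI; have [_ us _] := ss.
pose L := undup (flatten (map (@corners R) tau)).
(* Double counting: each triangle is replaced by the sum 1 over its corners, and the sum is
   regrouped by points. *)
have sizeE : (size tau)%:Z = \sum_(p <- L) (cornerp tau p + cornerm tau p).
  transitivity (\sum_(T <- tau) (1 : int)); first by rewrite big_const_seq count_predT iter_addr_0 natz.
  transitivity (\sum_(T <- tau) \sum_(p <- L) (p \in corners T)%:Z * wind2 (tedges T) p); last first.
    rewrite exchange_big /=; apply: eq_bigr => p _; rewrite /cornerp /cornerm -big_split /=.
    by apply: eq_bigr => T _; rewrite -mulrDr.
  apply: eq_big_seq => T Ttau; rewrite -(corner_sum (pos _ Ttau)).
  rewrite [RHS](eq_bigr (fun p => if p \in corners T then wind2 (tedges T) p else 0)); last first.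
    by move=> p _; case: ifP; rewrite ?mul1r ?mul0r.
  rewrite -big_mkcond /= -[RHS]big_filter; apply: perm_big; apply: uniq_perm.
  - exact: corners_uniq (pos _ Ttau).
  - by rewrite filter_uniq // undup_uniq.
  - move=> p; rewrite mem_filter; have [pT|//] := boolP (p \in corners T).
    rewrite mem_undup; symmetry; apply/flattenP; exists (corners T) => //; exact: map_f.
have w2 p : 0 <= wind2 (edges s) p.
  have /andP[p0 p1] := cornerp_bounds p pos fl; have /andP[m0 m1] := cornerm_bounds p pos fl.
  by rewrite /wind2; lia.
have bound p : p \in L -> cornerp tau p + cornerm tau p <=
    (if p \in s then wind2 (edges s) p else 0) + (if p \in I then 2 else 0).
  rewrite mem_undup => /flattenP[_ /mapP[T Ttau ->] pT].
  have /andP[p0 p1] := cornerp_bounds p pos fl; have /andP[m0 m1] := cornerm_bounds p pos fl.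
  have [ps|ps] := boolP (p \in s).
    by apply: le_trans (lerD p1 m1) _; rewrite lerDl; case: ifP.
  rewrite add0r; have [pb|pb] := pselect (bd (edges s) p); last first.
    have := windm_off pb; case: (vl p pb) => w wm; rewrite w in p1; rewrite wm w in m1.
      by apply: le_trans (lerD p1 m1) _; case: ifP.
    by rewrite (hI T p) //; exact: (lerD p1 m1).
  (* For a point inside an edge, [windp] and [windm] differ by 1 and lie in {0, 1}; one of them is
     0, so one of the two corner counts vanishes, and by [cd] the other one too. *)
  have cd := corner_difference pos fl ps.
  have [e eE ep] := pb.
  have oe : oseg e p.
    have [e1 e2] := mem_edges_both eE.
    case: ep => t [t01 pE]; exists t; split => //.
    have t0 : t != 0 by apply: contraNneq ps => t0; rewrite pE t0 lin0.
    have t1 : t != 1 by apply: contraNneq ps => t1; rewrite pE t1 lin1.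
    by case/andP: t01 => *; rewrite !lt_neqAle t1 eq_sym t0; apply/andP.
  have [q1 /vl wq1 e1] := windp_limit s p; have [q2 /vl wq2 e2] := windm_limit s p.
  rewrite e1 in wq1; rewrite e2 in wq2.
  have := windm_windp_edge ss eE oe.
  have -> : cornerp tau p + cornerm tau p = 0 by move: wq1 wq2 cd p0 p1 m0 m1 (windm_windp_edge ss eE oe); clear; lia.
  by case: ifP.
have le1 : \sum_(p <- L) (if p \in s then wind2 (edges s) p else 0) <= \sum_(p <- s) wind2 (edges s) p.
  rewrite -big_mkcond /= -big_filter.
  rewrite (perm_big [seq p <- s | p \in L]); last first.
    apply: uniq_perm; rewrite ?filter_uniq ?undup_uniq // => p.
    by rewrite !mem_filter andbC.
  by rewrite big_filter big_mkcond ler_sum // => p _; case: ifP.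
have le2 : \sum_(p <- L) (if p \in I then 2 else 0 : int) <= (2 * size I)%:Z.
  rewrite -big_mkcond /= -big_filter big_const_seq count_predT iter_addr_0.
  have : (size [seq p <- L | p \in I] <= size I)%N.
    by apply: uniq_leq_size => [|p]; rewrite ?filter_uniq ?undup_uniq // mem_filter => /andP[].
  by rewrite -mulr_natr natz; move: (size I) (size _); clear; lia.
have : (size tau)%:Z <= (size s)%:Z - 2 + (2 * size I)%:Z.
  have leb : \sum_(p <- L) (cornerp tau p + cornerm tau p) <=
      \sum_(p <- L) ((if p \in s then wind2 (edges s) p else 0) + (if p \in I then 2 else 0)).
    by rewrite big_seq [leRHS]big_seq ler_sum.
  rewrite sizeE; apply: (le_trans leb); rewrite big_split /=.
  by apply: lerD; [exact: le_trans le1 S|exact: le2].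
by move: (size tau) (size s) (size I); clear; lia.
Qed.

End Fillings.

(** * Adding interior points to a filling *)

Section Insertion.
Variable R : realType.
Local Notation pt := (R * R)%type.
Local Notation tri := (pt * pt * pt)%type.
Implicit Types (x y z q p a b m : pt) (e f : pt * pt) (t : R) (s : seq pt) (E : seq (pt * pt)) (T : tri) (tau : seq tri).

Definition corners_in tau s := forall T, T \in tau -> {subset corners T <= s}.

(* [tau'] replaces [tau], with the same boundary, using [p] as a new corner. *)
Definition refines tau tau' p := [/\ positive tau', size tau' = (size tau + 2)%N,
  (forall (V : numDomainType) (f : pt * pt -> V), antisym f ->
    \sum_(T <- tau') \sum_(e <- tedges T) f e = \sum_(T <- tau) \sum_(e <- tedges T) f e) &
  forall s, corners_in tau s -> corners_in tau' (p :: s)].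

Lemma add_inside tau x y z p : positive tau -> (x, y, z) \in tau ->
  0 < orient x y p -> 0 < orient y z p -> 0 < orient z x p ->
  exists tau', refines tau tau' p.
Proof.
move=> pos Tt h1 h2 h3; exists [:: (x, y, p), (y, z, p), (z, x, p) & rem (x, y, z) tau].
have pm := perm_to_rem Tt.
split.
- move=> T; rewrite !inE => /or4P[/eqP->|/eqP->|/eqP->|/mem_rem/pos] //.
- by rewrite (perm_size pm) /= addn2.
- move=> V f af; rewrite (perm_big _ pm) /= !big_cons !big_nil /=.
  by rewrite (af p x) (af p y) (af p z); ring.
- move=> s hs; have hT := hs _ Tt.
  have [xs ys zs] : [/\ x \in s, y \in s & z \in s] by split; apply: hT; rewrite /corners !inE eqxx ?orbT.
  move=> T; rewrite !inE => /or4P[/eqP->|/eqP->|/eqP->|/mem_rem/hs h] q.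
  + by rewrite !inE => /or3P[]/eqP->; rewrite ?xs ?ys ?zs ?eqxx ?orbT.
  + by rewrite !inE => /or3P[]/eqP->; rewrite ?xs ?ys ?zs ?eqxx ?orbT.
  + by rewrite !inE => /or3P[]/eqP->; rewrite ?xs ?ys ?zs ?eqxx ?orbT.
  + by move=> /h qs; rewrite inE qs orbT.
Qed.

Lemma add_on_edge tau x y z z' p : positive tau -> (x, y, z) \in tau -> (y, x, z') \in tau ->
  oseg (x, y) p -> exists tau', refines tau tau' p.
Proof.
move=> pos Tt T't [t [t01 pE]].
have D0 := pos _ Tt; have D0' := pos _ T't; rewrite /torient /= in D0 D0'.
have T't' : (y, x, z') \in rem (x, y, z) tau.
  rewrite (perm_mem (perm_to_rem Tt)) inE in T't; case/orP: T't => // /eqP[xy _ _].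
  by move: D0; rewrite xy /orient !subrr !mul0r subrr ltxx.
exists [:: (x, p, z), (p, y, z), (y, p, z'), (p, x, z') & rem (y, x, z') (rem (x, y, z) tau)].
have pm := perm_to_rem Tt; have pm' := perm_to_rem T't'.
split.
- move=> T; rewrite !inE => /or4P[/eqP->|/eqP->|/eqP->|/orP[/eqP->|/mem_rem/mem_rem/pos //]]; rewrite /torient /=.
  + by rewrite (_ : orient x p z = t * orient x y z) ?mulr_gt0 //; [case/andP: t01|rewrite pE /orient /lin /=; ring].
  + by rewrite (_ : orient p y z = (1 - t) * orient x y z) ?mulr_gt0 //; [case/andP: t01; lra|rewrite pE /orient /lin /=; ring].
  + by rewrite (_ : orient y p z' = (1 - t) * orient y x z') ?mulr_gt0 //; [case/andP: t01; lra|rewrite pE /orient /lin /=; ring].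
  + by rewrite (_ : orient p x z' = t * orient y x z') ?mulr_gt0 //; [case/andP: t01|rewrite pE /orient /lin /=; ring].
- by rewrite (perm_size pm) /= (perm_size pm') /= addn2.
- move=> V f af; rewrite (perm_big _ pm) /= !big_cons (perm_big _ pm') !big_cons !big_nil /=.
  by rewrite (af p x) (af p y) (af p z) (af p z') (af x y); ring.
- move=> s hs; have hT := hs _ Tt; have hT' := hs _ T't.
  have [xs ys zs] : [/\ x \in s, y \in s & z \in s] by split; apply: hT; rewrite /corners !inE eqxx ?orbT.
  have z's : z' \in s by apply: hT'; rewrite /corners !inE eqxx ?orbT.
  move=> T; rewrite !inE => /or4P[/eqP->|/eqP->|/eqP->|/orP[/eqP->|/mem_rem/mem_rem/hs h]] q; last first.
    by move=> /h qs; rewrite inE qs orbT.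
  all: by rewrite !inE => /or3P[]/eqP->; rewrite ?xs ?ys ?zs ?z's ?eqxx ?orbT.
Qed.

(** Triangles are ordered triples, so a chosen edge is brought to the front by cyclic reordering.
    The last clause keeps the other triangles available for the next step. *)
Definition rotated tau tau' T := [/\ size tau' = size tau, (positive tau -> positive tau'),
   (forall (V : numDomainType) (f : pt * pt -> V),
    \sum_(T <- tau') \sum_(e <- tedges T) f e = \sum_(T <- tau) \sum_(e <- tedges T) f e),
   (forall s, corners_in tau s -> corners_in tau' s) &
   forall T', T' \in tau -> T' != T -> T' \in tau'].

Lemma rotate_filling tau x y z : (x, y, z) \in tau ->
  exists2 tau', (y, z, x) \in tau' & rotated tau tau' (x, y, z).
Proof.
move=> Tt; exists ((y, z, x) :: rem (x, y, z) tau); first by rewrite mem_head.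
have pm := perm_to_rem Tt; split.
- by rewrite (perm_size pm).
- move=> pos T; rewrite inE => /orP[/eqP->|/mem_rem/pos //].
  by rewrite /torient /= orient_rot; exact: (pos _ Tt).
- by move=> V f; rewrite (perm_big _ pm) /= !big_cons /= !big_nil; ring.
- move=> s hs T; rewrite inE => /orP[/eqP-> q|/mem_rem/hs //].
  by rewrite /corners !inE => h; apply: (hs _ Tt); rewrite /corners !inE; case/or3P: h => ->; rewrite ?orbT.
- by move=> T' T't T'n; move: T't; rewrite (perm_mem pm) !inE (negbTE T'n) /= => ->; rewrite orbT.
Qed.

Lemma rotate_to tau T x y : T \in tau -> (x, y) \in tedges T ->
  exists tau' z, (x, y, z) \in tau' /\ rotated tau tau' T.
Proof.
case: T => -[a b] d Tt; rewrite !inE !xpair_eqE => /or3P[]/andP[/eqP-> /eqP->].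
- by exists tau, d; split => //; split.
- by have [tau' m h] := rotate_filling Tt; exists tau', a.
have [tau1 m1 [h1 h2 h3 h4 h5]] := rotate_filling Tt.
have [tau2 m2 [k1 k2 k3 k4 k5]] := rotate_filling m1.
have pm := perm_to_rem Tt.
exists ((d, a, b) :: rem (a, b, d) tau), b; split; first by rewrite mem_head.
split.
- by rewrite (perm_size pm).
- move=> pos T; rewrite inE => /orP[/eqP->|/mem_rem/pos //].
  by rewrite /torient /= -orient_rot; exact: (pos _ Tt).
- by move=> V f; rewrite (perm_big _ pm) /= !big_cons /= !big_nil; ring.
- move=> s hs T; rewrite inE => /orP[/eqP-> q|/mem_rem/hs //].
  by rewrite /corners !inE => h; apply: (hs _ Tt); rewrite /corners !inE; case/or3P: h => ->; rewrite ?orbT.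
- by move=> T' T't T'n; move: T't; rewrite (perm_mem pm) !inE (negbTE T'n) /= => ->; rewrite orbT.
Qed.

Lemma rotated_refines tau tau1 tau' T p : rotated tau tau1 T -> refines tau1 tau' p -> refines tau tau' p.
Proof.
move=> [h1 h2 h3 h4 h5] [k1 k2 k3 k4]; split => //.
- by rewrite k2 h1.
- by move=> V f af; rewrite k3 // h3.
- by move=> s /h4; exact: k4.
Qed.

Lemma rotated_fills tau tau' T E : rotated tau tau' T -> fills tau E -> fills tau' E.
Proof. by move=> [h1 h2 h3 h4 h5] fl V f af; rewrite h3; exact: fl. Qed.

(** These test functions recover multiplicities from sums of antisymmetric functions: their sum is
    the excess of [(x, y)] over [(y, x)]. *)
Lemma dart_count (X : eqType) (x y : X) : x != y ->
  antisym (fun e : X * X => (e == (x, y))%:Z - (e == (y, x))%:Z).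
Proof.
move=> xy a b; rewrite opprB; congr (Posz (nat_of_bool _) - Posz (nat_of_bool _)).
  by rewrite !xpair_eqE andbC.
by rewrite !xpair_eqE andbC.
Qed.

Lemma le_sum_mem (X : eqType) (F : X -> int) (l : seq X) (a : X) :
  (forall b : X, b \in l -> 0 <= F b) -> a \in l -> F a <= \sum_(b <- l) F b.
Proof.
move=> F0 al; rewrite (perm_big _ (perm_to_rem al)) big_cons lerDl big_seq sumr_ge0 //.
by move=> b /mem_rem/F0.
Qed.

(** Otherwise the signed count of [(x, y)] would be positive on the triangles but 0 on the
    boundary. *)
Lemma opposite_dart tau E T x y : positive tau -> fills tau E -> T \in tau -> (x, y) \in tedges T ->
  (x, y) \notin E -> (y, x) \notin E -> exists2 T', T' \in tau & (y, x) \in tedges T'.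
Proof.
move=> pos fl Tt xyT xyE yxE; apply: contrapT => none.
have xy : x != y.
  apply/eqP => xy; move: (corners_uniq (pos _ Tt)) xyT; rewrite xy; case: T {Tt} => -[a b] d.
  rewrite /corners /tedges /= !inE !xpair_eqE negb_or andbT => /andP[/andP[ab ad] bd].
  by case/or3P => /andP[/eqP e1 /eqP e2]; move: ab ad bd; rewrite -?e1 -?e2 ?eqxx.
pose F (e : pt * pt) := (e == (x, y))%:Z - (e == (y, x))%:Z.
have F0 T' : T' \in tau -> forall e, e \in tedges T' -> 0 <= F e.
  move=> T't e eT; rewrite /F; have [ee|_] := eqVneq e (y, x); last by rewrite subr0.
  by exfalso; apply: none; exists T' => //; rewrite -ee.
have := fl _ _ (dart_count xy); rewrite -/F.
rewrite [RHS]big_seq [RHS]big1; last first.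
  move=> e eE; rewrite /F; have -> : (e == (x, y)) = false by apply: contraNF xyE => /eqP <-.
  by have -> : (e == (y, x)) = false by apply: contraNF yxE => /eqP <-.
apply/eqP; rewrite gt_eqF //; apply: (@lt_le_trans _ _ (F (x, y))).
  by rewrite /F eqxx xpair_eqE (negbTE xy).
apply: le_trans (le_sum_mem (F0 _ Tt) xyT) _.
apply: (le_sum_mem (F := fun T => \sum_(e <- tedges T) F e)) => // T' T't.
by rewrite big_seq sumr_ge0 //; exact: F0.
Qed.

Lemma orient_eq0_oseg x y z p : 0 < orient x y z -> orient x y p = 0 ->
  0 <= orient y z p -> 0 <= orient z x p -> p != x -> p != y -> oseg (x, y) p.
Proof.
move=> D0 o1 o2 o3 px py.
have sum : orient y z p + orient z x p = orient x y z by rewrite -(orient_sum x y z p) o1 add0r.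
pose t := orient z x p / orient x y z.
have tE : t * orient x y z = orient z x p by rewrite /t divfK // lt0r_neq0.
have pE : p = lin x y t.
  have e1 : orient x y z * p.1 = orient y z p * x.1 + orient z x p * y.1 + orient x y p * z.1.
    by rewrite /orient; ring.
  have e2 : orient x y z * p.2 = orient y z p * x.2 + orient z x p * y.2 + orient x y p * z.2.
    by rewrite /orient; ring.
  have o2E : orient y z p = (1 - t) * orient x y z by rewrite mulrBl tE mul1r -sum addrK.
  rewrite o1 !mul0r !addr0 o2E -tE in e1 e2.
  rewrite [p]surjective_pairing /lin; congr pair; apply: (mulfI (lt0r_neq0 D0)).
    by rewrite e1; ring.
  by rewrite e2; ring.
exists t; split => //=.
have t0 : t != 0 by apply: contraNneq px => t0; rewrite pE t0 lin0.
have t1 : t != 1 by apply: contraNneq py => t1; rewrite pE t1 lin1.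
rewrite !lt_neqAle t1 eq_sym t0 /t divr_ge0 ?(ltW D0) //= ler_pdivrMr // mul1r -sum lerDr //.
Qed.

(** Some triangle has value 1 at [p] and hence contains [p]. Either [p] is strictly inside, or it
    lies inside one edge; that edge is not part of the polygon, so a second triangle contains it
    reversed. *)
Lemma add_point tau s p : positive tau -> fills tau (edges s) -> ~ bd (edges s) p ->
  windp (edges s) p = 1 -> (forall T, T \in tau -> p \notin corners T) ->
  exists tau', refines tau tau' p.
Proof.
move=> pos fl pb w1 pc.
have [T Tt wT] : exists2 T, T \in tau & windp (tedges T) p != 0.
  apply: contrapT => none; move: w1; rewrite (fills_windp p fl) big_seq big1 // => T Tt.
  by apply/eqP; apply: contrapT => /negP wT; apply: none; exists T.
have [w0|[_ [h1 h2 h3]]] := windp_tri p (pos _ Tt); first by rewrite w0 in wT.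
move: Tt (pos _ Tt) (pc _ Tt) h1 h2 h3; case: T {wT} => -[x y] z; rewrite /torient /corners /= !inE !negb_or.
move=> Tt D0 /and3P[px py pz] h1 h2 h3.
have onedge tau1 a b d : positive tau1 -> fills tau1 (edges s) -> (a, b, d) \in tau1 -> oseg (a, b) p ->
    exists tau', refines tau1 tau' p.
  move=> pos1 fl1 Tt1 os.
  have abT : (a, b) \in tedges (a, b, d) by rewrite inE eqxx.
  have abE : (a, b) \notin edges s.
    by apply/negP => abE; apply: pb; exists (a, b) => //; exact/hseg_seg/oseg_hseg.
  have baE : (b, a) \notin edges s.
    by apply/negP => baE; apply: pb; exists (b, a) => //; rewrite segC; exact/hseg_seg/oseg_hseg.
  have [T' T't baT'] := opposite_dart pos1 fl1 Tt1 abT abE baE.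
  have [tau2 [d' [T't' rt]]] := rotate_to T't baT'.
  have [_ rp _ _ rk] := rt.
  have Tn : (a, b, d) != T'.
    apply/eqP => TE; move: baT' (corners_uniq (pos1 _ Tt1)); rewrite -TE /corners /= !inE !xpair_eqE negb_or andbT.
    move=> + /andP[/andP[/negP nab /negP nad] /negP nbd].
    by case/or3P => /andP[e1 e2]; [apply: nab; rewrite eq_sym|apply: nad|apply: nbd].
  have [tau' rf] := add_on_edge (rp pos1) (rk _ Tt1 Tn) T't' os.
  by exists tau'; exact: rotated_refines rt rf.
have [n1|n1] := eqVneq (orient x y p) 0.
  by apply: onedge Tt _ => //; exact: orient_eq0_oseg D0 n1 h2 h3 px py.
have D1 : 0 < orient y z x by rewrite orient_rot.
have D2 : 0 < orient z x y by rewrite orient_rot.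
have [n2|n2] := eqVneq (orient y z p) 0.
  have yzT : (y, z) \in tedges (x, y, z) by rewrite !inE eqxx orbT.
  have [tau1 [d [T1 rt]]] := rotate_to Tt yzT.
  have [_ rp _ _ _] := rt.
  have [tau' rf] := onedge _ _ _ _ (rp pos) (rotated_fills rt fl) T1 (orient_eq0_oseg D1 n2 h3 h1 py pz).
  by exists tau'; exact: rotated_refines rt rf.
have [n3|n3] := eqVneq (orient z x p) 0.
  have zxT : (z, x) \in tedges (x, y, z) by rewrite !inE eqxx !orbT.
  have [tau1 [d [T1 rt]]] := rotate_to Tt zxT.
  have [_ rp _ _ _] := rt.
  have [tau' rf] := onedge _ _ _ _ (rp pos) (rotated_fills rt fl) T1 (orient_eq0_oseg D2 n3 h1 h2 pz px).
  by exists tau'; exact: rotated_refines rt rf.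
by apply: add_inside Tt _ _ _ => //; rewrite lt_neqAle eq_sym ?n1 ?n2 ?n3.
Qed.

Lemma add_points tau s (P : seq pt) : positive tau -> fills tau (edges s) -> corners_in tau s ->
  uniq P -> (forall p, p \in P -> ~ bd (edges s) p /\ windp (edges s) p = 1) ->
  exists tau', [/\ positive tau', fills tau' (edges s), corners_in tau' (P ++ s) &
    size tau' = (size tau + 2 * size P)%N].
Proof.
move=> pos fl cs; elim: P => [_ _|p P IH /= /andP[pP uP] hP]; first by exists tau; rewrite muln0 addn0.
have [||tau1 [pos1 fl1 cs1 sz1]] := IH => //.
  by move=> q qP; apply: hP; rewrite inE qP orbT.
have [pb w1] := hP p (mem_head _ _).
have pc T : T \in tau1 -> p \notin corners T.
  move=> /cs1 h; apply/negP => /h; rewrite mem_cat (negbTE pP) /= => ps.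
  case: s ps pb {fl cs fl1 cs1 h hP w1 IH} => // a l ps; apply.
  have sr : size (rot 1 (a :: l)) = size (a :: l) by rewrite size_rot.
  have : p \in unzip1 (edges (a :: l)) by rewrite unzip1_zip ?sr.
  by move=> /mapP[e eE ->]; exists e => //; exact: seg_l.
have [tau' [k1 k2 k3 k4]] := add_point pos1 fl1 pb w1 pc.
exists tau'; split => //.
- by move=> V f af; rewrite k3 //; exact: fl1.
- exact: k4.
- by rewrite k2 sz1; clear; lia.
Qed.

End Insertion.

(** * Lattice triangles *)

Section Balanced.
Variable X : choiceType.
Implicit Types (d : X * X) (l : seq (X * X)) (T : X * X * X).

Definition flip d := (d.2, d.1).

(** Says without signs that the 1-chain of these darts is zero; this is the form that Wick's rule
    produces. *)
Definition balanced l := perm_eq l (map flip l).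

Lemma flipK : involutive flip. Proof. by case. Qed.

Lemma count_flip l d : count_mem d (map flip l) = count_mem (flip d) l.
Proof.
rewrite count_map; apply: eq_count => e /=.
by rewrite -(inj_eq (inv_inj flipK)) flipK.
Qed.

Lemma balancedP l : balanced l <-> forall d, count_mem d l = count_mem (flip d) l.
Proof.
rewrite /balanced; split=> [/permP h d|h]; first by rewrite -count_flip h.
by apply/allP => d _ /=; rewrite count_flip h.
Qed.

Lemma sum_balanced (V : numDomainType) (f : X * X -> V) l : balanced l -> antisym f ->
  \sum_(d <- l) f d = 0.
Proof.
move=> bal af; have : \sum_(d <- l) f d = - \sum_(d <- l) f d.
  rewrite {1}(perm_big _ bal) big_map -sumrN; apply: eq_bigr => -[a b] _; exact: af.
by move/eqP; rewrite -addr_eq0 -mulr2n mulrn_eq0 /= => /eqP.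
Qed.

Lemma sum_dart_count l d :
  \sum_(e <- l) ((e == d)%:Z - (e == flip d)%:Z) = (count_mem d l)%:Z - (count_mem (flip d) l)%:Z.
Proof. by elim: l => [|e l IH]; rewrite ?big_nil // big_cons IH /=; lia. Qed.

(** With [sum_balanced] this translates between the combinatorics of Wick pairings and fillings of
    1-chains. *)
Lemma sum0_balanced l :
  (forall f : X * X -> int, antisym f -> \sum_(d <- l) f d = 0) -> balanced l.
Proof.
move=> h; apply/balancedP => -[x y].
have [->|xy] := eqVneq x y; first by [].
by have := h _ (dart_count xy); rewrite (sum_dart_count l (x, y)) => /eqP; rewrite subr_eq0 => /eqP[].
Qed.

Definition zdarts T := [:: (T.1.1, T.1.2); (T.1.2, T.2); (T.2, T.1.1)].

End Balanced.

Definition ztri_orient (T : Z2 * Z2 * Z2) : int := eps3 T.1.1 T.1.2 T.2.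

(** * Fillings of lattice polygons *)

Section Lattice.
Variables (R : realType) (n : nat) (v : 'I_n -> Z2).
Hypothesis n2 : (2 < n)%N.
Local Notation pt := (R * R)%type.
Local Notation tri := (pt * pt * pt)%type.

Definition vertices : seq pt := [seq plane R (v i) | i <- enum 'I_n].
Local Notation s := vertices.

Lemma size_vertices : size s = n.
Proof. by rewrite size_map size_enum_ord. Qed.

Lemma edges_vertices : edges s = [seq (plane R (v i), plane R (v (ordS i))) | i <- enum 'I_n].
Proof.
have n0 : (0 < n)%N by apply: leq_trans n2.
pose i0 := Ordinal n0.
rewrite /edges /vertices -map_rot.
suff -> : rot 1 (enum 'I_n) = [seq ordS i | i <- enum 'I_n].
  by rewrite -map_comp zip_map.
apply: (@eq_from_nth _ i0); first by rewrite size_rot size_map.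
rewrite size_rot size_enum_ord => i ilt.
rewrite (nth_map i0) ?size_enum_ord //; apply: val_inj => /=.
rewrite nth_enum_ord //.
rewrite /rot nth_cat size_drop size_enum_ord nth_drop.
case: ltnP => h.
  have h1 : (i.+1 < n)%N by move: h; clear; lia.
  by rewrite add1n nth_enum_ord // modn_small.
have -> : i = n.-1 by move: h ilt; clear; lia.
by rewrite subn1 subnn nth_take // nth_enum_ord // prednK // modnn.
Qed.

Lemma edge_pointE k t : edge_point v k t = lin (plane R (v k)) (plane R (v (ordS k))) t.
Proof. by []. Qed.

Lemma boundaryE : @boundary R n v = bd (edges s).
Proof.
apply/seteqP; split => x.
  move=> [k [t [t01 ->]]]; exists (plane R (v k), plane R (v (ordS k))); last by exists t.
  by rewrite edges_vertices; apply/mapP; exists k; rewrite ?mem_enum.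
move=> [e]; rewrite edges_vertices => /mapP[k _ ->] [t [t01 ->]].
by exists k, t.
Qed.

Lemma plane_inj : injective (plane R).
Proof. by case=> a b [c d] [] /intr_inj -> /intr_inj ->. Qed.

Hypothesis simple_v : simple_polygon R v.

Lemma v_inj : injective v.
Proof.
move=> i j ij; have z01 : 0 <= (0 : R) < 1 by rewrite lexx ltr01.
by case: (simple_v z01 z01 (k := i) (l := j)); rewrite // !edge_pointE !lin0 ij.
Qed.

Lemma simple_vertices : simple s.
Proof.
split; first by rewrite size_vertices.
  by rewrite map_inj_uniq ?enum_uniq // => i j /plane_inj/v_inj.
move=> e f q; rewrite edges_vertices => /mapP[k _ ->] /mapP[l _ ->] [t [t01 ->]] [u [u01 E]].
by have [-> _] := simple_v t01 u01 E.
Qed.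

Hypothesis clockwise_v : clockwise v.

Lemma shoelace_antisym : antisym (fun e : pt * pt => e.1.1 * e.2.2 - e.2.1 * e.1.2).
Proof. by move=> a b /=; rewrite opprB. Qed.

(** For [k = 0] the polygon would be cut into counterclockwise triangles, and its shoelace sum would
    be nonnegative. *)
Lemma jordan_vertices : [/\ valued s 1, sided s 1 &
  forall p, ~ bd (edges s) p -> windp (edges s) p = 0 -> far s p].
Proof.
have [k [k01 vl fr sd]] := jordan simple_vertices.
suff k1 : k = 1 by rewrite k1 in vl sd; split.
case: k01 => // k0.
have [tau [_ pos _ fl _]] := triangulation simple_vertices (or_introl k0) sd vl.
have := fl _ _ shoelace_antisym; rewrite /=.
suff /lt_eqF h : \sum_(e <- edges s) (e.1.1 * e.2.2 - e.2.1 * e.1.2) <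
  \sum_(T <- tau) \sum_(e <- tedges T) (e.1.1 * e.2.2 - e.2.1 * e.1.2) by move=> E; rewrite E eqxx in h.
apply: (@lt_le_trans _ _ 0).
  move: clockwise_v; rewrite /clockwise -(ltr_int R) rmorph_sum /=.
  rewrite edges_vertices big_map big_enum /=; congr (_ < _).
  by apply: eq_bigr => i _; rewrite rmorphB !rmorphM.
rewrite big_seq sumr_ge0 // => -[[x y] z] /pos.
rewrite k0 /torient /orient /tedges !big_cons big_nil /= mulr0 sub0r => h; lra.
Qed.

Lemma valued_vertices : valued s 1. Proof. by case: jordan_vertices. Qed.

(** Value 0 puts the point on a component that contains a vertical ray and is unbounded. Value 1 is
    constant on the component, while it is 0 outside a bounding square. *)
Lemma interiorE (m : Z2) : (@polygon R n v `\` @boundary R n v) (plane R m) <->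
  ~ bd (edges s) (plane R m) /\ windp (edges s) (plane R m) = 1.
Proof.
have [vl _ fr] := jordan_vertices.
rewrite /polygon boundaryE; split.
  move=> [[//|[_ bounded]] nb]; split=> //.
  case: (vl _ nb) => [w0|]; last by rewrite mulr1.
  have [c [z0 h]] := fr _ nb w0.
  exfalso; have [M [_ /(_ (`|M| + 1))]] := bounded.
  have Mlt : M < `|M| + 1 by have := ler_norm M; lra.
  move=> /(_ Mlt) /= /(_ _ (h (Num.max z0 (`|M| + 2)) _)).
  rewrite le_max lexx => /(_ isT); rewrite prod_normE /= ge_max => /andP[_].
  rewrite leNgt => /negP; apply; rewrite (lt_le_trans _ (ler_norm _)) // lt_max.
  by apply/orP; right; lra.
move=> [nb w1]; split => //; right; split => //.
have [B hB] := bound_exists s.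
exists B; split; first exact: num_real.
move=> M BM q /windp_linked; rewrite w1 => wq.
rewrite /= prod_normE /= ge_max; apply/andP; split; rewrite leNgt; apply/negP => h; move: wq;
  rewrite (windp_out hB) //; [left|right]; exact: lt_trans h.
Qed.

Variable N : nat.
Hypothesis box_v : forall i, in_box N (v i).

Definition lattice_interior : set Z2 := [set m : Z2 | (@polygon R n v `\` @boundary R n v) (plane R m)].

Lemma interior_box m : lattice_interior m -> in_box N m.
Proof.
move=> /interiorE[_ w1].
have hB : bound s (N%:R).
  move=> x /mapP[i _ ->] /=; have /andP[h1 h2] := box_v i.
  by split; rewrite -intr_norm -natr_absz ler_nat.
apply/andP; split; rewrite leqNgt; apply/negP => h; move: w1;
  rewrite (windp_out hB) //; [left|right];
  by rewrite /= -intr_norm -natr_absz ltr_nat.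
Qed.

Lemma finite_interior : finite_set lattice_interior.
Proof.
apply: (@sub_finite_set _ _ (val @` [set: box N])).
  by move=> m /interior_box h; exists (exist _ m h : box N).
exact: finite_image.
Qed.

Definition interior_points : seq Z2 := fset_set lattice_interior.

Lemma mem_interior_points m : (m \in interior_points) = (m \in lattice_interior).
Proof. exact: (in_fset_set finite_interior). Qed.

Lemma uniq_interior_points : uniq interior_points.
Proof. exact: fset_uniq. Qed.

Lemma size_interior_points : size interior_points = ell_star R v.
Proof. by []. Qed.

Local Notation dart := (Z2 * Z2)%type.
Local Notation ztri := (Z2 * Z2 * Z2)%type.

Definition polygon_darts : seq dart := [seq (v i, v (ordS i)) | i <- enum 'I_n].
(** The order is reversed: [omega] selects counterclockwise triangles, whose darts cancel those of
    the polygon, whereas a filling consists of clockwise triangles, whose edges add up to it. *)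
Definition plane_tri (T : ztri) : tri := (plane R T.2, plane R T.1.2, plane R T.1.1).

Lemma torient_plane T : torient (plane_tri T) = (ztri_orient T)%:~R.
Proof.
case: T => -[[i1 i2] [j1 j2]] [k1 k2]; rewrite /torient /orient /ztri_orient /eps3 /plane_tri /plane /=.
by rewrite !(rmorphB, rmorphM) /=; ring.
Qed.

Lemma sum_plane_tri (V : zmodType) (f : pt * pt -> V) T : antisym f ->
  \sum_(e <- tedges (plane_tri T)) f e = - \sum_(d <- zdarts T) f (plane R d.1, plane R d.2).
Proof.
case: T => -[i j] k af; rewrite /tedges /zdarts /plane_tri !big_cons !big_nil /= !addr0.
by rewrite (af (plane R j) (plane R k)) (af (plane R i) (plane R j)) (af (plane R k) (plane R i)) !opprD addrCA.
Qed.

Lemma sum_polygon_darts (V : zmodType) (f : pt * pt -> V) :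
  \sum_(e <- edges s) f e = \sum_(d <- polygon_darts) f (plane R d.1, plane R d.2).
Proof. by rewrite edges_vertices // !big_map. Qed.

(* The corners of the filling outside the vertices are interior lattice points. *)
Theorem balanced_size_le (tau : seq ztri) : (forall T, T \in tau -> 0 < ztri_orient T) ->
  balanced (polygon_darts ++ flatten [seq zdarts T | T <- tau]) ->
  (size tau + 2 <= n + 2 * ell_star R v)%N.
Proof.
move=> pos bal.
have [tau0 [sz0 pos0 cs0 fl0 S]] := triangulation simple_vertices (or_intror erefl)
  (let: And3 _ sd _ := jordan_vertices in sd) valued_vertices.
have -> : (n + 2 * ell_star R v = size s + 2 * size [seq plane R m | m <- interior_points])%N.
  by rewrite size_vertices size_map.
rewrite -(size_map plane_tri tau); apply: (filling_size_le simple_vertices valued_vertices (S erefl)).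
- by move=> _ /mapP[T Tt ->]; rewrite torient_plane ltr0z pos.
- move=> V f af; rewrite sum_polygon_darts big_map.
  under eq_bigr do rewrite sum_plane_tri //.
  have := sum_balanced (f := fun d => f (plane R d.1, plane R d.2)) bal.
  rewrite big_cat big_flatten big_map /= sumrN => h.
  by apply/eqP; rewrite eq_sym -addr_eq0; apply/eqP/h => a b; exact: af.
- by rewrite map_inj_uniq ?uniq_interior_points //; exact: plane_inj.
- move=> _ p /mapP[T Tt ->] pc pb w1.
  have [m pm] : exists m, p = plane R m.
    by move: pc; rewrite /corners !inE => /or3P[]/eqP->; eexists.
  apply/mapP; exists m => //; rewrite mem_interior_points inE; apply/interiorE.
  by rewrite -pm.
Qed.

Definition unplane (p : pt) : Z2 := (Num.floor p.1, Num.floor p.2).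

Lemma planeK : cancel (plane R) unplane.
Proof. by case=> a b; rewrite /unplane /= !intrKfloor. Qed.

(** The last clause allows these triangles to be read as triples of matrix indices. *)
Theorem balanced_exists : exists tau : seq ztri, [/\ forall T, T \in tau -> 0 < ztri_orient T,
  balanced (polygon_darts ++ flatten [seq zdarts T | T <- tau]),
  (size tau + 2 = n + 2 * ell_star R v)%N &
  forall T d, T \in tau -> d \in zdarts T -> in_box N d.1 /\ in_box N d.2].
Proof.
have [tau0 [sz0 pos0 cs0 fl0 S]] := triangulation simple_vertices (or_intror erefl)
  (let: And3 _ sd _ := jordan_vertices in sd) valued_vertices.
have pos1 : positive tau0 by move=> T /pos0; rewrite mul1r.
have [||tau [pos fl cs sz]] := add_points (P := map (plane R) interior_points) pos1 fl0 cs0.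
- by rewrite map_inj_uniq ?uniq_interior_points //; exact: plane_inj.
- by move=> _ /mapP[m mI ->]; apply/interiorE; move: mI; rewrite mem_interior_points inE.
have lat T p : T \in tau -> p \in corners T -> exists2 m, p = plane R m & in_box N m.
  move=> Tt /(cs _ Tt); rewrite mem_cat => /orP[/mapP[m]|/mapP[i _ ->]]; last by exists (v i).
  by rewrite mem_interior_points inE => /interior_box; exists m.
have lat3 x y z : (x, y, z) \in tau -> exists m1 m2 m3,
    [/\ (x, y, z) = (plane R m1, plane R m2, plane R m3), in_box N m1, in_box N m2 & in_box N m3].
  move=> Tt; have h := lat _ _ Tt.
  have [|m1 -> b1] := h x; first by rewrite inE eqxx.
  have [|m2 -> b2] := h y; first by rewrite !inE eqxx orbT.
  have [|m3 -> b3] := h z; first by rewrite !inE eqxx !orbT.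
  by exists m1, m2, m3.
pose back (T : tri) : ztri := (unplane T.2, unplane T.1.2, unplane T.1.1).
have backK T : T \in tau -> plane_tri (back T) = T.
  case: T => -[x y] z /lat3[m1 [m2 [m3 [-> _ _ _]]]].
  by rewrite /plane_tri /back /= !planeK.
exists (map back tau); split.
- by move=> _ /mapP[T Tt ->]; rewrite -(ltr0z R) -torient_plane backK // pos.
- apply: sum0_balanced => f af.
  pose g (e : pt * pt) := f (unplane e.1, unplane e.2).
  have ag : antisym g by move=> a b; rewrite /g /= af.
  have fE d : g (plane R d.1, plane R d.2) = f d by rewrite /g /= !planeK; case: d.
  have E : \sum_(d <- polygon_darts) f d = \sum_(T <- tau) \sum_(e <- tedges T) g e.
    by rewrite (fl _ g ag) sum_polygon_darts; apply: eq_bigr => d _; rewrite fE.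
  rewrite big_cat big_flatten /= [X in _ + X]big_map E big_map.
  rewrite -big_split /= big_seq big1 // => T Tt.
  rewrite -{1}(backK _ Tt) sum_plane_tri //; apply/eqP; rewrite addrC subr_eq0; apply/eqP.
  by apply: eq_bigr => d _; rewrite fE.
- rewrite size_map sz size_map size_interior_points addnAC sz0 size_vertices //.
- move=> _ d /mapP[[[x y] z] /lat3[m1 [m2 [m3 [-> b1 b2 b3]]]] ->].
  by rewrite /back /zdarts /= !planeK !inE => /or3P[]/eqP->.
Qed.

End Lattice.

(** * Gaussian integrals *)

Section GaussianMoments.
Variable R : realType.
Local Notation mu := (@lebesgue_measure R).
Implicit Types (c x : R) (p : nat).

Definition gmono c p x : R := x ^+ p * expR (- (c * x ^+ 2)).

Lemma is_derive_gmono c p x :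
  is_derive x 1 (gmono c p) (p%:R * gmono c p.-1 x - 2 * c * gmono c p.+1 x).
Proof.
have -> : gmono c p = (id ^+ p) * (expR \o (- (c \*: (id ^+ 2 : R -> R)))).
  by apply/funext => y; rewrite /gmono !fctE.
have d2 := is_deriveN (is_deriveZ c (is_deriveX 2 (is_derive_id x (1 : R)))).
have d1 := is_deriveM (is_deriveX p (is_derive_id x (1 : R))) (is_derive1_comp (is_derive_expR _) d2).
apply: (is_derive_eq d1).
rewrite !fctE /gmono /GRing.scale /= !exprS; ring.
Qed.

Lemma continuous_gmono c p : continuous (gmono c p).
Proof.
move=> x; apply/differentiable_continuous/derivable1_diffP.
by case: (is_derive_gmono c p x).
Qed.

Lemma measurable_gmono c p : measurable_fun [set: measurableTypeR R] (gmono c p).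
Proof. apply: continuous_measurable_fun; exact: continuous_gmono. Qed.

Lemma gmono_le c p : 0 < c -> exists K, forall x, `|gmono c p x| <= K * gmono (c / 2) 0 x.
Proof.
move=> c0; pose K := 1 + (2 / c) ^+ p.+1 * p.+1`!%:R.
exists K => x; rewrite /gmono expr0 mul1r normrM normrX (ger0_norm (expR_ge0 _)).
pose y := c / 2 * x ^+ 2.
have y0 : 0 <= y by rewrite mulr_ge0 ?sqr_ge0 // divr_ge0 // ltW.
have -> : expR (- (c * x ^+ 2)) = expR (- y) * expR (- y) by rewrite -expRD /y; congr expR; field.
rewrite mulrA -/y; apply: ler_wpM2r; first exact: expR_ge0.
rewrite expRN ler_pdivrMr ?expR_gt0 //.
have e1 : y ^+ p.+1 <= p.+1`!%:R * expR y.
  have := expR_ge1Dxn p y0; rewrite -ler_pdivrMl ?ltr0n ?fact_gt0 // mulrC.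
  by apply: le_trans; rewrite lerDr.
have e2 : 1 <= expR y by rewrite -expR0 ler_expR.
have e3 : `|x| ^+ p <= 1 + (x ^+ 2) ^+ p.+1.
  rewrite -real_normK ?num_real // -exprM.
  have [h|h] := lerP `|x| 1.
    by rewrite (@le_trans _ _ 1) ?exprn_ile1 // lerDl exprn_ge0.
  apply: (@le_trans _ _ (`|x| ^+ (2 * p.+1))); last by rewrite lerDr.
  by rewrite ler_weXn2l ?(ltW h) //; lia.
apply: le_trans e3 _; rewrite mulrDl mul1r lerD //.
have -> : x ^+ 2 = 2 / c * y by rewrite /y; field; rewrite lt0r_neq0.
rewrite exprMn -mulrA ler_wpM2l // exprn_ge0 // divr_ge0 // ltW //.
Qed.

Lemma gauss_normal c : 0 < c -> exists2 s, s != 0 & exists2 k, 0 < k &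
  forall x, gmono c 0 x = k * normal_pdf 0 s x.
Proof.
move=> c0; pose s := Num.sqrt (2 * c)^-1.
have s2 : s ^+ 2 = (2 * c)^-1 by rewrite sqr_sqrtr // invr_ge0 mulr_ge0 // ltW.
have s0 : s != 0 by rewrite -sqrf_eq0 s2 invr_eq0 mulf_neq0 // lt0r_neq0.
exists s => //; exists (normal_peak s)^-1; first by rewrite invr_gt0 normal_peak_gt0.
move=> x; rewrite normal_pdfE //= mulrA mulVf ?mul1r; last by rewrite lt0r_neq0 // normal_peak_gt0.
rewrite /gmono expr0 mul1r /normal_fun subr0 s2; congr expR; field.
by rewrite lt0r_neq0.
Qed.

Lemma integrable_gmono c p : 0 < c -> mu.-integrable setT (EFin \o gmono c p).
Proof.
move=> c0; have [K hK] := gmono_le p c0.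
have c20 : 0 < c / 2 by rewrite divr_gt0.
have [s s0 [k k0 E]] := gauss_normal c20.
apply: (@le_integrable _ _ _ mu _ measurableT _ (fun x => (K * k)%:E * (normal_pdf 0 s x)%:E)%E).
- apply/measurable_EFinP; exact: measurable_gmono.
- move=> x _ /=; rewrite lee_fin (le_trans (hK x)) // E mulrA ler_norm //.
- apply: integrableZl => //; exact: integrable_normal_pdf.
Qed.

Lemma integrable_scaled_gmono a c p : 0 < c -> mu.-integrable setT (EFin \o (fun x => a * gmono c p x)).
Proof. by move=> c0; have := integrableZl measurableT a (integrable_gmono p c0). Qed.

Definition moment c p : R := \int[mu]_x gmono c p x.

Lemma moment0_gt0 c : 0 < c -> 0 < moment c 0.
Proof.
move=> c0; have [s s0 [k k0 E]] := gauss_normal c0.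
rewrite /moment; under eq_Rintegral do rewrite E.
rewrite RintegralZl //; last exact: integrable_normal_pdf.
by rewrite /Rintegral integral_normal_pdf //= mulr1.
Qed.

Lemma gmono_decay c p : 0 < c -> exists K, forall x, `|x| * `|gmono c p x| <= K.
Proof.
move=> c0; have [K hK] := gmono_le p.+1 c0; exists K => x.
have -> : `|x| * `|gmono c p x| = `|gmono c p.+1 x| by rewrite -normrM mulrA -exprS.
have e0 y : gmono (c / 2) 0 y = expR (- (c / 2 * y ^+ 2)) by rewrite /gmono expr0 mul1r.
have K0 : 0 <= K.
  by have := le_trans (normr_ge0 _) (hK 0); rewrite e0 expr0n mulr0 oppr0 expR0 mulr1.
apply: le_trans (hK x) _; rewrite e0 ler_piMr // expR_le1 oppr_le0.
by rewrite mulr_ge0 ?sqr_ge0 // divr_ge0 // ltW.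
Qed.

Lemma gmono_cvg0 c p (u : R^nat) : 0 < c -> (forall n, `|u n| = n.+1%:R) -> gmono c p (u n) @[n --> \oo] --> 0.
Proof.
move=> c0 hu; have [K hK] := gmono_decay p c0.
apply: norm_cvg0; apply: (@squeeze_cvgr _ _ _ _ (cst 0) (fun n => K * n.+1%:R^-1)).
- apply: nearW => n; rewrite normr_ge0 /= ler_pdivlMr ?ltr0n // mulrC -hu; exact: hK.
- exact: cvg_cst.
- rewrite -[X in _ --> X](mulr0 K); apply: cvgM; [exact: cvg_cst|exact: cvg_harmonic].
Qed.

(** Integration by parts: the derivative of [gmono c p] has integral 0, as the limit of its
    integrals over the intervals [I n], whose boundary terms tend to 0. For [p = 0] the truncated
    index is harmless because of the factor [p%:R]. *)
Lemma moment_rec c p : 0 < c -> 2 * c * moment c p.+1 = p%:R * moment c p.-1.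
Proof.
move=> c0; have i1 := integrable_scaled_gmono p%:R p.-1 c0.
have i2 := integrable_scaled_gmono (2 * c) p.+1 c0.
pose q x := p%:R * gmono c p.-1 x - 2 * c * gmono c p.+1 x.
have cq : continuous q.
  by move=> x; apply: cvgB; apply: cvgM; try exact: cvg_cst; exact: continuous_gmono.
have iq : mu.-integrable setT (EFin \o q).
  by have := integrableB measurableT i1 i2.
suff : \int[mu]_x q x = 0.
  rewrite /q RintegralB // !RintegralZl ?integrable_gmono // => /eqP.
  by rewrite subr_eq0 eq_sym => /eqP.
pose I n : set R := [set` `[- n.+1%:R, n.+1%:R]].
have lim0 : (fun n => \int[mu]_(x in I n) (q x)%:E)%E @ \oo --> (0%R%:E : \bar R).
  have -> : (fun n => \int[mu]_(x in I n) (q x)%:E)%E =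
      EFin \o (fun n => gmono c p n.+1%:R - gmono c p (- n.+1%:R)).
    apply/funext => n; rewrite /I (@continuous_FTC2 _ q (gmono c p)) //.
    - by rewrite gtrN.
    - exact: continuous_subspaceT.
    - split; first by move=> x _; case: (is_derive_gmono c p x).
        by apply: cvg_at_right_filter; exact: continuous_gmono.
      by apply: cvg_at_left_filter; exact: continuous_gmono.
    - by move=> x _; rewrite derive1E; case: (is_derive_gmono c p x).
  apply: cvg_EFin; first exact: nearW.
  rewrite -(subr0 0); apply: cvgB; apply: gmono_cvg0 => // n; by rewrite ?normrN normr_nat.
have mI n : measurable (I n : set (measurableTypeR R)) by exact: measurable_itv.
have [||||| _ _ limq] := @dominated_convergence _ _ _ mu setT measurableT
  (fun n x => (q \_ (I n) x)%:E) (EFin \o q) (abse \o (EFin \o q)).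
- move=> n; apply/measurable_EFinP; apply/(measurable_restrictT _ (mI n)).
  by apply: measurable_funTS; apply: continuous_measurable_fun.
- by case/integrableP: iq.
- apply: aeW => x _; apply: cvg_EFin; first exact: nearW.
  apply: cvg_near_cst; near=> n.
  rewrite /= patchE ifT // inE /I /= in_itv /= -ler_norml.
  near: n; exists (Num.truncn `|x|) => // n /= xn.
  by rewrite (le_trans (ltW (truncnS_gt _))) // ler_nat ltnS.
- exact: integrable_abse.
- apply: aeW => x n _; rewrite /= patchE; case: ifP => // _.
  by rewrite normr0 lee_fin.
have E : (fun n => \int[mu]_x (q \_ (I n) x)%:E)%E = (fun n => \int[mu]_(x in I n) (q x)%:E)%E.
  by apply/funext => n; rewrite [RHS]integral_mkcond restrict_EFin.
rewrite /= E in limq; rewrite /Rintegral -(cvg_unique _ lim0 limq) //.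
Unshelve. all: end_near. Qed.

End GaussianMoments.

(** * Product functions and iterated Lebesgue measure *)

Section ProductIntegral.
Local Open Scope ereal_scope.
Context d1 d2 (T1 : measurableType d1) (T2 : measurableType d2) (R : realType).
Variables (m1 : {sigma_finite_measure set T1 -> \bar R}) (m2 : {sigma_finite_measure set T2 -> \bar R}).
Variables (g : T1 -> R) (f : T2 -> R).
Hypotheses (ig : m1.-integrable setT (EFin \o g)) (If : m2.-integrable setT (EFin \o f)).

Let gf (z : T1 * T2) := (g z.1 * f z.2)%:E.

Let mgf : measurable_fun setT gf.
Proof.
have /measurable_EFinP mg := measurable_int _ ig.
have /measurable_EFinP mf := measurable_int _ If.
apply/measurable_EFinP; apply: measurable_funM.
  by apply: (measurableT_comp mg); exact: measurable_fst.
by apply: (measurableT_comp mf); exact: measurable_snd.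
Qed.

Lemma integrable_prod : (m1 \x m2).-integrable setT gf.
Proof.
apply/integrable12ltyP => //.
have -> : (fun x => \int[m2]_y `|gf (x, y)|) =
          (fun x => `|(EFin \o g) x| * \int[m2]_y `|(EFin \o f) y|).
  apply/funext => x; rewrite -ge0_integralZl //.
  - by apply: eq_integral => y _; rewrite /gf EFinM abseM.
  - by apply: measurableT_comp => //; exact: measurable_int If.
have /integrableP[mg gy] := ig.
have /integrableP[mf fy] := If.
rewrite ge0_integralZr //; last 2 first.
- by apply: measurableT_comp.
- exact: integral_ge0.
by rewrite lte_mul_pinfty ?integral_ge0 // ge0_fin_numE // integral_ge0.
Qed.

Lemma integral_prod : \int[m1 \x m2]_z gf z = (\int[m1]_x (g x)%:E) * (\int[m2]_y (f y)%:E).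
Proof.
rewrite -(integral12_prod_meas1 integrable_prod) /fubini_F.
have fF : \int[m2]_y (f y)%:E \is a fin_num by exact: integrable_fin_num.
rewrite -(fineK fF) -integralZr //.
apply: eq_integral => x _; rewrite fineK // -integralZl //.
Qed.

End ProductIntegral.

Section SigmaFiniteCopy.
Context d (T : measurableType d) (R : realType).
Implicit Type m : {measure set T -> \bar R}.

(** An alias on which a proof of sigma-finiteness becomes a structure, as Fubini's theorem requires;
    [lebesgue_tuple] itself is only declared as a measure. *)
Definition sigma_finite_copy m of sigma_finite setT m : set T -> \bar R := m.

Variables (m : {measure set T -> \bar R}) (sf : sigma_finite setT m).

HB.instance Definition _ := Measure.copy (sigma_finite_copy sf) m.
HB.instance Definition _ := Measure_isSigmaFinite.Build _ _ R (sigma_finite_copy sf) sf.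

End SigmaFiniteCopy.

Section LebesgueTuple.
Variable R : realType.
Local Notation mu := (@lebesgue_measure R).

Lemma sigma_finite_lebesgue_tuple n : sigma_finite setT (lebesgue_tuple R n).
Proof.
elim: n => [|n [F FT hF]].
  apply: fin_num_fun_sigma_finite; first by rewrite measure0.
  by move=> A mA; rewrite /= /dirac fin_numE.
have [G GT hG] := sigma_finiteT mu.
pose H (k : nat * nat) : set (n.+1.-tuple (measurableTypeR R)) :=
  [set u | G k.1 (thead u) /\ F k.2 [tuple of behead u]].
exists (fun m => oapp H set0 (choice.unpickle m)).
  apply/seteqP; split=> // u _.
  have [k1 _ h1] : (\bigcup_i G i) (thead u) by rewrite -GT.
  have [k2 _ h2] : (\bigcup_i F i) [tuple of behead u] by rewrite -FT.
  by exists (choice.pickle (k1, k2)) => //; rewrite choice.pickleK.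
move=> m; case: (choice.unpickle m) => [[k1 k2]|]; last by split; [exact: measurable0|rewrite measure0].
have [mG Gy] := hG k1; have [mF Fy] := hF k2.
split => /=.
  have -> : H (k1, k2) = (fun u => tnth u ord0) @^-1` G k1 `&`
      (fun u : n.+1.-tuple (measurableTypeR R) => [tuple of behead u]) @^-1` F k2.
    by apply/seteqP; split=> u.
  apply: measurableI.
    by rewrite -[X in measurable X]setTI; apply: measurable_tnth.
  rewrite -[X in measurable X]setTI; apply: measurable_behead => //.
rewrite /= /cons_measure /pushforward.
have -> : @tuple_cons R n @^-1` H (k1, k2) = F k2 `*` G k1.
  have B x y : [tuple of behead_tuple (tuple_cons (x, y))] = x :> n.-tuple (measurableTypeR R).
    exact: val_inj.
  by apply/seteqP; split=> -[x y]; rewrite /H /= theadE B => -[].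
by rewrite product_measure1E // lte_mul_pinfty // ge0_fin_numE.
Qed.

Definition tuple_prod n (phi : nat -> R -> R) (u : n.-tuple (measurableTypeR R)) : R :=
  \prod_(i < n) phi i (tnth u i).

Lemma tuple_prod_cons n phi z : tuple_prod phi (@tuple_cons R n z) = tuple_prod (fun i => phi i.+1) z.1 * phi 0%N z.2.
Proof.
rewrite /tuple_prod big_ord_recl mulrC /tuple_cons (tnth_nth 0) /=; congr (_ * _).
by apply: eq_bigr => i _; rewrite !(tnth_nth 0).
Qed.

Lemma measurable_tuple_prod n phi : (forall i, measurable_fun [set: measurableTypeR R] (phi i)) ->
  measurable_fun setT (@tuple_prod n phi).
Proof.
move=> mphi; apply: measurable_prod => i _.
apply: (measurableT_comp (mphi i)); exact: measurable_tnth.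
Qed.

Lemma tuple_prod_integral n (phi : nat -> R -> R) : (forall i, mu.-integrable setT (EFin \o phi i)) ->
  (lebesgue_tuple R n).-integrable setT (EFin \o tuple_prod phi) /\
  \int[lebesgue_tuple R n]_u tuple_prod phi u = \prod_(i < n) \int[mu]_x phi i x.
Proof.
elim: n phi => [|n IH] phi iphi.
  have E1 : tuple_prod phi = cst 1 :> (0.-tuple (measurableTypeR R) -> R).
    by apply/funext => u; rewrite /tuple_prod big_ord0.
  have d1 : lebesgue_tuple R 0 setT = 1%E by rewrite /= diracE in_setT.
  rewrite E1 big_ord0; split.
    apply/integrableP; split; first by apply/measurable_EFinP; exact: measurable_cst.
    rewrite (_ : (fun x => `|(EFin \o cst 1%R) x|)%E = cst 1%E); last by apply/funext => x /=; rewrite normr1.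
    by rewrite integral_cst // d1 mule1 ltry.
  by rewrite Rintegral_cst // d1 mulr1.
have mphi i : measurable_fun [set: measurableTypeR R] (phi i).
  by apply/measurable_EFinP; exact: measurable_int (iphi i).
have [iG IG] := IH (fun i => phi i.+1) (fun i => iphi i.+1).
pose m1 := sigma_finite_copy (sigma_finite_lebesgue_tuple n).
have i1 := @integrable_prod _ _ _ _ R m1 mu _ _ iG (iphi 0%N).
have I1 := @integral_prod _ _ _ _ R m1 mu _ _ iG (iphi 0%N).
have FE : (EFin \o tuple_prod phi) \o @tuple_cons R n =
    (fun z => (tuple_prod (fun i => phi i.+1) z.1 * phi 0%N z.2)%:E).
  by apply/funext => z /=; rewrite tuple_prod_cons.
have mF : measurable_fun setT (EFin \o @tuple_prod n.+1 phi).
  by apply/measurable_EFinP; exact: measurable_tuple_prod.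
have i2 : (product_measure1 (lebesgue_tuple R n) mu).-integrable
    (@tuple_cons R n @^-1` setT) ((EFin \o tuple_prod phi) \o @tuple_cons R n).
  by rewrite preimage_setT FE.
split.
  exact: (integrable_pushforward (@measurable_tuple_cons R n) mF i2 measurableT).
rewrite {1}/Rintegral.
have -> : (\int[lebesgue_tuple R n.+1]_u (tuple_prod phi u)%:E =
    (\prod_(i < n.+1) \int[mu]_x phi i x)%:E)%E.
  apply: etrans (integral_pushforward (@measurable_tuple_cons R n) mF i2 measurableT) _.
  rewrite preimage_setT FE; apply: etrans I1 _.
  rewrite big_ord_recl mulrC EFinM; congr (_ * _)%E.
    rewrite /= -IG /Rintegral fineK //; exact: integrable_fin_num.
  rewrite /Rintegral fineK //; exact: (integrable_fin_num measurableT (iphi 0%N)).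
by [].
Qed.

End LebesgueTuple.

(** * Gaussian integration by parts for polynomials *)

Section GaussianIntegral.
Variables (R : realType) (n : nat) (c : nat -> R).
Hypothesis c_gt0 : forall k, 0 < c k.
Local Notation C := R[i].
Local Notation T := (n.-tuple (measurableTypeR R)).
Implicit Types (e : nat -> nat) (u : T) (f g : T -> C) (p q : seq (C * (nat -> nat))) (k j : 'I_n).

Definition cint f : C := ((\int[lebesgue_tuple R n]_u complex.Re (f u)) +i* (\int[lebesgue_tuple R n]_u complex.Im (f u)))%C.

Definition xmono e u : R := \prod_(i < n) tnth u i ^+ e i.
Definition weight u : R := \prod_(i < n) expR (- (c i * tnth u i ^+ 2)).
Definition mweight e : R := \prod_(i < n) moment (c i) (e i).

Lemma xmono_weight e : (fun u => xmono e u * weight u) = tuple_prod (fun i => gmono (c i) (e i)).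
Proof. by apply/funext => u; rewrite /xmono /weight -big_split. Qed.

Lemma integrable_xmono e : (lebesgue_tuple R n).-integrable setT (EFin \o (fun u => xmono e u * weight u)).
Proof.
rewrite xmono_weight.
by case: (@tuple_prod_integral R n (fun i => gmono (c i) (e i)) (fun i => integrable_gmono _ (c_gt0 i))).
Qed.

Lemma integral_xmono e : \int[lebesgue_tuple R n]_u (xmono e u * weight u) = mweight e.
Proof.
rewrite xmono_weight.
by case: (@tuple_prod_integral R n (fun i => gmono (c i) (e i)) (fun i => integrable_gmono _ (c_gt0 i))).
Qed.

Definition evalp p u : C := \sum_(t <- p) t.1 * (xmono t.2 u)%:C%C.

Lemma complex_Re_mulr (z : C) (x : R) : complex.Re (z * x%:C%C) = complex.Re z * x.
Proof. by case: z => a b /=; rewrite mulr0 subr0. Qed.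

Lemma complex_Im_mulr (z : C) (x : R) : complex.Im (z * x%:C%C) = complex.Im z * x.
Proof. by case: z => a b /=; rewrite mulr0 add0r. Qed.

Lemma integral_lincomb (X : Type) (s : seq X) (a : X -> R) (F : X -> T -> R) (I : X -> R) :
  (forall x, (lebesgue_tuple R n).-integrable setT (EFin \o F x)) ->
  (forall x, \int[lebesgue_tuple R n]_u F x u = I x) ->
  (lebesgue_tuple R n).-integrable setT (EFin \o (fun u => \sum_(x <- s) a x * F x u)) /\
  \int[lebesgue_tuple R n]_u (\sum_(x <- s) a x * F x u) = \sum_(x <- s) a x * I x.
Proof.
move=> iF IF; elim: s => [|x s [ih IH]].
  have -> : (fun u : T => \sum_(x <- [::]) a x * F x u) = cst 0.
    by apply/funext => u; rewrite big_nil.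
  split; first exact: integrable0.
  by rewrite big_nil /Rintegral integral0.
have -> : (fun u : T => \sum_(y <- x :: s) a y * F y u) = (fun u => a x * F x u + \sum_(y <- s) a y * F y u).
  by apply/funext => u; rewrite big_cons.
have ix : (lebesgue_tuple R n).-integrable setT (EFin \o (fun u => a x * F x u)).
  by have := integrableZl measurableT (a x) (iF x).
split; first by have := integrableD measurableT ix ih.
by rewrite RintegralD // RintegralZl // IF IH big_cons.
Qed.

Lemma cint_evalp p : cint (fun u => evalp p u * (weight u)%:C%C) = \sum_(t <- p) t.1 * (mweight t.2)%:C%C.
Proof.
have [_ hr] := integral_lincomb p (fun t => complex.Re t.1) (fun t => integrable_xmono t.2) (fun t => integral_xmono t.2).
have [_ hi] := integral_lincomb p (fun t => complex.Im t.1) (fun t => integrable_xmono t.2) (fun t => integral_xmono t.2).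
rewrite /cint.
have -> : (fun u => complex.Re (evalp p u * (weight u)%:C%C)) =
    (fun u => \sum_(t <- p) complex.Re t.1 * (xmono t.2 u * weight u)).
  apply/funext => u; rewrite /evalp mulr_suml raddf_sum; apply: eq_bigr => t _.
  by rewrite -mulrA -rmorphM; exact: complex_Re_mulr.
have -> : (fun u => complex.Im (evalp p u * (weight u)%:C%C)) =
    (fun u => \sum_(t <- p) complex.Im t.1 * (xmono t.2 u * weight u)).
  apply/funext => u; rewrite /evalp mulr_suml raddf_sum; apply: eq_bigr => t _.
  by rewrite -mulrA -rmorphM; exact: complex_Im_mulr.
rewrite hr hi; apply/eqP; rewrite eq_complex /= !raddf_sum; apply/andP; split; apply/eqP.
  by apply: eq_bigr => t _; exact/esym/complex_Re_mulr.
by apply: eq_bigr => t _; exact/esym/complex_Im_mulr.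
Qed.

Definition shiftp k p := [seq (t.1, fun i => (t.2 i + (i == k :> nat))%N) | t <- p].
(** The formal partial derivative; the truncated subtraction at exponent 0 comes with the
    coefficient 0. *)
Definition dpoly k p := [seq ((t.2 k)%:R * t.1, fun i => (t.2 i - (i == k :> nat))%N) | t : C * (nat -> nat) <- p].

(** A relation through a common formal polynomial, so that the derivative need not be shown
    independent of the representation. *)
Definition has_diff k f g := exists p, (forall u, f u = evalp p u) /\ (forall u, g u = evalp (dpoly k p) u).

Lemma evalp_cat p q u : evalp (p ++ q) u = evalp p u + evalp q u.
Proof. by rewrite /evalp big_cat. Qed.

Lemma xmono_shift e k u : xmono (fun i => (e i + (i == k :> nat))%N) u = tnth u k * xmono e u.
Proof.
rewrite /xmono (bigD1 k) //= [in RHS](bigD1 k) //= eqxx addn1 exprS -mulrA; congr (_ * (_ * _)).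
by apply: eq_bigr => i; rewrite -val_eqE /= => /negbTE->; rewrite addn0.
Qed.

Lemma evalp_shift k p u : evalp (shiftp k p) u = (tnth u k)%:C%C * evalp p u.
Proof.
rewrite /evalp big_map mulr_sumr; apply: eq_bigr => t _ /=.
by rewrite xmono_shift rmorphM mulrCA.
Qed.

Lemma diff_shift j k p u : evalp (dpoly k (shiftp j p)) u =
  (tnth u j)%:C%C * evalp (dpoly k p) u + (j == k)%:R * evalp p u.
Proof.
rewrite /evalp !big_map !mulr_sumr -big_split; apply: eq_bigr => -[a e] _ /=.
have [<-|jk] := eqVneq j k; rewrite ?eqxx.
  rewrite mul1r (_ : xmono _ u = xmono e u); last first.
    by apply: eq_bigr => i _; rewrite addnK.
  rewrite natrD !mulrDl mul1r; congr (_ + _).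
  have [e0|e0] := posnP (e j); first by rewrite e0 !mul0r mulr0.
  rewrite mulrCA -rmorphM -xmono_shift; congr (_ * _%:C%C).
  apply: eq_bigr => i _; congr (_ ^+ _); have [ij|_] := eqVneq (i : nat) j; last by rewrite subn0 addn0.
  by rewrite ij subn1 addn1 prednK.
have kj : (k == j :> nat) = false by rewrite eq_sym; exact/negbTE.
rewrite mul0r addr0 kj addn0 [in RHS]mulrCA -rmorphM -xmono_shift; congr (_ * _%:C%C).
apply: eq_bigr => i _; congr (_ ^+ _); have [->|_] := eqVneq (i : nat) k; last by rewrite !subn0.
by rewrite kj !addn0.
Qed.

Lemma has_diff_ext k f f' g g' : f =1 f' -> g =1 g' -> has_diff k f g -> has_diff k f' g'.
Proof. by move=> ff gg [p [fp gp]]; exists p; split=> u; rewrite -(ff, gg). Qed.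

Lemma has_diff1 k : has_diff k (fun=> 1) (fun=> 0).
Proof.
exists [:: (1, fun=> 0%N)]; split=> u; rewrite /evalp big_seq1 /=.
  by rewrite mul1r /xmono big1 // => i _; rewrite expr0.
by rewrite !mul0r.
Qed.

Lemma has_diffD k f1 g1 f2 g2 : has_diff k f1 g1 -> has_diff k f2 g2 ->
  has_diff k (fun u => f1 u + f2 u) (fun u => g1 u + g2 u).
Proof.
move=> [p1 [h1 h2]] [p2 [h3 h4]]; exists (p1 ++ p2); split=> u.
  by rewrite evalp_cat h1 h3.
by rewrite /dpoly map_cat evalp_cat h2 h4.
Qed.

Lemma has_diffZ k a f g : has_diff k f g -> has_diff k (fun u => a * f u) (fun u => a * g u).
Proof.
move=> [p [h1 h2]]; exists [seq (a * t.1, t.2) | t <- p]; split=> u.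
  by rewrite h1 /evalp big_map mulr_sumr; apply: eq_bigr => t _; rewrite mulrA.
rewrite h2 /evalp !big_map mulr_sumr; apply: eq_bigr => t _ /=.
by rewrite mulrA [a * _]mulrCA.
Qed.

Lemma has_diffX k j f g : has_diff k f g ->
  has_diff k (fun u => (tnth u j)%:C%C * f u) (fun u => (tnth u j)%:C%C * g u + (j == k)%:R * f u).
Proof.
move=> [p [h1 h2]]; exists (shiftp j p); split=> u; first by rewrite evalp_shift h1.
by rewrite diff_shift h1 h2.
Qed.

Lemma mweight_shift e k : (2 * c k) * mweight (fun i => (e i + (i == k :> nat))%N) =
  (e k)%:R * mweight (fun i => (e i - (i == k :> nat))%N).
Proof.
rewrite /mweight (bigD1 k) //= [in RHS](bigD1 k) //= eqxx addn1 subn1 !mulrA moment_rec //; congr (_ * _).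
by apply: eq_bigr => i; rewrite -val_eqE /= => /negbTE->; rewrite addn0 subn0.
Qed.

(** Stein's identity; on each monomial it is the moment recursion in the variable [k]. *)
Lemma cint_stein k f g : has_diff k f g ->
  (2 * c k)%:C%C * cint (fun u => (tnth u k)%:C%C * f u * (weight u)%:C%C) = cint (fun u => g u * (weight u)%:C%C).
Proof.
move=> [p [fp gp]].
have -> : (fun u => (tnth u k)%:C%C * f u * (weight u)%:C%C) = (fun u => evalp (shiftp k p) u * (weight u)%:C%C).
  by apply/funext => u; rewrite evalp_shift fp.
have -> : (fun u => g u * (weight u)%:C%C) = (fun u => evalp (dpoly k p) u * (weight u)%:C%C).
  by apply/funext => u; rewrite gp.
rewrite !cint_evalp !big_map mulr_sumr; apply: eq_bigr => t _ /=.
rewrite mulrCA -rmorphM mweight_shift rmorphM rmorph_nat; ring.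
Qed.

Definition polyfun f := exists p, forall u, f u = evalp p u.

Lemma cint_lincomb (X : Type) (s : seq X) (a : X -> C) (F : X -> T -> C) : (forall x, polyfun (F x)) ->
  cint (fun u => (\sum_(x <- s) a x * F x u) * (weight u)%:C%C) =
  \sum_(x <- s) a x * cint (fun u => F x u * (weight u)%:C%C).
Proof.
move=> /boolp.choice [P hP].
pose p := flatten [seq [seq (a x * t.1, t.2) | t <- P x] | x <- s].
have pE u : \sum_(x <- s) a x * F x u = evalp p u.
  rewrite /evalp big_flatten big_map; apply: eq_bigr => x _.
  by rewrite hP /evalp big_map mulr_sumr; apply: eq_bigr => t _; rewrite mulrA.
have -> : (fun u => (\sum_(x <- s) a x * F x u) * (weight u)%:C%C) = (fun u => evalp p u * (weight u)%:C%C).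
  by apply/funext => u; rewrite pE.
rewrite cint_evalp big_flatten big_map; apply: eq_bigr => x _.
have -> : (fun u => F x u * (weight u)%:C%C) = (fun u => evalp (P x) u * (weight u)%:C%C).
  by apply/funext => u; rewrite hP.
by rewrite cint_evalp big_map mulr_sumr; apply: eq_bigr => t _; rewrite mulrA.
Qed.

Lemma has_diff_polyfun k f g : has_diff k f g -> polyfun f.
Proof. by move=> [p [h _]]; exists p. Qed.

Lemma has_diff_polyfun2 k f g : has_diff k f g -> polyfun g.
Proof. by move=> [p [_ h]]; exists (dpoly k p). Qed.

Lemma polyfunX k f : polyfun f -> polyfun (fun u => (tnth u k)%:C%C * f u).
Proof. by move=> [p h]; exists (shiftp k p) => u; rewrite evalp_shift h. Qed.

Lemma cint_lincomb2 a b f g : polyfun f -> polyfun g ->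
  cint (fun u => (a * f u + b * g u) * (weight u)%:C%C) =
  a * cint (fun u => f u * (weight u)%:C%C) + b * cint (fun u => g u * (weight u)%:C%C).
Proof.
move=> pf pg; have := cint_lincomb [:: true; false] (fun x => if x then a else b)
  (F := fun x => if x then f else g) (fun x => if x as b return polyfun (if b then f else g) then pf else pg).
rewrite !big_cons big_nil addr0 => <-; congr cint; apply/funext => u.
by rewrite !big_cons big_nil addr0.
Qed.

Lemma cint1_gt0 : 0 < cint (fun u => (weight u)%:C%C).
Proof.
have -> : (fun u => (weight u)%:C%C) = (fun u => evalp [:: (1, fun=> 0%N)] u * (weight u)%:C%C).
  apply/funext => u; rewrite /evalp big_seq1 /xmono big1 ?mulr1 ?mul1r // => i _.
rewrite cint_evalp big_seq1 mul1r ltcR prodr_gt0 // => i _; exact: moment0_gt0.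
Qed.

End GaussianIntegral.

(** * Wick's rule for Hermitian matrices *)

Section Hermitian.
Variables (R : realType) (d : nat).
Local Notation C := R[i].
Local Notation T := ((d * d).-tuple (measurableTypeR R)).
Implicit Types (u : T) (e : 'I_d * 'I_d) (l : seq ('I_d * 'I_d)) (k : 'I_(d * d)) (x y : 'I_d).

(** Half of Tr(H^2) is the sum of the squares of H_ii over 2 and of Re(H_ij)^2 + Im(H_ij)^2 for i <
    j. Hence the rate is 1/2 exactly at the diagonal positions. *)
Definition coefw (k : nat) : R :=
  if [exists i : 'I_d, mxvec_index i i == k :> nat] then 2^-1 else 1.

Lemma coefw_gt0 (k : nat) : 0 < coefw k.
Proof. by rewrite /coefw; case: ifP => // _; rewrite invr_gt0. Qed.

Lemma mxvec_index_inj x y x' y' : mxvec_index x y = mxvec_index x' y' -> (x, y) = (x', y').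
Proof.
have [f fK _] := curry_mxvec_bij d d.
have E p : f (uncurry (@mxvec_index d d) p) = p by exact: fK.
by move/(congr1 f); have := E (x, y); have := E (x', y'); rewrite /= => -> ->.
Qed.

Lemma coefw_index x y : coefw (mxvec_index x y) = if x == y then 2^-1 else 1.
Proof.
rewrite /coefw; have [->|xy] := eqVneq x y.
  by rewrite ifT //; apply/existsP; exists y.
rewrite ifF //; apply/negbTE/existsP => -[i /eqP/val_inj/mxvec_index_inj[]] ix iy.
by rewrite -ix -iy eqxx in xy.
Qed.

Lemma weight_herm u : gauss_weight (herm_of u) = weight coefw u.
Proof.
rewrite /gauss_weight /weight -expR_sum; congr expR.
rewrite sumrN; congr (- _).
rewrite (reindex _ (curry_mxvec_bij d d)) /=.
pose c i j : R := tnth u (mxvec_index i j).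
transitivity ((\sum_i \sum_j (if i == j then c i i ^+ 2 else c i j ^+ 2 + c j i ^+ 2)) / 2).
  congr (_ / 2); rewrite /mxtrace raddf_sum /=; apply: eq_bigr => i _.
  rewrite mxE raddf_sum; apply: eq_bigr => j _.
  rewrite !mxE -/(c i i) -/(c j j) -/(c i j) -/(c j i).
  have [->|ij] := eqVneq i j; first by rewrite /=; ring.
  have [lt|gt|/val_inj eij] := ltngtP i j; [| |by rewrite eij eqxx in ij].
    by rewrite /=; ring.
  by rewrite /=; ring.
pose D i j : R := if i == j then 0 else c i j ^+ 2.
have -> : \sum_i \sum_j (if i == j then c i i ^+ 2 else c i j ^+ 2 + c j i ^+ 2) =
  \sum_i c i i ^+ 2 + \sum_i \sum_j D i j + \sum_i \sum_j D j i.
  rewrite -!big_split; apply: eq_bigr => i _ /=; rewrite -addrA -big_split.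
  rewrite [in LHS](bigD1 i) //= [in X in _ = _ + X](bigD1 i) //= /D !eqxx addr0 add0r.
  by congr (_ + _); apply: eq_bigr => j ji; rewrite eq_sym (negbTE ji).
rewrite [X in _ + X]exchange_big /=.
transitivity (\sum_i \sum_j coefw (mxvec_index i j) * c i j ^+ 2); last first.
  by rewrite pair_bigA; apply: eq_bigr => -[i j].
rewrite -addrA mulrDl mulrDl -splitr mulr_suml -big_split; apply: eq_bigr => i _ /=.
rewrite [in LHS](bigD1 i) //= [in RHS](bigD1 i) //= /D eqxx add0r coefw_index eqxx mulrC.
by congr (_ + _); apply: eq_bigr => j ij; rewrite coefw_index eq_sym (negbTE ij) mul1r.
Qed.

(** [rep] and [imp] are the positions of the real and imaginary parts of the entry [e], and [ims] is
    the factor of the latter: plus or minus the imaginary unit, or 0 on the diagonal. *)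
Definition rep e := if (e.1 <= e.2)%N then mxvec_index e.1 e.2 else mxvec_index e.2 e.1.
Definition imp e := if (e.1 <= e.2)%N then mxvec_index e.2 e.1 else mxvec_index e.1 e.2.
Definition ims e : C := if (e.1 < e.2)%N then 'i%C else if (e.2 < e.1)%N then - 'i%C else 0.

Lemma herm_entry u e : herm_of u e.1 e.2 = (tnth u (rep e))%:C%C + ims e * (tnth u (imp e))%:C%C.
Proof.
case: e => i j; rewrite mxE /rep /imp /ims /=.
have [->|ij] := eqVneq i j; first by rewrite leqnn ltnn mul0r addr0.
have [lt|gt|/val_inj eij] := ltngtP i j; [| |by rewrite eij eqxx in ij].
  by apply/eqP; rewrite eq_complex /=; apply/andP; split; apply/eqP; ring.
by apply/eqP; rewrite eq_complex /=; apply/andP; split; apply/eqP; ring.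
Qed.

Definition mono l (H : 'M[C]_d) : C := \prod_(e <- l) H e.1 e.2.

Fixpoint dmono k l u : C :=
  if l is e :: l' then
    ((rep e == k)%:R + ims e * (imp e == k)%:R) * mono l' (herm_of u) + herm_of u e.1 e.2 * dmono k l' u
  else 0.

Lemma has_diff_mono k l : has_diff k (fun u => mono l (herm_of u)) (dmono k l).
Proof.
elim: l => [|e l IH].
  apply: has_diff_ext _ _ (has_diff1 _ k) => u //; by rewrite /mono big_nil.
apply: has_diff_ext _ _ (has_diffD (has_diffX (rep e) IH) (has_diffZ (ims e) (has_diffX (imp e) IH))) => u.
  by rewrite /mono big_cons herm_entry; ring.
by rewrite /= herm_entry; ring.
Qed.

Lemma polyfun_mono l : polyfun (fun u => mono l (herm_of u)).
Proof.
case: l => [|e l]; last exact: has_diff_polyfun (has_diff_mono (rep e) (e :: l)).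
exists [:: (1, fun=> 0%N)] => u.
by rewrite /mono big_nil /evalp big_seq1 mul1r /xmono big1 // => i _; rewrite expr0.
Qed.

Lemma rep_imp e : (rep e = mxvec_index e.1 e.2 /\ imp e = mxvec_index e.2 e.1) \/
  (rep e = mxvec_index e.2 e.1 /\ imp e = mxvec_index e.1 e.2).
Proof. by rewrite /rep /imp; case: ifP; [left|right]. Qed.

Lemma rep_flip e : e.1 != e.2 -> rep (flip e) = rep e /\ imp (flip e) = imp e.
Proof.
by case: e => x y /= xy; rewrite /rep /imp /=; case: ltngtP => // /val_inj h; rewrite h eqxx in xy.
Qed.

Lemma rep_neq_imp e : e.1 != e.2 -> rep e != imp e.
Proof.
move=> xy; apply/eqP => h; move: (rep_imp e) xy; rewrite -h.
by case=> -[->] /mxvec_index_inj[->]; rewrite eqxx.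
Qed.

Lemma ims_sqr e : e.1 != e.2 -> ims e * ims e = -1.
Proof.
case: e => x y /= xy; rewrite /ims /=.
have ii : 'i%C * 'i%C = -1 :> C by rewrite -expr2 sqr_i.
by case: ltngtP => [_|_|/val_inj h]; rewrite ?mulrNN //; rewrite h eqxx in xy.
Qed.

Lemma ims_flip e : ims (flip e) = - ims e.
Proof. by case: e => x y; rewrite /ims /=; case: ltngtP; rewrite ?opprK ?oppr0. Qed.

Lemma rep_mem e e' : e'.1 != e'.2 ->
  [\/ rep e = rep e', rep e = imp e', imp e = rep e' | imp e = imp e'] -> e = e' \/ e = flip e'.
Proof.
case: e => i j; case: e' => x y /= xy.
by case: (rep_imp (i, j)) => -[-> ->]; case: (rep_imp (x, y)) => -[-> ->] /=;
  case=> /mxvec_index_inj[-> ->]; auto.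
Qed.

(** The combination of the derivatives along [rep e'] and [imp e'] is twice the Wirtinger derivative
    by the conjugate of the entry [e'], that is, by the entry [flip e']. It annihilates every other
    entry. *)
Lemma dirac_entry e e' : e'.1 != e'.2 ->
  (rep e == rep e')%:R + ims e * (imp e == rep e')%:R +
  ims e' * ((rep e == imp e')%:R + ims e * (imp e == imp e')%:R) = 2 * (e == flip e')%:R.
Proof.
move=> xy; have ab := rep_neq_imp xy; have ba : imp e' != rep e' by rewrite eq_sym.
have [->|n1] := eqVneq e (flip e').
  have [-> ->] := rep_flip xy; rewrite !eqxx (negbTE ab) (negbTE ba) ims_flip.
  by rewrite mulr0 addr0 add0r mulr1 mulrN ims_sqr // opprK mulr1.
have [->|n2] := eqVneq e e'.
  by rewrite !eqxx (negbTE ab) (negbTE ba) mulr0 addr0 add0r mulr1 ims_sqr // subrr mulr0.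
have no : ~ (e = e' \/ e = flip e') by case=> h; rewrite h eqxx in n1 n2.
have f1 : (rep e == rep e') = false by apply/negP => /eqP h; apply/no/rep_mem/Or41.
have f2 : (rep e == imp e') = false by apply/negP => /eqP h; apply/no/rep_mem/Or42.
have f3 : (imp e == rep e') = false by apply/negP => /eqP h; apply/no/rep_mem/Or43.
have f4 : (imp e == imp e') = false by apply/negP => /eqP h; apply/no/rep_mem/Or44.
by rewrite f1 f2 f3 f4 !(mulr0, addr0).
Qed.

Lemma dmono_flip e l u : e.1 != e.2 ->
  dmono (rep e) l u + ims e * dmono (imp e) l u =
  2 * (count_mem (flip e) l)%:R * mono (rem (flip e) l) (herm_of u).
Proof.
move=> xy; elim: l => [|e' l IH] /=; first by rewrite !mulr0 addr0 mul0r.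
transitivity (2 * (e' == flip e)%:R * mono l (herm_of u) +
  herm_of u e'.1 e'.2 * (dmono (rep e) l u + ims e * dmono (imp e) l u)).
  by rewrite -dirac_entry //; ring.
rewrite IH; have [->|ne] := eqVneq e' (flip e).
  rewrite natrD [in RHS](mulrDr 2) [RHS]mulrDl; congr (_ + _).
  have [c0|c0] := posnP (count_mem (flip e) l); first by rewrite c0 !mulr0 !mul0r mulr0.
  have el : flip e \in l by rewrite -has_pred1 has_count.
  by rewrite mulrCA /mono [in RHS](perm_big _ (perm_to_rem el)) big_cons.
by rewrite mulr0 mul0r add0r add0n mulrCA /mono big_cons.
Qed.

Local Notation E l := (cint (fun u => mono l (herm_of u) * (weight coefw u)%:C%C)).

Lemma coefw_rep e : e.1 != e.2 -> coefw (rep e) = 1 /\ coefw (imp e) = 1.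
Proof.
move=> xy; have yx : e.2 != e.1 by rewrite eq_sym.
by case: (rep_imp e) => -[-> ->]; rewrite !coefw_index (negbTE xy) (negbTE yx).
Qed.

(** Stein's identity along the two real coordinates of the entry [e], both of rate 1. The resulting
    factor 2 cancels the one in [dmono_flip]. *)
Lemma wick e l : e.1 != e.2 -> E (e :: l) = (count_mem (flip e) l)%:R * E (rem (flip e) l).
Proof.
move=> xy; have [c1 c2] := coefw_rep xy.
have s1 := cint_stein coefw_gt0 (has_diff_mono (rep e) l).
have s2 := cint_stein coefw_gt0 (has_diff_mono (imp e) l).
rewrite c1 mulr1 in s1; rewrite c2 mulr1 in s2.
apply: (@mulfI _ (2%:R%:C%C)); first by rewrite fmorph_eq0 pnatr_eq0.
have p2 := polyfun_mono (rem (flip e) l).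
have -> : (fun u => mono (e :: l) (herm_of u) * (weight coefw u)%:C%C) =
  (fun u => (1 * ((tnth u (rep e))%:C%C * mono l (herm_of u)) +
    ims e * ((tnth u (imp e))%:C%C * mono l (herm_of u))) * (weight coefw u)%:C%C).
  by apply/funext => u; congr (_ * _); rewrite /mono big_cons herm_entry; ring.
rewrite cint_lincomb2 //; try exact/polyfunX/polyfun_mono; try exact: coefw_gt0.
rewrite mulrDr mul1r s1 mulrCA s2 -[X in X + _]mul1r -cint_lincomb2; last 3 first.
- exact: coefw_gt0.
- exact: has_diff_polyfun2 (has_diff_mono _ _).
- exact: has_diff_polyfun2 (has_diff_mono _ _).
transitivity (cint (fun u => (2 * (count_mem (flip e) l)%:R * mono (rem (flip e) l) (herm_of u) +
   0 * mono (rem (flip e) l) (herm_of u)) * (weight coefw u)%:C%C)).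
  by congr cint; apply/funext => u; rewrite mul1r dmono_flip // mul0r addr0.
rewrite cint_lincomb2 //; last exact: coefw_gt0.
by rewrite mul0r addr0 mulrA rmorph_nat.
Qed.

Definition offdiag l := all (fun e => e.1 != e.2) l.

Lemma balanced_cons2 e l : balanced (e :: flip e :: l) <-> balanced l.
Proof.
have sw e' : (flip e == e') = (e == flip e') by rewrite -(inj_eq (inv_inj (@flipK _))) flipK.
have fl e' : (flip e == flip e') = (e == e') by rewrite (inj_eq (inv_inj (@flipK _))).
split=> /balancedP h; apply/balancedP => e'; have := h e'; rewrite /= sw fl addnCA.
  by move=> /eqP; rewrite !eqn_add2l => /eqP.
by move=> ->.
Qed.

Lemma balanced_perm l l' : perm_eq l l' -> balanced l <-> balanced l'.
Proof.
move=> /permP p; split=> /balancedP h; apply/balancedP => e; first by rewrite -!p h.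
by rewrite !p h.
Qed.

(** By induction with [wick]: removing the head together with one reversal of it preserves both
    balance and its failure. Without a reversal the integral is 0, and the list is not balanced
    because [e] and [flip e] differ off the diagonal. *)
Lemma E_balanced l : offdiag l ->
  (balanced l -> 0 < E l) /\ (~ balanced l -> E l = 0).
Proof.
have [m] := ubnP (size l); elim: m l => // m IH [|e l].
  move=> _ _; split=> [_|]; last by case.
  rewrite (_ : (fun u => _) = (fun u => (weight coefw u)%:C%C)); last first.
    by apply/funext => u; rewrite /mono big_nil mul1r.
  exact: cint1_gt0 coefw_gt0.
rewrite /= ltnS => sl /andP[xy od]; rewrite wick //.
have [c0|c0] := posnP (count_mem (flip e) l).
  rewrite c0 mul0r; split=> // /balancedP /(_ e) /=.
  have -> : (e == flip e) = false.
    by case: e xy {sl c0} => a b /= ab; rewrite /flip /= xpair_eqE (negbTE ab).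
  by rewrite eqxx c0.
have el : flip e \in l by rewrite -has_pred1 has_count.
have pl : perm_eq (e :: l) (e :: flip e :: rem (flip e) l) by rewrite perm_cons perm_to_rem.
have [||h1 h2] := IH (rem (flip e) l).
- by rewrite (leq_ltn_trans _ sl) // size_rem // leq_pred.
- by apply/allP => e' /mem_rem; apply: (allP od).
have bl : balanced (e :: l) <-> balanced (rem (flip e) l).
  exact: iff_trans (balanced_perm pl) (balanced_cons2 _ _).
split=> [/bl/h1 E0|nb]; first by rewrite mulr_gt0 // ltr0n.
by rewrite h2 ?mulr0 // => /bl.
Qed.

Lemma gauss_avgE (P : 'M[C]_d -> C) :
  gauss_avg P = cint (fun u => P (herm_of u) * (weight coefw u)%:C%C) / E [::].
Proof.
rewrite /gauss_avg; congr (_ / _).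
  rewrite [LHS](_ : _ = cint (fun u => P (herm_of u) * (gauss_weight (herm_of u))%:C%C)) //.
  by congr cint; apply/funext => u; rewrite weight_herm.
rewrite [LHS](_ : _ = cint (fun u => (gauss_weight (herm_of u : 'M[C]_d))%:C%C)) //.
by congr cint; apply/funext => u; rewrite weight_herm /mono big_nil mul1r.
Qed.

Lemma gauss_avg_lincomb (X : Type) (s : seq X) (a : X -> C) (L : X -> seq ('I_d * 'I_d)) :
  gauss_avg (fun H => \sum_(x <- s) a x * mono (L x) H) = \sum_(x <- s) a x * gauss_avg (mono (L x)).
Proof.
rewrite gauss_avgE (cint_lincomb coefw_gt0 s a (F := fun (z : X) u => mono (L z) (herm_of u))).
  by rewrite mulr_suml; apply: eq_bigr => x _; rewrite gauss_avgE mulrA.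
by move=> x; exact: polyfun_mono.
Qed.

Lemma gauss_avg_mono_gt0 l : offdiag l -> balanced l -> 0 < gauss_avg (mono l).
Proof.
move=> od bl; rewrite gauss_avgE divr_gt0 //; first by case: (E_balanced od) => /(_ bl).
by case: (E_balanced (l := [::])) => // /(_ isT).
Qed.

Lemma gauss_avg_mono_eq0 l : offdiag l -> ~ balanced l -> gauss_avg (mono l) = 0.
Proof. by move=> od bl; rewrite gauss_avgE; case: (E_balanced od) => _ /(_ bl) ->; rewrite mul0r. Qed.

End Hermitian.

(** * The correlator *)

Section Series.
Variables (I : finType) (K : fieldType).
Local Notation PS := (fpseries I K).
Implicit Types (f g : PS) (a b : K).

Lemma ps_mulE f g m : (f * g) m = \sum_(p <- splits m) f p.1 * g p.2.
Proof. by []. Qed.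

Lemma ps_scaleE a f m : (a *: f) m = a * f m.
Proof. by []. Qed.

Lemma ps_sumE (X : Type) (s : seq X) (F : X -> PS) m : (\sum_(x <- s) F x) m = \sum_(x <- s) F x m.
Proof. by elim: s => [|x s IH]; rewrite ?big_nil // !big_cons -IH. Qed.

Lemma ps_mul_scale a b f g : (a *: f) * (b *: g) = (a * b) *: (f * g).
Proof.
apply/funext => m; rewrite ps_scaleE !ps_mulE mulr_sumr; apply: eq_bigr => p _.
by rewrite !ps_scaleE mulrACA.
Qed.

Lemma ps_prod_scale (X : Type) (s : seq X) (a : X -> K) (F : X -> PS) :
  \prod_(x <- s) (a x *: F x) = (\prod_(x <- s) a x) *: \prod_(x <- s) F x.
Proof.
elim: s => [|x s IH]; first by rewrite !big_nil scale1r.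
by rewrite !big_cons IH ps_mul_scale.
Qed.

(** Constant terms are multiplicative; nonvanishing of the correlator is read off from its constant
    term. *)
Lemma ps_mul0E f g : (f * g) 0 = f 0 * g 0.
Proof.
rewrite ps_mulE (bigD1_seq (0, 0)) ?uniq_splits ?mem_splits ?add0r //=.
rewrite big_seq_cond big1 ?addr0 // => -[p q] /andP[]; rewrite mem_splits => /eqP pq.
suff -> : (p, q) == (0, 0) by [].
rewrite xpair_eqE; apply/andP; split; apply/eqP/ffunP => i; have := congr1 (fun h : {ffun I -> nat} => h i) pq;
  rewrite !ffunE /= => /eqP; rewrite addn_eq0 => /andP[/eqP h1 /eqP h2] //.
Qed.

Lemma ps_prod0E (X : Type) (s : seq X) (F : X -> PS) : (\prod_(x <- s) F x) 0 = \prod_(x <- s) F x 0.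
Proof.
elim: s => [|x s IH]; last by rewrite !big_cons ps_mul0E IH.
by rewrite !big_nil; rewrite [LHS]/(@ps_one I K 0) /ps_one eqxx.
Qed.

Lemma ps_exp0E f : ps_exp f 0 = 1.
Proof.
have e0 : (\sum_i (0%R : {ffun I -> nat}) i = 0)%N by apply: big1 => i _; rewrite ffunE.
rewrite /ps_exp e0 big_ord_recl big_ord0 addr0 /= expr0 fact0 invr1 mul1r.
by rewrite [LHS]/(@ps_one I K 0) /ps_one eqxx.
Qed.

End Series.

Section Reduction.
Variables (R : realType) (N : nat).
Local Notation C := R[i].
Local Notation B := (box N).
Local Notation X := (B * B * B)%type.
Local Notation PS := (fpseries B C).
Local Notation D := #|{: B}|.

Definition coords (e : B * B) : 'I_D * 'I_D := (enum_rank e.1, enum_rank e.2).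
Definition omega3 (T : X) : PS := @omega R N T.1.1 T.1.2 T.2.

Lemma mono_coords (l : seq (B * B)) (H : hmatrix R N) : mono (map coords l) H = \prod_(e <- l) entry H e.1 e.2.
Proof. by rewrite /mono big_map. Qed.

Lemma potential_expr H k : @potential R N H ^+ k = \sum_(f : {ffun 'I_k -> X})
  (3^-1 ^+ k * \prod_(e <- flatten [seq zdarts (f a) | a <- enum 'I_k]) entry H e.1 e.2) *:
  \prod_(a < k) omega3 (f a).
Proof.
have -> : potential H = \sum_(T : X) (3^-1 * \prod_(e <- zdarts T) entry H e.1 e.2) *: omega3 T.
  rewrite /potential pair_bigA pair_bigA scaler_sumr; apply: eq_bigr => -[[i j] k'] _ /=.
  by rewrite scalerA /zdarts !big_cons big_nil mulr1 mulrA.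
have powE (A : comNzRingType) (x : A) : \prod_(a < k) x = x ^+ k by rewrite big_const_ord iter_mulr_1.
rewrite -powE.
rewrite bigA_distr_bigA; apply: eq_bigr => f _.
rewrite ps_prod_scale; congr (_ *: _).
rewrite big_split /= powE big_flatten big_map; congr (_ * _).
by rewrite big_enum.
Qed.

Lemma correlatorE n (i : 'I_n -> B) k m : correlator R i k m =
  \sum_(f : {ffun 'I_k -> X}) (k`!%:R^-1 * 3^-1 ^+ k) * (\prod_(a < k) omega3 (f a)) m *
   gauss_avg (@mono R D (map coords ([seq (i a, i (ordS a)) | a <- enum 'I_n] ++
     flatten [seq zdarts (f a) | a <- enum 'I_k]))).
Proof.
rewrite /correlator ps_scaleE /gauss_avg_ps.
have -> : (fun H : hmatrix R N => ((\prod_(a < n) entry H (i a) (i (ordS a))) *: potential H ^+ k) m) =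
  (fun H => \sum_(f : {ffun 'I_k -> X}) (3^-1 ^+ k * (\prod_(a < k) omega3 (f a)) m) *
    mono (map coords ([seq (i a, i (ordS a)) | a <- enum 'I_n] ++ flatten [seq zdarts (f a) | a <- enum 'I_k])) H).
  apply/funext => H; rewrite potential_expr ps_scaleE ps_sumE mulr_sumr; apply: eq_bigr => f _.
  rewrite ps_scaleE mono_coords big_cat /= big_map big_enum /=; ring.
rewrite gauss_avg_lincomb mulr_sumr; apply: eq_bigr => f _.
by rewrite !mulrA.
Qed.

End Reduction.

Lemma balanced_map (X Y : choiceType) (g : X -> Y) (l : seq (X * X)) : injective g ->
  balanced [seq (g e.1, g e.2) | e <- l] <-> balanced l.
Proof.
move=> gi; rewrite /balanced -map_comp.
have -> : [seq (@flip Y \o (fun e => (g e.1, g e.2))) e | e <- l] =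
          [seq (g e.1, g e.2) | e <- map (@flip X) l] by rewrite -map_comp.
split=> [|h]; last exact: perm_map.
by apply: perm_map_inj => -[a b] [a' b'] [/gi -> /gi ->].
Qed.

(** * The degree of the correlator *)

Section Positivity.
Variables (R : realType) (n : nat) (v : 'I_n -> Z2) (N : nat).
Hypotheses (n2 : (2 < n)%N) (simple_v : simple_polygon R v) (clockwise_v : clockwise v).
Variable i : 'I_n -> box N.
Hypothesis iE : forall a, val (i a) = v a.
Local Notation C := R[i].
Local Notation B := (box N).
Local Notation X := (B * B * B)%type.

Definition box_tri (T : X) : Z2 * Z2 * Z2 := (val T.1.1, val T.1.2, val T.2).

Definition all_darts k (f : {ffun 'I_k -> X}) : seq (B * B) :=
  [seq (i a, i (ordS a)) | a <- enum 'I_n] ++ flatten [seq zdarts (f a) | a <- enum 'I_k].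

Lemma box_v a : in_box N (v a). Proof. by rewrite -iE; exact: (valP (i a)). Qed.

Lemma val_darts k (f : {ffun 'I_k -> X}) : [seq (val e.1, val e.2) | e <- all_darts f] =
  polygon_darts v ++ flatten [seq zdarts T | T <- [seq box_tri (f a) | a <- enum 'I_k]].
Proof.
rewrite map_cat; congr (_ ++ _).
  by rewrite -map_comp; apply: eq_map => a /=; rewrite !iE.
by rewrite map_flatten -!map_comp; congr flatten; apply: eq_map => a.
Qed.

Lemma balanced_coords k (f : {ffun 'I_k -> X}) : balanced (map (@coords N) (all_darts f)) <->
  balanced (polygon_darts v ++ flatten [seq zdarts T | T <- [seq box_tri (f a) | a <- enum 'I_k]]).
Proof.
rewrite -val_darts; apply: iff_trans (balanced_map _ enum_rank_inj) (iff_sym (balanced_map _ val_inj)).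
Qed.

Lemma ztri_orient_neq (T : Z2 * Z2 * Z2) : 0 < ztri_orient T ->
  [/\ T.1.1 != T.1.2, T.1.2 != T.2 & T.2 != T.1.1].
Proof.
case: T => -[x y] z; rewrite /ztri_orient /eps3 /= => h.
by split; apply: contraTneq h => ->; rewrite ?subrr ?mulr0 ?mul0r ?subrr //; apply/negP; lia.
Qed.

Lemma offdiag_coords k (f : {ffun 'I_k -> X}) : (forall a, 0 < ztri_orient (box_tri (f a))) ->
  offdiag (map (@coords N) (all_darts f)).
Proof.
move=> pos; apply/allP => _ /mapP[e eE ->] /=; rewrite (inj_eq enum_rank_inj) -(inj_eq val_inj).
move: eE; rewrite mem_cat => /orP[/mapP[a _ ->]|/flattenP[_ /mapP[a _ ->]]] /=.
  rewrite !iE (inj_eq (v_inj simple_v)) -val_eqE /=.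
  have := ltn_ord a; rewrite leq_eqVlt => /orP[/eqP an|an]; last by rewrite modn_small // neq_ltn ltnSn.
  by rewrite an modnn -lt0n -ltnS an; exact: leq_trans n2.
have [h1 h2 h3] := ztri_orient_neq (pos a).
by rewrite !inE => /or3P[]/eqP->.
Qed.

Lemma omega3_eq0 (T : X) : ~~ (0 < ztri_orient (box_tri T)) -> omega3 R T = 0.
Proof. by move=> h; rewrite /omega3 /omega /ztri_orient /= in h *; rewrite (negbTE h). Qed.

Lemma omega3_at0 (T : X) : omega3 R T 0 = if 0 < ztri_orient (box_tri T) then 1 else 0.
Proof.
rewrite /omega3 /omega /ztri_orient /=; case: ifP => // _; exact: ps_exp0E.
Qed.

(** Every term vanishes separately: either some triangle is not counterclockwise and its [omega] is
    0, or the darts would have to balance with more triangles than [balanced_size_le] allows. *)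
Lemma correlator_eq0 k : (2 * ell_star R v + n - 2 < k)%N -> correlator R i k = 0.
Proof.
move=> kd; apply/funext => m; rewrite correlatorE big1 // => f _.
have [pos|] := boolP [forall a, 0 < ztri_orient (box_tri (f a))]; last first.
  rewrite negb_forall => /existsP[a /omega3_eq0 h].
  by rewrite (bigD1 a) //= h mul0r mulr0 mul0r.
move/forallP in pos; rewrite gauss_avg_mono_eq0 ?mulr0 //; first exact: offdiag_coords.
move=> /balanced_coords /(balanced_size_le n2 simple_v clockwise_v box_v) h.
have {h} : (k + 2 <= n + 2 * ell_star R v)%N.
  by rewrite -{1}(size_enum_ord k) -(size_map (fun a => box_tri (f a))); apply: h => _ /mapP[a _ ->].
by move: kd n2; clear; lia.
Qed.

Lemma correlator_neq0 : correlator R i (2 * ell_star R v + n - 2)%N != 0.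
Proof.
set k := (_ - 2)%N.
have [tau [pos bal sz inb]] := balanced_exists n2 simple_v clockwise_v box_v.
have szk : size tau = k by rewrite /k; move: sz n2; clear; lia.
have orig : in_box N (0, 0) by [].
pose o : B := exist _ (0, 0) orig.
pose lift (T : Z2 * Z2 * Z2) : X := (insubd o T.1.1, insubd o T.1.2, insubd o T.2).
have liftK T : T \in tau -> box_tri (lift T) = T.
  case: T => -[x y] z Tt; have h d := inb (x, y, z) d Tt.
  have [|bx byy] := h (x, y); first by rewrite inE eqxx.
  have [|_ bz] := h (y, z); first by rewrite !inE eqxx orbT.
  by rewrite /box_tri /lift /= !insubdK.
pose f : {ffun 'I_k -> X} := [ffun a : 'I_k => lift (nth (0 : Z2 * Z2 * Z2) tau a)].
have fE : [seq box_tri (f a) | a <- enum 'I_k] = tau.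
  apply: (@eq_from_nth _ (0 : Z2 * Z2 * Z2)); rewrite size_map size_enum_ord ?szk // => j jk.
  rewrite (nth_map (Ordinal jk)) ?size_enum_ord // ffunE nth_enum_ord // liftK //.
  by rewrite mem_nth // szk.
(* In the constant term each [omega] counts as 1 or 0, so all terms are nonnegative and the one of
   [f] is positive. *)
suff : 0 < correlator R i k 0 by apply: contraTneq => ->; rewrite [X in 0 < X](_ : _ = 0) // ltxx.
rewrite correlatorE.
have c0 : 0 < (k`!%:R^-1 * 3^-1 ^+ k : C).
  by rewrite mulr_gt0 ?exprn_gt0 ?invr_gt0 ?ltr0n ?fact_gt0.
have term0 (g : {ffun 'I_k -> X}) : 0 <= (k`!%:R^-1 * 3^-1 ^+ k) * (\prod_(a < k) omega3 R (g a)) 0 *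
   gauss_avg (@mono R _ (map (@coords N) (all_darts g))).
  rewrite ps_prod0E.
  have [posg|] := boolP [forall a, 0 < ztri_orient (box_tri (g a))]; last first.
    rewrite negb_forall => /existsP[a h].
    by rewrite (bigD1 a) //= omega3_at0 ifN // mul0r mulr0 mul0r.
  move/forallP in posg; rewrite mulr_ge0 //.
    rewrite mulr_ge0 ?(ltW c0) // prodr_ge0 // => a _; by rewrite omega3_at0; case: ifP.
  have [bg|nb] := pselect (balanced (map (@coords N) (all_darts g))).
    by apply/ltW/gauss_avg_mono_gt0 => //; exact: offdiag_coords.
  by rewrite gauss_avg_mono_eq0 //; exact: offdiag_coords.
rewrite (bigD1 f) //= ltr_pwDl ?sumr_ge0 //.
have posf a : 0 < ztri_orient (box_tri (f a)).
  by apply: pos; rewrite -fE; apply/mapP; exists a; rewrite ?mem_enum.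
rewrite mulr_gt0 //; last first.
  by apply: gauss_avg_mono_gt0; [exact: offdiag_coords|apply/balanced_coords; rewrite fE].
by rewrite mulr_gt0 // ps_prod0E big1 ?ltr01 // => a _; rewrite omega3_at0 posf.
Qed.

End Positivity.

Theorem mainTheorem2 (R : realType) (n : nat) (v : 'I_n -> Z2) :
  (2 < n)%N -> simple_polygon R v -> clockwise v ->
  exists N0 : nat, forall N : nat, (N0 <= N)%N ->
  exists i : 'I_n -> box N, (forall a : 'I_n, val (i a) = v a) /\
    highest_degree (correlator R i) (2 * ell_star R v + n - 2)%N.
Proof.
move=> n2 simple_v clockwise_v.
(* It suffices that the box contains the vertices: by [interior_box] it then contains the interior
   lattice points, which are the other corners used. *)
exists (\max_a maxn `|(v a).1| `|(v a).2|)%N => N leN.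
have inb a : in_box N (v a).
  have := leq_trans (leq_bigmax (F := fun a => maxn `|(v a).1| `|(v a).2|) a) leN.
  by rewrite geq_max.
pose i a : box N := exist _ (v a) (inb a).
exists i; split=> //; split; first exact: correlator_neq0.
by move=> k; exact: correlator_eq0.
Qed.
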